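(* Let $E$ be a Hilbert space and let $f_\varepsilon(u)=\frac12\|u\|^2-F(u)+G(\varepsilon,u)$, with critical manifold $Z=\{z_\theta:\theta\in\mathbb{R}^d\}$ of $f_0$, satisfy hypotheses (H), (F0)–(F4) and (G0)–(G5) listed in the context. Let $\theta\in\mathbb{R}^d$ and suppose that for every small $\varepsilon>0$ there is a critical point $u_\varepsilon\in Z_\varepsilon$ of $f_\varepsilon$ such that $u_\varepsilon=z_{\theta_\varepsilon}+w(\varepsilon,\theta_\varepsilon)$ and $\theta_\varepsilon\to\theta$ as $\varepsilon\to0$. Assume that $z_\theta=\lim_{\varepsilon\to 0} z_{\theta_\varepsilon}$ is nondegenerate for the restriction of $f_0$ to $(T_{z_\theta}Z)^\perp$, with Morse index equal to $m_0$, and that the Hessian matrix $D^2\Gamma(\theta)$ is positive definite or negative definite. Then, for small $\varepsilon$, $u_\varepsilon$ is a nondegenerate critical point of $f_\varepsilon$, with Morse index equal to $m_0$ if $D^2\Gamma(\theta)$ is positive definite, and to $m_0+d$ if $D^2\Gamma(\theta)$ is negative definite. As a consequence, the critical points $u_\varepsilon$ of $f_\varepsilon$ form a continuous curve (i.e. $\varepsilon\mapsto u_\varepsilon$ is continuous for small $\varepsilon>0$).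
   Context: Setting: $E$ is a Hilbert space with scalar product $(\cdot|\cdot)$ and norm $\|\cdot\|$, $I_E$ is its identity map, $L(E,E)$ is the space of continuous linear operators, $F:E\to\mathbb{R}$, $G:\mathbb{R}\times E\to\mathbb{R}$. $F'(u)\in E$ and $F''(u)\in L(E,E)$ are defined by $(F'(u)|v)=DF(u)[v]$, $(F''(u)v|w)=D^2F(u)[v,w]$, and $F'''(u)$ is the bilinear map $E\times E\to E$ with $(F'''(u)[v_1,v_2]|v_3)=D^3F(u)[v_1,v_2,v_3]$; $G'(\varepsilon,u),G''(\varepsilon,u),G'''(\varepsilon,u)$ are defined in the same way, differentiating with respect to $u$. Powers $\varepsilon^\alpha$ and limits $\varepsilon\to0$ are for $\varepsilon>0$. Hypotheses: (F0) $F\in C^2$. (F1) There is a $d$-dimensional $C^2$ manifold $Z\subset E$, $d\ge1$, of critical points of $f_0$, i.e. $z=F'(z)$ for all $z\in Z$. $Z$ is parametrized by a single map $\theta\mapsto z_\theta$, $\theta\in\mathbb{R}^d$; write $\partial_iz_\theta=\partial z_\theta/\partial\theta_i$, $\partial_{ij}z_\theta=\partial^2z_\theta/\partial\theta_i\partial\theta_j$. (F2) $F''(z)$ is compact for all $z\in Z$. (F3) $T_zZ=\ker[I_E-F''(z)]$ for all $z\in Z$, where $T_zZ$ is the tangent space. (F4) $F$ is of class $C^4$. (H) For all $\theta$: $(\partial_iz_\theta|\partial_jz_\theta)=0$ if $i\ne j$; $\|\partial_iz_\theta\|=c$ with $c$ independent of $i$ and $\theta$; $(\partial_{ij}z_\theta|\partial_lz_\theta)=0$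 for all $i,j,l=1,\dots,d$. (G0) $G$ is continuous on $\mathbb{R}\times E$ and $G(0,u)=0$ for all $u\in E$. (G1) $G$ is of class $C^2$ with respect to $u$. (G2) $(\varepsilon,u)\mapsto G'(\varepsilon,u)$ and $(\varepsilon,u)\mapsto G''(\varepsilon,u)$ are continuous from $\mathbb{R}\times E$ to $E$, resp. to $L(E,E)$. (G3) There are $\alpha>0$ and a continuous $\Gamma:Z\to\mathbb{R}$ such that for all $z\in Z$: $\Gamma(z)=\lim_{\varepsilon\to0}\varepsilon^{-\alpha}G(\varepsilon,z)$ and $G'(\varepsilon,z)=o(\varepsilon^{\alpha/2})$. Write $\Gamma(\theta)=\Gamma(z_\theta)$. (G4) $G$ is of class $C^4$ with respect to $u$ and $(\varepsilon,u)\mapsto G'''(\varepsilon,u)$ is continuous. (G5) $\Gamma$ is $C^2$ (as a function of $\theta$) and, whenever $\theta_\varepsilon\to\theta$ as $\varepsilon\to0$, for all $i,j$: $\lim_{\varepsilon\to0}[\varepsilon^{-\alpha}(G'(\varepsilon,z_{\theta_\varepsilon})|\partial_{ij}z_{\theta_\varepsilon})+\varepsilon^{-\alpha}(G''(\varepsilon,z_{\theta_\varepsilon})\partial_iz_{\theta_\varepsilon}|\partial_jz_{\theta_\varepsilon})]=\partial_{ij}\Gamma(\theta)$; $\lim_{\varepsilon\to0}\varepsilon^{-\alpha/2}G''(\varepsilon,z_{\theta_\varepsilon})\partial_iz_{\theta_\varepsilon}=0$; $\lim_{\varepsilon\to0}\varepsilon^{-\alpha/2}G''(\varepsilon,z_{\theta_\varepsilon})\partial_{ij}z_{\theta_\varepsilon}=0$;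 $\lim_{\varepsilon\to0}\varepsilon^{-\alpha/2}G'''(\varepsilon,z_{\theta_\varepsilon})[\partial_iz_{\theta_\varepsilon},\partial_jz_{\theta_\varepsilon}]=0$. The reduction: by the Implicit Function Theorem, for $\varepsilon$ small and (locally) $z=z_\eta\in Z$ there is a unique small $w=w(\varepsilon,\eta)=w(\varepsilon,z_\eta)\in E$ with $w\perp T_zZ$ and $f_\varepsilon'(z+w)\in T_zZ$ (where $f'_\varepsilon$ is the gradient of $f_\varepsilon$); it satisfies $\|w\|=o(\varepsilon^{\alpha/2})$ and $\|D_zw(\varepsilon,z)\|\to0$ as $\varepsilon\to0$. One sets $Z_\varepsilon=\{z+w(\varepsilon,z)\}$. A critical point $u$ of $f_\varepsilon$ is nondegenerate if the self-adjoint operator representing $D^2f_\varepsilon(u)$ is invertible; its Morse index is the maximal dimension of a subspace on which $D^2f_\varepsilon(u)$ is negative definite. The same terminology is used for the quadratic form $D^2f_0(z_\theta)$ restricted to $(T_{z_\theta}Z)^\perp$.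
   Formalization: Added to (G4): near each z in Z the fourth u-derivative of G is bounded uniformly for small ε>0 (implied by its joint continuity in (ε,u)); without this the Morse index claim fails, e.g. on E=R² with F=x²/2, α=4. *)

(* Defs.v *)
From HB Require Import structures.
From mathcomp Require Import all_boot all_order all_algebra.
From mathcomp Require Import sesquilinear.
From mathcomp Require Import all_classical all_reals all_analysis.

Set Implicit Arguments.
Unset Strict Implicit.
Unset Printing Implicit Defensive.

Import Order.TTheory GRing.Theory Num.Theory.
Import numFieldNormedType.Exports.

Local Open Scope classical_set_scope.
Local Open Scope ring_scope.

(** * The normed space of continuous linear maps *)

Section ContinuousLinearMaps.
Context {R : realType} (V W : normedModType R).

Definition clinear_pred : {pred V -> W} :=
  [pred f | `[< linear f /\ continuous f >]].

Record clinear := CLinear {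
  clinear_fun :> V -> W;
  _ : clinear_fun \in clinear_pred }.

HB.instance Definition _ := [isSub for clinear_fun].
HB.instance Definition _ := [Choice of clinear by <:].

Lemma clinear_predP (f : V -> W) :
  reflect (linear f /\ continuous f) (f \in clinear_pred).
Proof. by rewrite inE; exact: asboolP. Qed.

Lemma clinear_submod_closed : submod_closed clinear_pred.
Proof.
split.
  apply/clinear_predP; split; last exact: cst_continuous.
  by move=> a x y; rewrite /= /GRing.zero /= scaler0 addr0.
move=> a f g /clinear_predP[fl fc] /clinear_predP[gl gc].
apply/clinear_predP; split.
  move=> b x y.
  rewrite [LHS](_ : _ = a *: f (b *: x + y) + g (b *: x + y))//.
  rewrite [RHS](_ : _ = b *: (a *: f x + g x) + (a *: f y + g y))//.
  by rewrite fl gl !scalerDr !scalerA addrACA (mulrC a).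
move=> x; apply: (cvgD (f := a \*: f) (g := g)); last exact: gc.
by apply: cvgZl_tmp; exact: fc.
Qed.

HB.instance Definition _ :=
  GRing.isSubmodClosed.Build R (V -> W) clinear_pred clinear_submod_closed.
HB.instance Definition _ := [SubChoice_isSubLmodule of clinear by <:].

Lemma clinear_linear (f : clinear) : linear f.
Proof. by case: f => f /= /clinear_predP[]. Qed.

Lemma clinear_continuous (f : clinear) : continuous f.
Proof. by case: f => f /= /clinear_predP[]. Qed.

HB.instance Definition _ (f : clinear) :=
  GRing.isLinear.Build R V W *:%R f (clinear_linear f).

Lemma clinear_bound (f : clinear) :
  exists M, forall x, `|x| <= 1 -> `|f x| <= M.
Proof.
have /bounded_funP/(_ 1)//: bounded_near f (nbhs (0 : V)).
by apply/linear_bounded_continuous; exact: clinear_continuous.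
Qed.

Definition opnorm (f : clinear) : R :=
  sup [set `|f x| | x in [set x : V | `|x| <= 1]].

Lemma opnorm_has_sup (f : clinear) :
  has_sup [set `|f x| | x in [set x : V | `|x| <= 1]].
Proof.
split; first by exists `|f 0|; exists 0; rewrite //= normr0.
by have [M fM] := clinear_bound f; exists M => _ [x /= x1 <-]; exact: fM.
Qed.

Lemma opnorm_ub (f : clinear) x : `|x| <= 1 -> `|f x| <= opnorm f.
Proof. by move=> x1; apply: (sup_upper_bound (opnorm_has_sup f)); exists x. Qed.

Lemma opnorm_le (f : clinear) M :
  (forall x, `|x| <= 1 -> `|f x| <= M) -> opnorm f <= M.
Proof.
move=> fM; apply: ge_sup; first by have [] := opnorm_has_sup f.
by move=> _ [x /= x1 <-]; exact: fM.
Qed.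

Lemma opnormD f g : opnorm (f + g) <= opnorm f + opnorm g.
Proof.
apply: opnorm_le => x x1; rewrite (le_trans (ler_normD (f x) (g x)))//.
by rewrite lerD// opnorm_ub.
Qed.

Lemma opnormZ_le (l : R) f : opnorm (l *: f) <= `|l| * opnorm f.
Proof.
apply: opnorm_le => x x1; rewrite [leLHS](_ : _ = `|l *: f x|)//.
by rewrite normrZ ler_wpM2l// opnorm_ub.
Qed.

Lemma opnormZ (l : R) f : opnorm (l *: f) = `|l| * opnorm f.
Proof.
apply/eqP; rewrite eq_le opnormZ_le/=.
have [->|l0] := eqVneq l 0.
  rewrite normr0 mul0r (le_trans (normr_ge0 ((0 *: f : clinear) 0)))//.
  by rewrite opnorm_ub// normr0.
rewrite -ler_pdivlMl ?normr_gt0// -normfV.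
by rewrite (le_trans _ (opnormZ_le _ _))// scalerA mulVf// scale1r.
Qed.

Lemma opnorm_eq0 f : opnorm f = 0 -> f = 0.
Proof.
move=> f0; apply/val_inj/funext => x /=.
have [->|x0] := eqVneq x 0; first by rewrite linear0.
have /eqP : `|f (`|x|^-1 *: x)| = 0.
  apply/eqP; rewrite eq_le normr_ge0 andbT -f0 opnorm_ub//.
  by rewrite normfZV.
by rewrite normr_eq0 linearZ/= scaler_eq0 invr_eq0 normr_eq0 (negPf x0) => /eqP.
Qed.

HB.instance Definition _ :=
  Lmodule_isNormed.Build R clinear opnormD opnormZ opnorm_eq0.

End ContinuousLinearMaps.

(** * Fréchet derivatives of higher order *)

Section HigherDerivatives.
Context {R : realType} (V : normedModType R).

(* [insubd] only matters where [f] is not differentiable: ['d f x] is then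
   unspecified and is replaced by [0] if it is not continuous. *)
Definition Dop (W : normedModType R) (f : V -> W) (x : V) : clinear V W :=
  insubd 0 ('d f x : V -> W).

Fixpoint Ck (k : nat) (W : normedModType R) (f : V -> W) : Prop :=
  if k is k'.+1 then (forall x, differentiable f x) /\ Ck k' (Dop f)
  else continuous f.

End HigherDerivatives.

Definition partial {R : realType} {d : nat} {W : normedModType R} (i : 'I_d)
    (f : 'rV[R]_d -> W) (th : 'rV[R]_d) : W :=
  'D_(delta_mx 0 i) f th.

(** * Functionals on a Hilbert space

    The Hilbert space is a complete normed module [E] with a dot product [ip]
    inducing its norm; the latter condition is a hypothesis of the theorem. *)

Section Hilbert.
Context {R : realType} {E : completeNormedModType R}.
Variable ip : {dot E for (@idfun R)}.

(* Representatives given by the Riesz theorem. The bilinear map [E * E -> E]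
   of order three is curried, with the norm of [clinear E (clinear E E)],
   which is the usual norm of bilinear maps. *)
Definition grad (f : E -> R^o) (u : E) : E :=
  get [set g | forall v, ip g v = Dop f u v].

Definition hess (f : E -> R^o) (u : E) : clinear E E :=
  get [set A : clinear E E |
    forall v w, ip (A v) w = Dop (Dop f) u v w].

Definition third (f : E -> R^o) (u : E) : clinear E (clinear E E) :=
  get [set B : clinear E (clinear E E) |
    forall v1 v2 v3, ip (B v1 v2) v3 = Dop (Dop (Dop f)) u v1 v2 v3].

Definition D2form (f : E -> R^o) (u v w : E) : R := Dop (Dop f) u v w.

Definition critical (f : E -> R^o) (u : E) : Prop :=
  differentiable f u /\ grad f u = 0.

Definition compact_operator (A : clinear E E) : Prop :=
  precompact (A @` [set x | `|x| <= 1]).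

Definition orthocomp (T : set E) : set E :=
  [set v | forall t, T t -> ip v t = 0].

(* The form [q] restricted to the closed subspace [V] is represented by an
   invertible operator of [V]. The operator and its inverse are given as
   continuous operators of [E] that map [V] to itself, which is no restriction
   since an operator of [V] extends to [E] by the orthogonal projection. *)
Definition nondegenerate_on (V : set E) (q : E -> E -> R) : Prop :=
  exists A B : clinear E E,
    [/\ forall v, V v -> V (A v) /\ V (B v),
        forall v w, V v -> V w -> ip (A v) w = q v w &
        forall v, V v -> A (B v) = v /\ B (A v) = v].

Definition negdef_subspace_dim (V : set E) (q : E -> E -> R) (n : nat) :=
  exists b : 'I_n -> E,
    [/\ forall i, V (b i),
        forall c : 'I_n -> R, \sum_i c i *: b i = 0 -> forall i, c i = 0 &
        forall c : 'I_n -> R, let v := \sum_i c i *: b i in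
          v != 0 -> q v v < 0].

Definition morse_index (V : set E) (q : E -> E -> R) (m : nat) : Prop :=
  negdef_subspace_dim V q m /\
  forall n, negdef_subspace_dim V q n -> (n <= m)%N.

(** * The critical manifold and the reduction *)

Definition tangent {d} (z : 'rV[R]_d -> E) (th : 'rV[R]_d) : set E :=
  range ('d z th).

(* [range z] is a [d]-dimensional C^2 submanifold and [z] is a C^2
   parametrization of it: an immersion that is open onto its image (with the
   induced topology), so that it is a homeomorphism onto a relatively open
   subset of [range z] near every [th]. Global injectivity is not required. *)
Definition C2_parametrization {d} (z : 'rV[R]_d -> E) : Prop :=
  [/\ Ck 2 z,
      forall th, injective ('d z th) &
      forall th U, nbhs th U -> within (range z) (nbhs (z th)) (z @` U)].

Definition fpert (F : E -> R^o) (G : R -> E -> R^o) (e : R) : E -> R^o :=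
  fun u => 2^-1 * `|u| ^+ 2 - F u + G e u.

Definition reduction_solution {d} (f : R -> E -> R^o) (z : 'rV[R]_d -> E)
    (e : R) (eta : 'rV[R]_d) (w : E) : Prop :=
  orthocomp (tangent z eta) w /\ tangent z eta (grad (f e) (z eta + w)).

(* [w e eta] is the unique small solution, for [e > 0] small and locally in
   [eta]. *)
Definition is_reduction {d} (f : R -> E -> R^o) (z : 'rV[R]_d -> E)
    (w : R -> 'rV[R]_d -> E) : Prop :=
  forall th0 : 'rV[R]_d, exists2 rho : R, 0 < rho &
    \forall e \near 0^'+ & eta \near th0,
      [/\ `|w e eta| < rho, reduction_solution f z e eta (w e eta) &
          forall w', `|w'| < rho -> reduction_solution f z e eta w' ->
            w' = w e eta].

(* The fourth derivative in [u] is bounded near [p], uniformly in small [e > 0].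
   Continuity of [(e, u) |-> third ip (G e) u] together with [Ck 4 (G e)] for
   every [e] does not imply this, and does not suffice to expand [hess] at
   [z + w] to the order [o(e `^ alpha)] when [w = o(e `^ (alpha / 2))]. *)
Definition fourth_bounded_near (G : R -> E -> R^o) (p : E) : Prop :=
  exists M : R, \forall e \near 0^'+ & u \near p,
    `|Dop (Dop (Dop (Dop (G e)))) u| <= M.

(* Z_e = {z + w(e,z)} *)
Definition Zpert {d} (z : 'rV[R]_d -> E) (w : R -> 'rV[R]_d -> E) (e : R) :
    set E :=
  range (fun eta => z eta + w e eta).

End Hilbert.

Definition hessian_mx {R : realType} {d} (g : 'rV[R]_d -> R^o)
    (th : 'rV[R]_d) : 'M[R]_d :=
  \matrix_(i, j) partial i (partial j g) th.

Definition posdef_mx {R : realType} {d} (A : 'M[R]_d) : Prop :=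
  forall x : 'rV[R]_d, x != 0 -> 0 < (x *m A *m x^T) 0 0.

Definition negdef_mx {R : realType} {d} (A : 'M[R]_d) : Prop :=
  forall x : 'rV[R]_d, x != 0 -> (x *m A *m x^T) 0 0 < 0.

(* Main.v *)
Require Import Defs.
From HB Require Import structures.
From mathcomp Require Import all_boot all_order all_algebra.
From mathcomp Require Import sesquilinear.
From mathcomp Require Import all_classical all_reals all_analysis.
From mathcomp Require Import ring lra.

Set Implicit Arguments.
Unset Strict Implicit.
Unset Printing Implicit Defensive.

Import Order.TTheory GRing.Theory Num.Theory.
Import numFieldNormedType.Exports.

Local Open Scope classical_set_scope.
Local Open Scope ring_scope.

(* With s = e^(alpha/2), test the Hessian of f_e at z_eta + w, |w| = o(s),
   against the tangent field T = Dz h scaled by 1/s and against vectors normal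
   to the manifold. Differentiating the identities F'(z) = z and
   (I - F''(z)) T = 0 along the manifold removes the terms of lower order:
   D^2 f_e (T, T) = s^2 D^2 Gamma (h, h) + o(s^2), D^2 f_e (T, y) = o(s), and
   D^2 f_e is close to D^2 f_0. After the scaling, the Hessian is a small
   perturbation of the direct sum of D^2 Gamma and of D^2 f_0 restricted to the
   normal space, whence nondegeneracy and the Morse index. Testing the increment
   of f_e' between two points z_eta + w and z_eta' + w' in the same directions
   gives s^2 (|eta' - eta| + |w' - w|) <= C |f_e'(z_eta' + w')| when
   f_e'(z_eta + w) = 0, and this estimate gives the continuity of the curve. *)

(** The obstacle is the order of the tangent block. As [w] is only o(s), [D^2 f_e (T, T)] at [z + w]
    contains the term [D^3 f_e (w, T, T)], linear in [w], which is o(s) but not o(s^2). The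
    expansion of [D f_e (S)], with [S = D^2 z (h, h)], contains [D^2 f_e (w, S)]; in the sum of the
    two, the contributions of [F] and of the norm cancel, and those of [G] are o(s) |w| = o(s^2).
    The remainders are quadratic in [w], which takes bounded fourth derivatives. For this reason
    [D^2 f_e (T, T)] and [D f_e (S)] are estimated together. At a critical point the second one
    vanishes; in the continuity argument, where intermediate points are not critical, it arises by
    differentiating the tangent field that serves as a moving test vector. Since two different
    points are compared there, all bounds are uniform for [(e, eta)] near [(0, th)] instead of
    holding along [th_] only. The same bounds give [w = o(s)]: Newton's iteration finds a solution
    in a ball of radius [k s], for any [k > 0], and uniqueness identifies it with [w]. *)

(** * Continuous linear maps and their operator norm *)

Section ContinuousLinear.
Context {R : realType} {V W : normedModType R}.
Implicit Types f g h : clinear V W.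

Lemma clinearDE f g x : (f + g) x = f x + g x. Proof. by []. Qed.
Lemma clinearBE f g x : (f - g) x = f x - g x. Proof. by []. Qed.
Lemma clinearZE a f x : (a *: f) x = a *: f x. Proof. by []. Qed.
Lemma clinear0E x : (0 : clinear V W) x = 0. Proof. by []. Qed.

Lemma clinear_linE f g h x : (f - g + h) x = f x - g x + h x. Proof. by []. Qed.

Lemma clinear_ext f g : f =1 g -> f = g.
Proof. by move=> fg; apply/val_inj/funext. Qed.

Lemma clinear_le f x : `|f x| <= `|f| * `|x|.
Proof.
have [->|x0] := eqVneq x 0; first by rewrite linear0 !normr0 mulr0.
have xgt0 : 0 < `|x| by rewrite normr_gt0.
rewrite -ler_pdivrMr// mulrC.
have -> : `|x|^-1 * `|f x| = `|f (`|x|^-1 *: x)|.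
  by rewrite linearZ/= normrZ ger0_norm// invr_ge0 ltW.
by apply: opnorm_ub; rewrite normfZV.
Qed.

Lemma clinear_norm_le f (M : R) :
  0 <= M -> (forall x, `|f x| <= M * `|x|) -> `|f| <= M.
Proof.
move=> M0 fM; apply: opnorm_le => x x1.
by rewrite (le_trans (fM x))// ler_piMr.
Qed.

(** The result is a sigma type rather than an existential, so that [projT1] of it can be used to
    define further operators, as in [clinear_postcomp]. *)
Lemma clinear_of (f : V -> W) (M : R) :
  linear f -> (forall x, `|f x| <= M * `|x|) ->
  {g : clinear V W | forall x, g x = f x}.
Proof.
move=> lf fM.
have fp : f \in @clinear_pred R V W.
  apply/clinear_predP; split=> //.
  pose ff := HB.pack f (GRing.isLinear.Build R V W *:%R f lf) : {linear V -> W}.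
  suff : continuous ff by [].
  apply/linear_bounded_continuous/linear_boundedP.
  apply: filterS (nbhs_pinfty_ge (num_real M)) => r Mr x.
  by rewrite (le_trans (fM x))// ler_wpM2r.
by exists (CLinear fp).
Qed.

End ContinuousLinear.

Lemma clinear_id {R : realType} (V : normedModType R) :
  {g : clinear V V | forall x, g x = x}.
Proof.
by apply: (@clinear_of _ _ _ idfun 1) => // x; rewrite mul1r.
Qed.

Lemma clinear_comp {R : realType} {U V W : normedModType R}
    (g : clinear V W) (f : clinear U V) :
  {h : clinear U W | forall x, h x = g (f x)}.
Proof.
apply: (@clinear_of _ _ _ (g \o f) (`|g| * `|f|)) => [|x].
  by move=> a x y /=; rewrite !linearP.
rewrite /= (le_trans (clinear_le _ _))// -mulrA ler_wpM2l//.
exact: clinear_le.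
Qed.

(** It exhibits the derivative of [L \o f] as a continuous linear image of the derivative of [f],
    which is what inductions on the order of smoothness need, and it carries the Riesz map to
    operators of higher order. *)
Lemma clinear_postcomp {R : realType} {U V W : normedModType R}
    (g : clinear V W) :
  {h : clinear (clinear U V) (clinear U W) | forall f x, h f x = g (f x)}.
Proof.
have [||h hE] := @clinear_of _ _ _
    (fun f : clinear U V => projT1 (clinear_comp g f)) `|g|.
- move=> a f1 f2; apply: clinear_ext => x; rewrite clinearDE clinearZE.
  by do 3!(case: clinear_comp => ? /= ->); rewrite -linearP.
- move=> f; case: clinear_comp => k /= kE.
  apply: clinear_norm_le => [|x]; first exact: mulr_ge0.
  rewrite kE (le_trans (clinear_le _ _))// -mulrA ler_wpM2l//.
  exact: clinear_le.
- by exists h => f x; rewrite hE; case: clinear_comp => k /= ->.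
Qed.

Lemma clinear_eval {R : realType} {V W : normedModType R} (v : V) :
  {h : clinear (clinear V W) W | forall f, h f = f v}.
Proof.
apply: (@clinear_of _ _ _ (fun f : clinear V W => f v) `|v|) => // f.
by rewrite mulrC clinear_le.
Qed.

Section Bilinear.
Context {R : realType} {U V W : normedModType R}.
Implicit Types f g : clinear U (clinear V W).

Lemma clinear2BE f g a b : (f - g) a b = f a b - g a b. Proof. by []. Qed.

Lemma clinear2_le f a b : `|f a b| <= `|f| * `|a| * `|b|.
Proof.
by rewrite (le_trans (clinear_le _ _))// ler_wpM2r// clinear_le.
Qed.

End Bilinear.

(** * The dot product, the Cauchy-Schwarz inequality and the Riesz theorem *)

Section DotProduct.
Context {R : realType} {E : completeNormedModType R}.
Variable ip : {dot E for (@idfun R)}.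
Hypothesis ip_norm : forall u : E, ip u u = `|u| ^+ 2.

Lemma ipC u v : ip u v = ip v u.
Proof. by rewrite hermC expr0 mul1r. Qed.
Lemma ipDl u v w : ip (u + v) w = ip u w + ip v w.
Proof. exact: linearDl. Qed.
Lemma ipDr u v w : ip u (v + w) = ip u v + ip u w.
Proof. by rewrite ipC ipDl !(ipC u). Qed.
Lemma ipZl a u w : ip (a *: u) w = a * ip u w.
Proof. exact: linearZl_LR. Qed.
Lemma ipZr a u w : ip u (a *: w) = a * ip u w.
Proof. by rewrite ipC ipZl ipC. Qed.
Lemma ipNl u w : ip (- u) w = - ip u w.
Proof. by rewrite -scaleN1r ipZl mulN1r. Qed.
Lemma ipNr u w : ip u (- w) = - ip u w.
Proof. by rewrite ipC ipNl ipC. Qed.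
Lemma ipBl u v w : ip (u - v) w = ip u w - ip v w.
Proof. by rewrite ipDl ipNl. Qed.
Lemma ipBr u v w : ip u (v - w) = ip u v - ip u w.
Proof. by rewrite ipDr ipNr. Qed.
Lemma ip0l u : ip 0 u = 0.
Proof. by rewrite -(scale0r 0) ipZl mul0r. Qed.
Lemma ip0r u : ip u 0 = 0.
Proof. by rewrite ipC ip0l. Qed.
Lemma ip_suml I (s : seq I) (P : pred I) (f : I -> E) u :
  ip (\sum_(i <- s | P i) f i) u = \sum_(i <- s | P i) ip (f i) u.
Proof. by elim/big_rec2: _ => [|i x y _ <-]; rewrite ?ip0l ?ipDl. Qed.
Lemma ip_sumr I (s : seq I) (P : pred I) (f : I -> E) u :
  ip u (\sum_(i <- s | P i) f i) = \sum_(i <- s | P i) ip u (f i).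
Proof. by rewrite ipC ip_suml; apply: eq_bigr => i _; rewrite ipC. Qed.

Lemma ip_eq u v : (forall y, ip u y = ip v y) -> u = v.
Proof.
move=> uv; apply/eqP; rewrite -subr_eq0 -normr_eq0 -sqrf_eq0 -ip_norm.
by rewrite ipBl uv subrr.
Qed.

Lemma sqr_normD u v : `|u + v| ^+ 2 = `|u| ^+ 2 + 2 * ip u v + `|v| ^+ 2.
Proof. by rewrite -!ip_norm ipDl !ipDr (ipC v u); ring. Qed.

Lemma cauchy_schwarz u v : `|ip u v| <= `|u| * `|v|.
Proof.
have [->|v0] := eqVneq v 0; first by rewrite ip0r !normr0 mulr0.
have vgt0 : 0 < `|v| ^+ 2 by rewrite exprn_gt0// normr_gt0.
rewrite -[leRHS]ger0_norm; last exact: mulr_ge0.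
rewrite -ler_sqr ?nnegrE// !real_normK ?num_real// exprMn.
have := mulr_ge0 (sqr_ge0 `|u + (- (ip u v / `|v| ^+ 2)) *: v|) (ltW vgt0).
rewrite sqr_normD ipZr normrZ exprMn real_normK ?num_real// sqrrN.
set a := ip u v; set b := `|v| in vgt0 *; set c := `|u|.
suff -> : (c ^+ 2 + 2 * (- (a / b ^+ 2) * a) + (a / b ^+ 2) ^+ 2 * b ^+ 2) *
  b ^+ 2 = c ^+ 2 * b ^+ 2 - a ^+ 2 by rewrite subr_ge0.
by field; rewrite normr_eq0.
Qed.

Lemma ip_le u v : ip u v <= `|u| * `|v|.
Proof. exact: le_trans (ler_norm _) (cauchy_schwarz u v). Qed.

Lemma norm_le_ip u (M : R) : 0 <= M -> (forall y, ip u y <= M * `|y|) -> `|u| <= M.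
Proof.
move=> M0 uM; have := uM u; rewrite ip_norm expr2.
have [->|u0] := eqVneq u 0; first by rewrite normr0.
by rewrite ler_pM2r// normr_gt0.
Qed.

(* The representative of [ell] minimizes [|v|^2 - 2 ell v]; minimizing
   sequences are Cauchy by the parallelogram identity. *)
Lemma riesz (ell : clinear E R^o) : exists g, forall v, ip g v = ell v.
Proof.
pose J (v : E) : R := `|v| ^+ 2 - 2 * (ell v : R).
have JB v y t : J (v + t *: y) =
    J v + 2 * t * (ip v y - (ell y : R)) + t ^+ 2 * `|y| ^+ 2.
  rewrite /J sqr_normD ipZr normrZ exprMn real_normK ?num_real//.
  have -> : (ell (v + t *: y) : R) = (ell v : R) + t * (ell y : R).
    by rewrite linearD linearZ.
  ring.
have Jlb v : - `|ell| ^+ 2 <= J v.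
  have ev : (ell v : R) <= `|ell| * `|v|.
    exact: le_trans (ler_norm _) (clinear_le ell v).
  rewrite /J; have := sqr_ge0 (`|v| - `|ell|); move: ev.
  set a := (ell v : R); set b := `|ell|; set c := `|v|; nra.
pose S := range J.
have Sinf : has_inf S.
  by split; [exists (J 0), 0|exists (- `|ell| ^+ 2) => _ [v _ <-]].
pose m := inf S.
have mJ v : m <= J v by apply: ge_inf; [case: Sinf|exists v].
(* [J] is quadratic and at least [m] at the midpoint, so two almost minimizing vectors are close. *)
have close v w (e : R) : J v <= m + e -> J w <= m + e ->
    `|v - w| ^+ 2 <= 4 * e.
  move=> Jv Jw.
  have := mJ (v + 2^-1 *: (w - v)); rewrite JB.
  have Ew : J w = J v + 2 * 1 * (ip v (w - v) - (ell (w - v) : R))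
      + 1 ^+ 2 * `|w - v| ^+ 2.
    by rewrite -JB scale1r addrC subrK.
  rewrite -(normrN (v - w)) opprB.
  move: Ew Jv Jw; set a := _ - _; set b := `|w - v|; set x := J v; set y := J w.
  by move=> ->; set bb := b ^+ 2; lra.
have /choice [u uP] n : exists v, J v < m + n.+1%:R^-1.
  have [|_ [v _ <-] Jv] := inf_adherent _ Sinf (eps := n.+1%:R^-1).
    by rewrite invr_gt0.
  by exists v.
have small (e : R) : 0 < e -> \forall n \near \oo, (n.+1%:R^-1 : R) < e.
  by move=> e0; have := near_infty_natSinv_lt (PosNum e0).
have : cvgn u.
  apply/cauchy_cvgP/cauchy_exP => e e0.
  have e20 : 0 < e ^+ 2 / 8 by rewrite divr_gt0// exprn_gt0.
  have [N _ NP] := small _ e20.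
  exists (u N); rewrite nbhs_simpl; exists N => //= n /= Nn.
  rewrite -ball_normE /=.
  rewrite -(ltr_pXn2r (_ : 0 < 2)%N) ?nnegrE ?normr_ge0 ?(ltW e0)//.
  apply: le_lt_trans (close _ _ (e ^+ 2 / 8) _ _) _.
  - by rewrite ltW// (lt_trans (uP N))// ltrD2l; exact: (NP N (leqnn N)).
  - by rewrite ltW// (lt_trans (uP n))// ltrD2l; exact: (NP n Nn).
  - move: e20; set x := e ^+ 2; lra.
set g := limn u => ug.
have Jg : J g <= m.
  have Jc : J (u n) @[n --> \oo] --> J g.
    rewrite /J; apply: cvgB.
      by rewrite expr2; apply: cvgM; apply: cvg_norm.
    have ellc : (ell (u n) : R) @[n --> \oo] --> (ell g : R).
      have h : ell y @[y --> g] --> ell g by exact: clinear_continuous.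
      exact: (cvg_comp u ell ug h).
    exact: cvgM (cvg_cst _) ellc.
  apply/ler_addgt0Pr => e e0.
  apply: (cvgr_to_le Jc).
  have [N _ NP] := small _ e0; exists N => // n /= Nn.
  by rewrite ltW// (lt_trans (uP n))// ltrD2l; exact: (NP n Nn).
exists g => v.
suff H : ip g v - (ell v : R) = 0 by apply/eqP; rewrite -subr_eq0; apply/eqP.
set a := _ - _.
have Q (t : R) : 0 <= 2 * t * a + t ^+ 2 * `|v| ^+ 2.
  have := mJ (g + t *: v); rewrite JB -/a; lra.
(* Close to the minimizing value of [t]; the [1 +] in the denominator covers [v = 0] without a
   separate case. *)
have := Q (- a / (1 + `|v| ^+ 2)).
have b0 : 0 <= `|v| ^+ 2 by rewrite exprn_ge0.
set b := `|v| ^+ 2 in b0 *.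
have b1 : 0 < 1 + b by rewrite ltr_pwDl.
rewrite -(pmulr_rge0 _ (exprn_gt0 2 b1)).
have -> : (1 + b) ^+ 2 * (2 * (- a / (1 + b)) * a + (- a / (1 + b)) ^+ 2 * b)
   = - a ^+ 2 * (2 + b) by field; rewrite gt_eqF.
move=> h; apply/eqP; rewrite -sqrf_eq0 eq_le sqr_ge0 andbT.
move: h; set aa := a ^+ 2; nra.
Qed.

End DotProduct.

(** * Contractions and zeros of nearly linear maps *)

Section FixedPoints.
Context {R : realType} {E : completeNormedModType R}.

Lemma fixed_point_in (U : set E) (f : E -> E) (q : R) :
  closed U -> U !=set0 -> {homo f : x / U x} -> 0 <= q -> q < 1 ->
  (forall x y, U x -> U y -> `|f x - f y| <= q * `|x - y|) ->
  exists2 p, U p & f p = p.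
Proof.
move=> Uc U0 fU q0 q1 fq.
have fUU : set_fun U U f by move=> x Ux; exact: fU.
have [||| p Up pE] := @banach_fixed_point R E U (mkfun fUU).
- exists (NngNum q0); split => //= -[x y] [/= Ux Uy]; exact: fq.
- by [].
- by [].
- by exists p.
Qed.

Lemma closed_norm_ball (r : R) : closed [set x : E | `|x| <= r].
Proof.
have -> : [set x : E | `|x| <= r] = (fun x : E => `|x|) @^-1` [set y | y <= r] by [].
apply: closed_comp; last exact: closed_le.
by move=> x _; exact: norm_continuous.
Qed.

(* Newton's iteration with the frozen derivative [K]. *)
Lemma zero_near_linear (Phi : E -> E) (K L : clinear E E) (k r : R) :
  (forall v, L (K v) = v) -> (forall v, K (L v) = v) -> 0 <= r ->
  (forall x y, `|x| <= r -> `|y| <= r ->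
     `|Phi x - Phi y - K (x - y)| <= k * `|x - y|) ->
  `|L| * k <= 2^-1 -> `|L| * `|Phi 0| <= r / 2 ->
  exists2 x, `|x| <= r & Phi x = 0.
Proof.
move=> LK KL r0 PhiK Lk LP.
pose f x := x - L (Phi x).
have ff x y : `|x| <= r -> `|y| <= r -> `|f x - f y| <= 2^-1 * `|x - y|.
  move=> xr yr.
  have -> : f x - f y = - L (Phi x - Phi y - K (x - y)).
    rewrite (linearB L) (linearB L (Phi x)) /= LK [RHS]opprB.
    by rewrite /f [- (y - _)]opprD addrACA -opprD.
  rewrite normrN (le_trans (clinear_le _ _))//.
  have := PhiK _ _ xr yr; have := normr_ge0 L; have := normr_ge0 (x - y).
  move: Lk; set a := `|L|; set b := `|x - y|; set c := `|_|.
  move=> h1 h2 h3 h4; apply: le_trans (_ : a * (k * b) <= _).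
    by rewrite ler_wpM2l.
  by rewrite mulrA ler_wpM2r.
have [||||||x xr fx] := @fixed_point_in [set x | `|x| <= r] f 2^-1.
- exact: closed_norm_ball.
- by exists 0; rewrite /= normr0.
(* [f 0] uses one half of the radius, the contraction factor leaves the other half for
   [f x - f 0]. *)
- move=> x /= xr; have := ff _ 0 xr; rewrite normr0 => /(_ r0).
  have f0 : `|f 0| <= r / 2.
    by rewrite /f sub0r normrN (le_trans (clinear_le _ _)).
  rewrite subr0 => fx.
  rewrite -(subrK (f 0) (f x)) (le_trans (ler_normD _ _))//.
  move: xr fx f0; set a := `|x|; set b := `|_|; set c := `|f 0|; lra.
- by rewrite invr_ge0.
- by rewrite invf_lt1 ?ltr1n.
- exact: ff.
exists x => //; rewrite -(KL (Phi x)).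
have : L (Phi x) = x - f x by rewrite /f opprB addrCA subrr addr0.
by rewrite fx subrr => ->; rewrite linear0.
Qed.

End FixedPoints.

(** * Riesz representatives of the derivatives; inverses of symmetric operators *)

Section Representatives.
Context {R : realType} {E : completeNormedModType R}.
Variable ip : {dot E for (@idfun R)}.
Hypothesis ip_norm : forall u : E, ip u u = `|u| ^+ 2.

(** Uniqueness of the representative makes it depend linearly on the functional; composing with this
    map turns curried multilinear forms into operators. *)
Lemma riesz_clinear :
  {J : clinear (clinear E R^o) E | forall ell v, ip (J ell) v = ell v}.
Proof.
pose j (ell : clinear E R^o) := projT1 (cid (riesz ip_norm ell)).
have jE ell v : ip (j ell) v = ell v by rewrite /j; case: cid.
have [||J JE] := @clinear_of _ _ _ j 1.
- move=> a x y; apply: (ip_eq ip_norm) => v.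
  by rewrite ipDl ipZl !jE.
- move=> ell; apply: (norm_le_ip ip_norm) => [|v]; first by rewrite mul1r.
  by rewrite jE mul1r (le_trans (ler_norm _))// clinear_le.
- by exists J => ell v; rewrite JE jE.
Qed.

(** [grad], [hess] and [third] are selected by [get], hence satisfy their specification as soon as
    some representative exists; [Dop] is continuous by construction, so the Riesz theorem provides
    one at every point. *)
Lemma gradP (f : E -> R^o) u v : ip (grad ip f u) v = Dop f u v.
Proof.
have [g gE] := riesz ip_norm (Dop f u).
exact: (@getPex _ [set g | forall v, ip g v = Dop f u v]) (ex_intro _ g gE) v.
Qed.

Lemma hessP (f : E -> R^o) u v w :
  ip (hess ip f u v) w = Dop (Dop f) u v w.
Proof.
have [J JE] := riesz_clinear.
have [A AE] := clinear_comp J (Dop (Dop f) u).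
have AP : [set A : clinear E E |
    forall v w, ip (A v) w = Dop (Dop f) u v w] !=set0.
  by exists A => x y; rewrite AE JE.
exact: (getPex AP).
Qed.

Lemma thirdP (f : E -> R^o) u v1 v2 v3 :
  ip (third ip f u v1 v2) v3 = Dop (Dop (Dop f)) u v1 v2 v3.
Proof.
have [J JE] := riesz_clinear.
have [J2 J2E] := clinear_postcomp (U := E) J.
have [A AE] := clinear_comp J2 (Dop (Dop (Dop f)) u).
have AP : [set B : clinear E (clinear E E) |
    forall v1 v2 v3, ip (B v1 v2) v3 = Dop (Dop (Dop f)) u v1 v2 v3] !=set0.
  by exists A => x y t; rewrite AE J2E JE.
exact: (getPex AP).
Qed.

(** Symmetry replaces coercivity: [(A A x | x) = |A x|^2 >= c^2 |x|^2] even if [A] is indefinite. So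
    [A A x = A y] is solved by iteration, and injectivity cancels one [A]. The step [t = c^2 / M^4]
    minimizes the contraction bound [1 - 2 t c^2 + t^2 M^4], and the minimum is [q2]. *)
Lemma symmetric_bounded_below_inverse (A : clinear E E) (c : R) : 0 < c ->
  (forall x y, ip (A x) y = ip x (A y)) ->
  (forall x, c * `|x| <= `|A x|) ->
  {B : clinear E E | forall x, A (B x) = x /\ B (A x) = x}.
Proof.
move=> c0 Asym Ac.
have Ainj x y : A x = A y -> x = y.
  move=> Axy; apply/eqP; rewrite -subr_eq0 -normr_eq0 eq_le normr_ge0 andbT.
  by rewrite -(pmulr_rle0 _ c0) (le_trans (Ac _))// linearB /= Axy subrr normr0.
(* The summand [c] ensures [c <= M], hence [0 <= q2] below. *)
pose M := 1 + `|A| + c.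
have M0 : 0 < M by rewrite /M; have := normr_ge0 A; lra.
have AM x : `|A x| <= M * `|x|.
  rewrite (le_trans (clinear_le A x))// ler_wpM2r// /M.
  by have := c0; set a := `|A|; lra.
have Asurj y : exists x, A x = y.
  (* the map [x |-> x - t (A A x - A y)] is a contraction for small [t] *)
  pose t := c ^+ 2 / M ^+ 4.
  pose q2 := 1 - c ^+ 4 / M ^+ 4.
  have cM : c <= M by rewrite /M; have := normr_ge0 A; lra.
  have M40 : 0 < M ^+ 4 by rewrite exprn_gt0.
  have q20 : 0 <= q2.
    by rewrite subr_ge0 ler_pdivrMr// mul1r ler_pXn2r// nnegrE ltW.
  have q21 : q2 < 1 by rewrite ltrBlDr ltrDl divr_gt0// exprn_gt0.
  have t0 : 0 <= t by rewrite divr_ge0// ?exprn_ge0// ltW.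
  pose f x := x - t *: (A (A x) - A y).
  have [||||||x _ fx] := @fixed_point_in _ _ setT f (Num.sqrt q2).
  - exact: closedT.
  - by exists 0.
  - by [].
  - exact: sqrtr_ge0.
  - by rewrite -sqrtr1 ltr_sqrt// ltr01.
  - move=> x x' _ _.
    have -> : f x - f x' = (x - x') + (- t) *: A (A (x - x')).
      rewrite (linearB A) /= (linearB A (A x)) /= scaleNr /f [- (x' - _)]opprD addrACA -opprD -scalerBr.
      by rewrite opprB addrA subrK.
    set z := x - x'.
    rewrite -(ler_pXn2r (_ : 0 < 2)%N) ?nnegrE ?mulr_ge0 ?sqrtr_ge0//.
    rewrite exprMn sqr_sqrtr// (sqr_normD ip_norm) ipZr normrZ exprMn normrN.
    rewrite (ger0_norm t0) -Asym ip_norm.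
    have h1 : c ^+ 2 * `|z| ^+ 2 <= `|A z| ^+ 2.
      by rewrite -exprMn ler_pXn2r// ?nnegrE// mulr_ge0// ltW.
    have h2 : `|A (A z)| ^+ 2 <= M ^+ 4 * `|z| ^+ 2.
      rewrite -[4%N]/(2 * 2)%N exprM -exprMn ler_pXn2r// ?nnegrE ?mulr_ge0 ?exprn_ge0 ?(ltW M0)//.
      by rewrite (le_trans (AM _))// expr2 -mulrA ler_pM2l.
    have h3 : t ^+ 2 * `|A (A z)| ^+ 2 <= t ^+ 2 * (M ^+ 4 * `|z| ^+ 2).
      by rewrite ler_wpM2l// exprn_ge0.
    have h4 : t * (c ^+ 2 * `|z| ^+ 2) <= t * `|A z| ^+ 2 by rewrite ler_wpM2l.
    have e1 : t ^+ 2 * (M ^+ 4 * `|z| ^+ 2) = c ^+ 4 / M ^+ 4 * `|z| ^+ 2.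
      by rewrite /t; field; rewrite gt_eqF.
    have e2 : t * (c ^+ 2 * `|z| ^+ 2) = c ^+ 4 / M ^+ 4 * `|z| ^+ 2.
      by rewrite /t; field; rewrite gt_eqF.
    rewrite e1 in h3; rewrite e2 in h4; rewrite /q2 mulrBl mul1r mulNr.
    move: h3 h4; set a := _ / _ * _; set b := t * _; set d := t ^+ 2 * _; lra.
  exists x; apply: Ainj.
  move/eqP: fx; rewrite /f -subr_eq0 addrAC subrr sub0r oppr_eq0 scaler_eq0.
  by rewrite subr_eq0 gt_eqF/= ?divr_gt0 ?exprn_gt0// => /eqP.
pose b y := projT1 (cid (Asurj y)).
have bE y : A (b y) = y by rewrite /b; case: cid.
have [||B BE] := @clinear_of _ _ _ b c^-1.
- by move=> a x y; apply: Ainj; rewrite linearP /= !bE.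
- by move=> x; rewrite ler_pdivlMl// (le_trans (Ac _))// bE.
- by exists B => x; rewrite !BE; split; [exact: bE|apply: Ainj; exact: bE].
Qed.

End Representatives.

(** * Calculus of [Dop] and of the classes [Ck] *)

Section Derivatives.
Context {R : realType} {V W : normedModType R}.

Lemma DopE (f : V -> W) x v : differentiable f x -> Dop f x v = 'd f x v.
Proof.
move=> df; rewrite /Dop.
have fp : ('d f x : V -> W) \in @clinear_pred R V W.
  apply/clinear_predP; split; last exact: diff_continuous.
  by move=> a u w; rewrite linearP.
have := insubdK (0 : clinear V W) fp => /(congr1 (fun g => g v)).
by [].
Qed.

Lemma Dop_unique (f : V -> W) (L : clinear V W) x :
  is_diff x f L -> Dop f x = L.
Proof.
move=> dfL; apply: clinear_ext => v.
by rewrite DopE; [rewrite diff_val|exact: ex_diff].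
Qed.

Lemma Dop_is_diff (f : V -> W) x : differentiable f x -> is_diff x f (Dop f x).
Proof.
by move=> df; apply: DiffDef => //; apply/funext => v; rewrite DopE.
Qed.

Lemma DopD (f g : V -> W) x : differentiable f x -> differentiable g x ->
  Dop (f + g) x = Dop f x + Dop g x.
Proof.
move=> /Dop_is_diff df /Dop_is_diff dg; apply: Dop_unique; exact: is_diffD.
Qed.

Lemma DopN (f : V -> W) x : differentiable f x -> Dop (- f) x = - Dop f x.
Proof. by move=> /Dop_is_diff df; apply: Dop_unique; exact: is_diffN. Qed.

Lemma clinear_differentiable (L : clinear V W) x : differentiable L x.
Proof. by apply: linear_differentiable; exact: clinear_continuous. Qed.

Lemma Dop_clinear (L : clinear V W) x : Dop L x = L.
Proof.
apply: Dop_unique; apply: DiffDef; first exact: clinear_differentiable.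
by apply: diff_lin; exact: clinear_continuous.
Qed.

Lemma Dop_cst (a : W) x : Dop (fun _ : V => a) x = 0.
Proof. by apply: Dop_unique; exact: is_diff_cst. Qed.

End Derivatives.

Section CompositeDerivatives.
Context {R : realType} {U V W : normedModType R}.

Lemma Dop_comp_clinear (X Y : normedModType R) (L : clinear X Y) (f : U -> X) x v :
  differentiable f x ->
  differentiable (fun y => L (f y)) x /\
  Dop (fun y => L (f y)) x v = L (Dop f x v).
Proof.
move=> df; have dL := clinear_differentiable L (f x).
have dc : differentiable (L \o f) x by exact: differentiable_comp.
split=> //; rewrite (DopE _ dc) diff_comp//=.
by rewrite -(DopE _ dL) -(DopE _ df) Dop_clinear.
Qed.

Lemma eval_differentiable (f : U -> clinear V W) y x :
  differentiable f x -> differentiable (fun u => f u y) x.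
Proof.
move=> df; have [h hE] := @clinear_eval R V W y.
have [+ _] := Dop_comp_clinear h 0 df.
by have -> : (fun u => h (f u)) = fun u => f u y by apply/funext => u; rewrite hE.
Qed.

Lemma Dop_eval (f : U -> clinear V W) y x v : differentiable f x ->
  Dop (fun u => f u y) x v = Dop f x v y.
Proof.
move=> df; have [h hE] := @clinear_eval R V W y.
have [_] := Dop_comp_clinear h v df; rewrite hE => <-.
by congr (Dop _ _ _); apply/funext => u; rewrite hE.
Qed.

End CompositeDerivatives.

Section SmoothClasses.
Context {R : realType} {V : normedModType R}.

Lemma CkD k (W : normedModType R) (f g : V -> W) :
  Ck k f -> Ck k g -> Ck k (f + g).
Proof.
elim: k W f g => [|k IH] W f g /= => [fc gc x|[df cf] [dg cg]].
  by apply: cvgD; [exact: fc|exact: gc].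
split=> [x|]; first exact: differentiableD.
rewrite (_ : Dop (f + g) = Dop f + Dop g); first exact: IH.
by apply/funext => x; rewrite DopD.
Qed.

Lemma CkN k (W : normedModType R) (f : V -> W) : Ck k f -> Ck k (- f).
Proof.
elim: k W f => [|k IH] W f /= => [fc x|[df cf]].
  by apply: cvgN; exact: fc.
split=> [x|]; first exact: differentiableN.
rewrite (_ : Dop (- f) = - Dop f); first exact: IH.
by apply/funext => x; rewrite DopN.
Qed.

Lemma Ck_cst k (W : normedModType R) (a : W) : Ck k (fun _ : V => a).
Proof.
elim: k W a => [|k IH] W a /=; first exact: cst_continuous.
split=> [x|]; first exact: differentiable_cst.
rewrite (_ : Dop _ = fun=> 0); first exact: IH.
by apply/funext => x; rewrite Dop_cst.
Qed.

Lemma Ck_clinear k (W : normedModType R) (L : clinear V W) : Ck k L.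
Proof.
case: k => [|k] /=; first exact: clinear_continuous.
split=> [x|]; first exact: clinear_differentiable.
rewrite (_ : Dop L = fun=> L); first exact: Ck_cst.
by apply/funext => x; rewrite Dop_clinear.
Qed.

End SmoothClasses.

(** * Chain and product rules along curves *)

Section Curves.
Context {R : realType}.
Implicit Types V W : normedModType R.

Lemma is_derive_cvg W (f : R -> W) (t : R) df :
  h^-1 *: (f (h + t) - f t) @[h --> 0^'] --> df -> is_derive t 1 f df.
Proof.
have E : (fun h => h^-1 *: ((f \o shift t) (h *: 1) - f t)) =
    (fun h => h^-1 *: (f (h + t) - f t)).
  by apply/funext => h /=; rewrite [h *: 1]mulr1.
move=> c; split; rewrite /derivable /derive E; first by apply/cvg_ex; exists df.
exact/cvg_lim.
Qed.

Lemma is_derive_curve_cvg W (f : R -> W) (t : R) df : is_derive t 1 f df ->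
  h^-1 *: (f (h + t) - f t) @[h --> 0^'] --> df.
Proof.
move=> [cf <-]; move: cf; rewrite /derivable /derive.
have -> : (fun h => h^-1 *: ((f \o shift t) (h *: 1) - f t)) =
    (fun h => h^-1 *: (f (h + t) - f t)).
  by apply/funext => h /=; rewrite [h *: 1]mulr1.
by [].
Qed.

Lemma curve_continuous W (f : R -> W) (t : R) df :
  is_derive t 1 f df -> {for t, continuous f}.
Proof.
move=> [cf _]; apply: differentiable_continuous.
exact/derivable1_diffP.
Qed.

Lemma curve_comp V W (f : V -> W) (g : R -> V) (t : R) dg :
  differentiable f (g t) -> is_derive t 1 g dg ->
  is_derive t 1 (fun s => f (g s)) (Dop f (g t) dg).
Proof.
move=> df [cg <-].
have dg' : differentiable g t by exact/derivable1_diffP.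
have dc : differentiable (f \o g) t by exact: differentiable_comp.
split; first exact/derivable1_diffP.
by rewrite [LHS](deriveE _ dc) diff_comp//= -DopE// deriveE.
Qed.

Lemma cvg_apply V W T (F : set_system T) {FF : Filter F}
    (A_ : T -> clinear V W) (v_ : T -> V) (A : clinear V W) (v : V) :
  A_ x @[x --> F] --> A -> v_ x @[x --> F] --> v ->
  A_ x (v_ x) @[x --> F] --> A v.
Proof.
move=> cA cv.
have h1 : (A_ x - A) (v_ x) @[x --> F] --> (0 : W).
  apply/norm_cvg0P.
  have H : `|A_ x - A| * `|v_ x| @[x --> F] --> (0 : R).
    rewrite -(mul0r `|v|); apply: cvgM; last exact: cvg_norm.
    by rewrite -(@normr0 _ (clinear V W)) -(subrr A); apply: cvg_norm;
      apply: cvgB => //; exact: cvg_cst.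
  apply: (squeeze_cvgr _ (cvg_cst 0) H).
  by apply: nearW => x; rewrite normr_ge0 clinear_le.
have h2 : A (v_ x) @[x --> F] --> A v.
  have h : A y @[y --> v] --> A v by exact: clinear_continuous.
  exact: (cvg_comp v_ A cv h).
have h3 := cvgD h1 h2; rewrite add0r in h3.
rewrite (_ : (fun x => A_ x (v_ x)) =
  (fun x => (A_ x - A) (v_ x)) + (fun x => A (v_ x))); first exact: h3.
by apply/funext => x; rewrite addrfctE clinearBE subrK.
Qed.

Lemma curve_apply V W (A : R -> clinear V W) (g : R -> V) (t : R) dA dg :
  is_derive t 1 A dA -> is_derive t 1 g dg ->
  is_derive t 1 (fun s => A s (g s)) (dA (g t) + A t dg).
Proof.
move=> HA Hg; apply: is_derive_cvg.
have cA := is_derive_curve_cvg HA; have cg := is_derive_curve_cvg Hg.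
have ct (X : normedModType R) (f : R -> X) df : is_derive t 1 f df ->
    f (h + t) @[h --> 0^'] --> f t.
  move=> /curve_continuous fc.
  have h0 : h + t @[h --> 0^'] --> t.
    rewrite -[X in _ --> X]add0r; apply: cvgD; last exact: cvg_cst.
    exact: nbhs_dnbhs.
  exact: (cvg_comp (fun h => h + t) f h0 fc).
have h1 := cvg_apply cA (ct _ _ _ Hg).
have h2 := cvg_apply (@cvg_cst _ (A t) _ _ _) cg.
rewrite (_ : (fun h => _) = (fun h => (h^-1 *: (A (h + t) - A t)) (g (h + t))) +
  (fun h => A t (h^-1 *: (g (h + t) - g t)))); first exact: cvgD (h1 _) (h2 _ _).
apply/funext => h; rewrite addrfctE clinearZE clinearBE linearZ /= -scalerDr.
by rewrite (linearB (A t)) /= addrA subrK.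
Qed.

End Curves.

(** * Mean values and symmetry of the second and third derivatives *)

Section MeanValue.
Context {R : realType}.

Lemma mvt01 (g dg : R -> R) : (forall t, is_derive t (1 : R) g (dg t)) ->
  exists2 t, 0 <= t <= 1 & g 1 - g 0 = dg t.
Proof.
move=> gd; have [|c] := MVT_segment ler01 (fun t _ => gd t).
  by apply: continuous_subspaceT => s; exact: curve_continuous (gd s).
by rewrite in_itv /= => c01; rewrite subr0 mulr1 => ->; exists c.
Qed.

Context {V : normedModType R}.

Lemma line_derive (u w : V) (t : R) : is_derive t 1 (fun s => u + s *: w) w.
Proof.
apply: is_derive_cvg; apply: cvg_near_cst.
near=> h.
have h0 : h != 0 by near: h; exact: nbhs_dnbhs_neq.
rewrite opprD addrACA subrr add0r -scalerBl addrK scalerA mulVf ?scale1r//.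
Unshelve. all: by end_near. Qed.

Lemma Dop_mvt (f : V -> R^o) u w : (forall x, differentiable f x) ->
  exists2 t : R, 0 <= t <= 1 &
    (f (u + w) : R) - (f u : R) = Dop f (u + t *: w) w.
Proof.
move=> df; have [|t t01 E] := @mvt01 (fun s => f (u + s *: w))
    (fun s => Dop f (u + s *: w) w).
  by move=> t; apply: curve_comp; [exact: df|exact: line_derive].
by exists t => //; move: E; rewrite scale1r scale0r addr0.
Qed.

(** The mean value theorem is applied in the direction [v] to a difference in the direction [w],
    then in the direction [w] to [Dop f _ v]. The left-hand side is symmetric in [v] and [w], the
    arguments on the right are ordered: this yields [D2_sym]. *)
Lemma second_difference (f : V -> R^o) u v w (t : R) : Ck 2 f ->
  exists2 y, `|y - u| <= `|t| * (`|v| + `|w|) &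
  (f (u + t *: v + t *: w) : R) - f (u + t *: v) - f (u + t *: w) + f u =
  t ^+ 2 * (Dop (Dop f) y w v : R).
Proof.
move=> [df [ddf _]].
have [|s /andP[s0 s1] Eg] := @mvt01
    (fun s => (f (u + t *: w + s *: (t *: v)) : R) - f (u + s *: (t *: v)))
    (fun s => (Dop f (u + t *: w + s *: (t *: v)) (t *: v) : R) -
       Dop f (u + s *: (t *: v)) (t *: v)).
  by move=> s; apply: is_deriveB; apply: curve_comp => //; exact: line_derive.
pose g (x : V) : R^o := Dop f x v.
have dg x : differentiable g x by exact: eval_differentiable.
have [r /andP[r0 r1] E] := Dop_mvt (u + s *: (t *: v)) (t *: w) dg.
have Zf x : (Dop f x (t *: v) : R) = t * (g x : R) by rewrite linearZ.
exists (u + s *: (t *: v) + r *: (t *: w)).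
  rewrite -[_ + r *: _]addrA [_ - u]addrC addKr (le_trans (ler_normD _ _))//.
  rewrite !normrZ mulrDr lerD//.
    by rewrite ger0_norm// ler_piMl// mulr_ge0.
  by rewrite ger0_norm// ler_piMl// mulr_ge0.
have Eg2 : (Dop g (u + s *: (t *: v) + r *: (t *: w)) (t *: w) : R) =
    t * (Dop (Dop f) (u + s *: (t *: v) + r *: (t *: w)) w v : R).
  apply: etrans (Dop_eval v (t *: w) (ddf _)) _.
  exact: (congr1 (fun L : clinear V R^o => L v) (linearZ _ _)).
have aux (a b c e x y p : R) : b - c - (a - e) = t * x - t * y ->
    x - y = t * p -> b - c - a + e = t ^+ 2 * p.
  by move=> h1 h2; rewrite expr2 -mulrA -h2 mulrBr -h1; ring.
apply: aux (etrans E Eg2).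
move: Eg; rewrite (Zf (u + t *: w + s *: (t *: v))) (Zf (u + s *: (t *: v))).
rewrite !scale1r !scale0r !addr0 (addrAC u (t *: w) (t *: v)).
by rewrite (addrAC u (t *: w) (s *: (t *: v))).
Qed.

Lemma D2_sym (f : V -> R^o) u v w :
  Ck 2 f -> Dop (Dop f) u v w = Dop (Dop f) u w v.
Proof.
move=> cf; apply/eqP; rewrite -subr_eq0 -normr_le0; apply/ler_addgt0Pl => e e0.
pose r := 1 + `|v| + `|w|; have r0 : 0 < r by rewrite ltr_wpDr// ltr_wpDr.
pose k := e / (2 * r ^+ 2).
have k0 : 0 < k by rewrite divr_gt0// mulr_gt0// exprn_gt0.
have [_ [_ /(_ u)]] := cf.
move=> /cvgrPdist_le /(_ k k0) /nbhs_ballP [d /= d0 dP].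
pose t := d / (2 * r); have t0 : 0 < t by rewrite divr_gt0// mulr_gt0.
have [y yd Ey] := second_difference u v w t cf.
have [x xd Ex] := second_difference u w v t cf.
have tr : `|t| * (`|v| + `|w|) < d.
  rewrite gtr0_norm// /t mulrAC ltr_pdivrMr ?mulr_gt0// ltr_pM2l// /r.
  by have := normr_ge0 v; have := normr_ge0 w; lra.
have closex a b q : `|q - u| <= `|t| * (`|v| + `|w|) -> `|a| <= r -> `|b| <= r ->
   `|(Dop (Dop f) u a b : R) - Dop (Dop f) q a b| <= k * r ^+ 2.
  move=> qd ar br; have {}dP : `|Dop (Dop f) u - Dop (Dop f) q| <= k.
    by apply: dP; rewrite -ball_normE /= distrC (le_lt_trans qd).
  have := clinear2_le (Dop (Dop f) u - Dop (Dop f) q) a b.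
  rewrite clinear2BE => /le_trans; apply.
  by rewrite expr2 mulrA ler_pM ?ler_pM ?mulr_ge0.
have vr : `|v| <= r by rewrite /r; have := normr_ge0 w; lra.
have wr : `|w| <= r by rewrite /r; have := normr_ge0 v; lra.
have xd' : `|x - u| <= `|t| * (`|v| + `|w|) by rewrite [_ + `|w|]addrC.
have h1 := closex v w x xd' vr wr; have h2 := closex w v y yd wr vr.
(* Both sides are the same second difference divided by [t ^+ 2], its terms being only permuted. *)
have E : (Dop (Dop f) y w v : R) = Dop (Dop f) x v w.
  have t20 : t ^+ 2 != 0 by rewrite expf_neq0// gt_eqF.
  apply: (mulfI t20); rewrite -Ey -Ex.
  have -> : u + t *: v + t *: w = u + t *: w + t *: v by rewrite addrAC.
  set a : R := f _; set b : R := f _; set c : R := f _; set p : R := f _; ring.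
have ke : k * r ^+ 2 = e / 2 by rewrite /k; field; rewrite gt_eqF.
move: h1 h2; rewrite E ke => h1 h2.
have := ler_distD (Dop (Dop f) x v w : R) (Dop (Dop f) u v w : R)
  (Dop (Dop f) u w v : R).
move=> /le_trans -> //; rewrite addr0 [leRHS]splitr lerD// distrC//.
Qed.

End MeanValue.

Section HigherSymmetry.
Context {R : realType}.

Lemma Ck_comp_clinear k (U V W : normedModType R) (L : clinear V W)
    (f : U -> V) : Ck k f -> Ck k (fun x => L (f x)).
Proof.
elim: k V W L f => [|k IH] V W L f /=.
  move=> fc x; have h : L y @[y --> f x] --> L (f x).
    exact: clinear_continuous.
  exact: (cvg_comp f L (fc x) h).
move=> [df cf]; split=> [x|]; first by have [] := Dop_comp_clinear L 0 (df x).
have [P PE] := clinear_postcomp (U := U) L.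
rewrite (_ : Dop _ = (fun x => P (Dop f x))); first exact: IH.
apply/funext => x; apply: clinear_ext => v; rewrite PE.
by have [] := Dop_comp_clinear L v (df x).
Qed.

Lemma Ck_eval k (U V W : normedModType R) (f : U -> clinear V W) y :
  Ck k f -> Ck k (fun x => f x y).
Proof.
move=> cf; have [h hE] := @clinear_eval R V W y.
rewrite (_ : (fun x => f x y) = (fun x => h (f x))).
  exact: Ck_comp_clinear.
by apply/funext => x; rewrite hE.
Qed.

Context {V : normedModType R}.

(** Exchanging the first two arguments is the symmetry of the second derivative of
    [x |-> Dop f x c]; exchanging the last two, in [D3_sym23], comes from differentiating the
    symmetry of [Dop (Dop f)]. *)
Lemma D3_sym12 (f : V -> R^o) u a b c : Ck 3 f ->
  Dop (Dop (Dop f)) u a b c = Dop (Dop (Dop f)) u b a c.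
Proof.
move=> [df [ddf cf]]; have [d3f _] := cf.
pose g x : R^o := Dop f x c.
have gE x p q : Dop (Dop g) x p q = Dop (Dop (Dop f)) x p q c.
  have dg y : differentiable g y by exact: eval_differentiable.
  have ddg y : differentiable (Dop g) y.
    have [_ [+ _]] : Ck 2 g by apply: Ck_eval; split.
    by [].
  rewrite -(Dop_eval q p (ddg x)).
  rewrite (_ : (fun y => Dop g y q) = (fun y => Dop (Dop f) y q c)).
    rewrite (Dop_eval c p); first by rewrite Dop_eval.
    exact: eval_differentiable.
  by apply/funext => y; rewrite Dop_eval.
rewrite -!gE; apply: D2_sym; apply: Ck_eval; split => //.
Qed.

Lemma D3_sym23 (f : V -> R^o) u a b c : Ck 3 f ->
  Dop (Dop (Dop f)) u a b c = Dop (Dop (Dop f)) u a c b.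
Proof.
move=> [df [ddf [d3f c3f]]].
have E p q : Dop (Dop (Dop f)) u a p q =
    Dop (fun y => Dop (Dop f) y p q) u a.
  rewrite (Dop_eval q a); first by rewrite Dop_eval.
  exact: eval_differentiable.
rewrite (E b c) (E c b).
have -> : (fun y => Dop (Dop f) y b c) = (fun y => Dop (Dop f) y c b).
  apply/funext => y; apply: D2_sym.
  by split=> //; split=> // x; apply: differentiable_continuous.
by [].
Qed.

End HigherSymmetry.

(** * The derivatives of [fpert F G e] up to order four *)

Section PerturbedFunctional.
Context {R : realType} {E : completeNormedModType R}.
Variable ip : {dot E for (@idfun R)}.
Hypothesis ip_norm : forall u : E, ip u u = `|u| ^+ 2.

Lemma is_diff_quadratic_remainder (V W : normedModType R) (f : V -> W)
    (L : clinear V W) x (C : R) :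
  (forall h, `|f (h + x) - f x - L h| <= C * `|h| ^+ 2) -> is_diff x f L.
Proof.
move=> fC.
have H : f \o shift x = cst (f x) + L +o_ 0 id.
  apply/eqaddoP => _/posnumP[e].
  have C0 : 0 < 1 + `|C| by rewrite ltr_pwDl.
  near=> h; rewrite /= !fctE.
  rewrite opprD addrA (le_trans (fC _))// expr2 mulrA ler_wpM2r//.
  apply: (@le_trans _ _ ((1 + `|C|) * `|h|)).
    by rewrite ler_wpM2r// (le_trans (ler_norm C))// lerDr.
  rewrite -ler_pdivlMl//; near: h; apply: nbhs0_le.
have dE : 'd f x = L :> (V -> W).
  by apply: diff_unique H; exact: clinear_continuous.
apply: DiffDef => //; apply/diff_locallyP; split; last by rewrite dE.
by rewrite dE; exact: clinear_continuous.
Unshelve. all: by end_near. Qed.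

Lemma ip_clinear :
  {I : clinear E (clinear E R^o) | forall u v, I u v = ip u v}.
Proof.
have cl u : {L : clinear E R^o | forall v, L v = ip u v}.
  apply: (@clinear_of _ _ _ (ip u : E -> R^o) `|u|) => [a x y|x].
    by rewrite ipDr ipZr.
  exact: (cauchy_schwarz ip_norm).
have clE u v : projT1 (cl u) v = ip u v := projT2 (cl u) v.
have [||I IE] := @clinear_of _ _ _ (fun u => projT1 (cl u)) 1.
- move=> a x y; apply: clinear_ext => v; rewrite clinearDE clinearZE.
  by rewrite !clE ipDl ipZl.
- move=> u; rewrite mul1r; apply: clinear_norm_le => // v; rewrite clE.
  exact: (cauchy_schwarz ip_norm).
- by exists I => u v; rewrite IE clE.
Qed.

Definition half_sqr_norm (u : E) : R^o := 2^-1 * `|u| ^+ 2.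

Lemma is_diff_half_sqr_norm (I : clinear E (clinear E R^o)) u :
  (forall u v, I u v = ip u v) -> is_diff u half_sqr_norm (I u).
Proof.
move=> IE; apply: (@is_diff_quadratic_remainder _ _ _ _ _ 2^-1) => h.
rewrite IE /half_sqr_norm (sqr_normD ip_norm) (ipC ip h u).
set a : R := `|h| ^+ 2.
have -> : 2^-1 * (a + 2 * ip u h + `|u| ^+ 2) - 2^-1 * `|u| ^+ 2 - ip u h =
  2^-1 * a by field.
by rewrite ger0_norm// mulr_ge0// ?invr_ge0// exprn_ge0.
Qed.

Lemma Ck_half_sqr_norm k : Ck k half_sqr_norm.
Proof.
have [I IE] := ip_clinear.
case: k => [|k] /=.
  move=> u; apply: differentiable_continuous.
  by have := is_diff_half_sqr_norm u IE => -[].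
split=> [u|]; first by have := is_diff_half_sqr_norm u IE => -[].
rewrite (_ : Dop _ = I); first exact: Ck_clinear.
by apply/funext => u; apply/Dop_unique; exact: is_diff_half_sqr_norm.
Qed.

Variables (F : E -> R^o) (G : R -> E -> R^o).

Lemma fpertE e : fpert F G e = half_sqr_norm - F + G e.
Proof. by []. Qed.

Lemma Ck_fpert k e : Ck k F -> Ck k (G e) -> Ck k (fpert F G e).
Proof.
move=> cF cG; rewrite fpertE; apply: CkD => //; apply: CkD; last exact: CkN.
exact: Ck_half_sqr_norm.
Qed.

Lemma Dop_fun_lin (W : normedModType R) (f g h : E -> W) :
  (forall x, differentiable f x) -> (forall x, differentiable g x) ->
  (forall x, differentiable h x) ->
  Dop (f - g + h) = Dop f - Dop g + Dop h.
Proof.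
move=> df dg dh; apply/funext => x; rewrite DopD//.
  by rewrite DopD ?DopN//; exact: differentiableN.
by apply: differentiableD => //; exact: differentiableN.
Qed.

Hypotheses (CF : Ck 4 F) (CG : forall e, Ck 4 (G e)).

Let I := projT1 ip_clinear.
Let IE u v : I u v = ip u v. Proof. by rewrite /I; case: ip_clinear. Qed.

Let Dop_half : Dop half_sqr_norm = I.
Proof. by apply/funext => u; apply/Dop_unique; exact: is_diff_half_sqr_norm. Qed.

Lemma Dop_fpert_fun e : Dop (fpert F G e) = (I : E -> _) - Dop F + Dop (G e).
Proof.
have [dF _] := CF; have [dG _] := CG e; have [dQ _] := Ck_half_sqr_norm 1.
by rewrite fpertE Dop_fun_lin// Dop_half.
Qed.

Lemma D2_fpert_fun e :
  Dop (Dop (fpert F G e)) = cst I - Dop (Dop F) + Dop (Dop (G e)).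
Proof.
have [_ [dF _]] := CF; have [_ [dG _]] := CG e.
have dI x : differentiable (I : E -> _) x by exact: clinear_differentiable.
apply: etrans (congr1 (@Dop _ _ _) (Dop_fpert_fun e)) _.
apply: etrans (Dop_fun_lin dI dF dG) _.
have DI : Dop (I : E -> _) = cst I by apply/funext => x; exact: Dop_clinear.
exact: (congr1 (fun X => X - Dop (Dop F) + Dop (Dop (G e))) DI).
Qed.

Lemma D3_fpert_fun e : Dop (Dop (Dop (fpert F G e))) =
  Dop (Dop (Dop (G e))) - Dop (Dop (Dop F)).
Proof.
have [_ [_ [dF _]]] := CF; have [_ [_ [dG _]]] := CG e.
have dI x : differentiable (cst I : E -> _) x by exact: differentiable_cst.
apply: etrans (congr1 (@Dop _ _ _) (D2_fpert_fun e)) _.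
apply: etrans (Dop_fun_lin dI dF dG) _.
have DI : Dop (cst I : E -> _) = 0 by apply/funext => x; exact: Dop_cst.
apply: etrans
  (congr1 (fun X => X - Dop (Dop (Dop F)) + Dop (Dop (Dop (G e)))) DI) _.
by rewrite add0r addrC.
Qed.

Lemma D4_fpert_fun e : Dop (Dop (Dop (Dop (fpert F G e)))) =
  Dop (Dop (Dop (Dop (G e)))) - Dop (Dop (Dop (Dop F))).
Proof.
have [_ [_ [_ [dF _]]]] := CF; have [_ [_ [_ [dG _]]]] := CG e.
apply: etrans (congr1 (@Dop _ _ _) (D3_fpert_fun e)) _.
apply/funext => x; apply: etrans (DopD (dG x) (differentiableN (dF x))) _.
exact: (congr1 (fun X => Dop (Dop (Dop (Dop (G e)))) x + X) (DopN (dF x))).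
Qed.

Lemma Dop_fpert e u v : (Dop (fpert F G e) u v : R) =
  ip u v - (Dop F u v : R) + (Dop (G e) u v : R).
Proof.
rewrite -IE.
exact: (congr1 (fun L : E -> clinear E R^o => L u v) (Dop_fpert_fun e)).
Qed.

Lemma D2_fpert e u v w : (Dop (Dop (fpert F G e)) u v w : R) =
  ip v w - (Dop (Dop F) u v w : R) + (Dop (Dop (G e)) u v w : R).
Proof.
have E1 : Dop (Dop (fpert F G e)) u = I - Dop (Dop F) u + Dop (Dop (G e)) u.
  exact: (congr1 (fun L : E -> clinear E (clinear E R^o) => L u)
    (D2_fpert_fun e)).
have E2 := etrans (congr1 (fun L : clinear E (clinear E R^o) => L v) E1)
  (clinear_linE _ _ _ v).
have E3 := etrans (congr1 (fun L : clinear E R^o => L w) E2)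
  (clinear_linE _ _ _ w).
apply: etrans E3 _.
exact: (congr1 (fun r : R => r - (Dop (Dop F) u v w : R) +
  (Dop (Dop (G e)) u v w : R)) (IE v w)).
Qed.

Lemma D3_fpert e u a b c : (Dop (Dop (Dop (fpert F G e))) u a b c : R) =
  (Dop (Dop (Dop (G e))) u a b c : R) - (Dop (Dop (Dop F)) u a b c : R).
Proof.
have E1 : Dop (Dop (Dop (fpert F G e))) u =
    Dop (Dop (Dop (G e))) u - Dop (Dop (Dop F)) u.
  exact: (congr1 (fun L : E -> clinear E (clinear E (clinear E R^o)) => L u)
    (D3_fpert_fun e)).
have E2 := etrans (congr1 (fun L : clinear E (clinear E (clinear E R^o)) => L a) E1)
  (clinearBE _ _ a).
have E3 := etrans (congr1 (fun L : clinear E (clinear E R^o) => L b) E2)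
  (clinearBE _ _ b).
exact: (etrans (congr1 (fun L : clinear E R^o => L c) E3) (clinearBE _ _ c)).
Qed.

End PerturbedFunctional.

(** * Statements uniform for small [e > 0] and for points near a given one *)

Section SmallNear.
Context {R : realType} {V : normedModType R}.

(* The filter [0^'+ * nbhs x0] with an explicit common radius. *)
Definition small_near (x0 : V) (P : R -> V -> Prop) :=
  exists2 r, 0 < r & forall e x, 0 < e -> e < r -> `|x - x0| < r -> P e x.

Implicit Types P Q : R -> V -> Prop.

Lemma small_nearS (x0 : V) P Q : (forall e x, 0 < e -> P e x -> Q e x) ->
  small_near x0 P -> small_near x0 Q.
Proof. by move=> PQ [r r0 rP]; exists r => // e x e0 er xr; apply/PQ/rP. Qed.

Lemma small_nearI (x0 : V) P Q : small_near x0 P -> small_near x0 Q ->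
  small_near x0 (fun e x => P e x /\ Q e x).
Proof.
move=> [r r0 rP] [s s0 sQ]; exists (Num.min r s); first by rewrite lt_min r0.
move=> e x e0; rewrite !lt_min => /andP[er es] /andP[xr xs].
by split; [exact: rP|exact: sQ].
Qed.

Lemma small_near_forall (I : finType) (x0 : V) (P : I -> R -> V -> Prop) :
  (forall i, small_near x0 (P i)) ->
  small_near x0 (fun e x => forall i, P i e x).
Proof.
move=> Pi; suff : forall s : seq I,
    small_near x0 (fun e x => forall i, i \in s -> P i e x).
  by move=> /(_ (enum I)); apply: small_nearS => e x _ + i; apply; rewrite mem_enum.
elim=> [|i s IH]; first by exists 1.
apply: small_nearS (small_nearI (Pi i) IH) => e x _ [Pix Psx] j.
by rewrite in_cons => /orP[/eqP ->|/Psx].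
Qed.

Lemma small_near_left (x0 : V) (P : R -> Prop) :
  (\forall e \near 0^'+, P e) -> small_near x0 (fun e _ => P e).
Proof.
move=> /nbhs_normP[r /= r0 rP]; exists r => // e x e0 er _.
by apply: rP => //=; rewrite sub0r normrN gtr0_norm.
Qed.

Lemma small_near_right (x0 : V) (P : V -> Prop) :
  (\forall x \near x0, P x) -> small_near x0 (fun _ x => P x).
Proof.
move=> /nbhs_normP[r /= r0 rP]; exists r => // e x e0 er xr.
by apply: rP => //=; rewrite distrC.
Qed.

Lemma small_near_exponent (x0 : V) : small_near x0 (fun e _ => e <= 1).
Proof. by exists 1 => // e x _ /ltW. Qed.

Lemma small_nearP (x0 : V) P :
  small_near x0 P <-> \forall e \near 0^'+ & x \near x0, P e x.
Proof.
split=> [[r r0 rP]|].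
  exists ([set e | 0 < e < r], [set x | `|x - x0| < r]).
    split=> /=.
      near=> e; apply/andP; split; first by near: e; exact: nbhs_right_gt.
      by near: e; exact: nbhs_right_lt.
    by apply/nbhs_normP; exists r => //= x /=; rewrite distrC.
  by move=> [e x] /= [/andP[e0 er] xr]; exact: rP.
move=> [[A B] /= [A0 Bx] AB].
apply: small_nearS (small_nearI (small_near_left x0 A0) (small_near_right Bx)).
by move=> e x e0 [Ae Bx']; exact: (AB (e, x)).
Unshelve. all: by end_near. Qed.

Lemma small_near_along (x0 : V) P (x_ : R -> V) : small_near x0 P ->
  x_ e @[e --> 0^'+] --> x0 -> \forall e \near 0^'+, P e (x_ e).
Proof.
move=> [r r0 rP] xc; near=> e; apply: rP.
- by near: e; exact: nbhs_right_gt.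
- by near: e; exact: nbhs_right_lt.
- rewrite distrC; near: e; move/cvgrPdist_lt: xc; exact.
Unshelve. all: by end_near. Qed.

(* A sequence of bad pairs [(e_n, x_n)] is interpolated by a function of [e],
   constant equal to [x0] off the [e_n]; it converges since each [e_n] is
   positive. *)
Lemma small_near_of_along (x0 : V) P :
  (forall x_ : R -> V, x_ e @[e --> 0^'+] --> x0 ->
     \forall e \near 0^'+, P e (x_ e)) -> small_near x0 P.
Proof.
move=> alongP; apply: contrapT => nP.
have /choice [p pP] (n : nat) : exists p : R * V,
    [/\ 0 < p.1, p.1 < n.+1%:R^-1, `|p.2 - x0| < n.+1%:R^-1 & ~ P p.1 p.2].
  apply: contrapT => /forallNP np; apply: nP.
  exists n.+1%:R^-1; first by rewrite invr_gt0.
  move=> e x e0 er xr; apply: contrapT => nPe.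
  by apply: (np (e, x)).
pose bad e n := e = (p n).1.
pose x_ e := if pselect (exists n, bad e n) is left ex then (p (projT1 (cid ex))).2
  else x0.
have xbad e n : bad e n -> exists2 m, bad e m & x_ e = (p m).2.
  rewrite /x_; case: pselect => [ex _|nex en]; last by case: nex; exists n.
  by case: cid => m em /=; exists m.
have xc : x_ e @[e --> 0^'+] --> x0.
  apply/cvgrPdist_lt => k k0.
  have [N _ NP] := near_infty_natSinv_lt (PosNum k0).
  (* Below the first [N] values [(p n).1] only indices [m >= N] can occur, and these have [(p m).2]
     close to [x0]. *)
  have small : \forall e \near 0^'+, forall n, (n < N)%N -> e < (p n).1.
    elim: N {NP} => [|N IH]; first by apply: nearW.
    near=> e => n; rewrite ltnS leq_eqVlt => /orP[/eqP ->|nN].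
      by near: e; apply: nbhs_right_lt; have [] := pP N.
    by move: n nN; near: e; exact: IH.
  near=> e.
  rewrite /x_; case: pselect => [ex|_]; last by rewrite subrr normr0.
  case: cid => m em /=; rewrite distrC; have [_ _ /lt_trans + _] := pP m; apply.
  apply: NP => /=; rewrite leqNgt; apply/negP => mN.
  have : e < (p m).1 by move: m mN {em}; near: e; exact: small.
  by rewrite em ltxx.
have := alongP x_ xc => /nbhs_normP[r /= r0 rP].
have [N _ NP] := near_infty_natSinv_lt (PosNum r0).
have [pN0 pN1 _ _] := pP N.
have pr : (p N).1 < r by apply: lt_trans pN1 (NP N (leqnn N)).
(* The value of [x_] at [(p N).1] may come from another index with the same first component; that
   pair is bad as well. *)
have [m em xE] := xbad _ N (erefl _).
have [_ _ _] := pP m; apply; rewrite -em -xE; apply: rP => //=.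
by rewrite sub0r normrN gtr0_norm.
Unshelve. all: by end_near. Qed.

End SmallNear.

(** * Coordinates: linear and bilinear combinations, partial derivatives *)

Section FiniteSums.
Context {R : realType} {d : nat}.

Lemma norm_entry_le (h : 'rV[R]_d) i : `|h 0 i| <= `|h|.
Proof.
rewrite [leRHS]/Num.norm/= mx_normrE.
exact: (le_bigmax _ (fun ij : 'I_1 * 'I_d => `|h ij.1 ij.2|) (0, i)).
Qed.

Lemma clinear_sumE (V W : normedModType R) I (r : seq I) (P : pred I)
    (f : I -> clinear V W) x :
  (\sum_(i <- r | P i) f i) x = \sum_(i <- r | P i) f i x.
Proof.
elim: r => [|i r IH]; rewrite ?big_nil// !big_cons.
by case: ifP => _ //; rewrite clinearDE IH.
Qed.

Lemma norm_row_comb_le (W : normedModType R) (X : 'I_d -> W) (B : R)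
    (h : 'rV[R]_d) : (forall i, `|X i| <= B) ->
  `|\sum_i h 0 i *: X i| <= d%:R * B * `|h|.
Proof.
move=> XB; apply: (le_trans (ler_norm_sum _ _ _)).
apply: (@le_trans _ _ (\sum_(i < d) B * `|h|)); last first.
  by rewrite sumr_const card_ord -[leLHS]mulr_natl mulrA.
apply: ler_sum => i _; rewrite normrZ mulrC ler_pM//; exact: norm_entry_le.
Qed.

Lemma norm_row_comb2_le (W : normedModType R) (X : 'I_d -> 'I_d -> W) (B : R)
    (h : 'rV[R]_d) : (forall i j, `|X i j| <= B) ->
  `|\sum_i h 0 i *: (\sum_j h 0 j *: X i j)| <= d%:R ^+ 2 * B * `|h| ^+ 2.
Proof.
move=> XB; apply: le_trans (norm_row_comb_le _ _) _.
  by move=> i; exact: norm_row_comb_le (XB i).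
by rewrite !expr2; set a := `|h|; rewrite le_eqVlt; apply/orP; left; apply/eqP; ring.
Qed.

Lemma clinear_row (W : normedModType R) (f : clinear 'rV[R]_d W) (h : 'rV[R]_d) :
  f h = \sum_i h 0 i *: f (delta_mx 0 i).
Proof.
rewrite [in LHS](row_sum_delta h) linear_sum; apply: eq_bigr => i _.
by rewrite linearZ.
Qed.

End FiniteSums.

Section Partials.
Context {R : realType} {d : nat} {W : normedModType R}.
Variable z : 'rV[R]_d -> W.
Hypothesis Cz : Ck 2 z.

Lemma partialE eta i : partial i z eta = Dop z eta (delta_mx 0 i).
Proof. by have [dz _] := Cz; rewrite /partial deriveE// DopE. Qed.

Lemma partial2E eta i j : partial i (partial j z) eta =
  Dop (Dop z) eta (delta_mx 0 i) (delta_mx 0 j).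
Proof.
have [dz [ddz _]] := Cz.
have -> : partial j z = fun x => Dop z x (delta_mx 0 j).
  by apply/funext => x; rewrite partialE.
rewrite /partial deriveE; last exact: eval_differentiable.
rewrite -DopE; last exact: eval_differentiable.
exact: Dop_eval.
Qed.

Lemma Dop_row eta h : Dop z eta h = \sum_i h 0 i *: partial i z eta.
Proof. by rewrite clinear_row; apply: eq_bigr => i _; rewrite partialE. Qed.

Lemma Dop2_row eta h : Dop (Dop z) eta h h =
  \sum_i h 0 i *: (\sum_j h 0 j *: partial i (partial j z) eta).
Proof.
apply: etrans (congr1 (fun L : clinear 'rV[R]_d W => L h)
  (clinear_row (Dop (Dop z) eta) h)) _.
rewrite clinear_sumE; apply: eq_bigr => i _.
rewrite clinearZE clinear_row; congr (_ *: _).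
by apply: eq_bigr => j _; rewrite partial2E.
Qed.

End Partials.

Lemma clinear3_le {R : realType} {U V W X : normedModType R}
    (f : clinear U (clinear V (clinear W X))) a b c :
  `|f a b c| <= `|f| * `|a| * `|b| * `|c|.
Proof.
by rewrite (le_trans (clinear2_le _ _ _))// ler_wpM2r// ler_wpM2r// clinear_le.
Qed.

Lemma clinear4_le {R : realType} {U V W X Y : normedModType R}
    (f : clinear U (clinear V (clinear W (clinear X Y)))) a b c p :
  `|f a b c p| <= `|f| * `|a| * `|b| * `|c| * `|p|.
Proof.
rewrite (le_trans (clinear3_le _ _ _ _))// ler_wpM2r// ler_wpM2r// ler_wpM2r//.
exact: clinear_le.
Qed.

(* Bounds for forms, with the norm of [R] rather than that of [R^o]. *)
Section FormBounds.
Context {R : realType} {U V W X : normedModType R}.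

Lemma form2_le (f : clinear U (clinear V R^o)) a b :
  `|(f a b : R)| <= `|f| * `|a| * `|b|.
Proof. exact: clinear2_le. Qed.

Lemma form2_sub_le (f g : clinear U (clinear V R^o)) a b :
  `|(f a b : R) - (g a b : R)| <= `|f - g| * `|a| * `|b|.
Proof.
have E := congr1 (fun x : R => `|x|) (esym (clinear2BE f g a b)).
by apply: le_trans (form2_le (f - g) a b); rewrite le_eqVlt; apply/orP; left; apply/eqP.
Qed.

Lemma form3_le (f : clinear U (clinear V (clinear W R^o))) a b c :
  `|(f a b c : R)| <= `|f| * `|a| * `|b| * `|c|.
Proof. exact: (@clinear3_le R U V W R^o f a b c). Qed.

Lemma form4_le (f : clinear U (clinear V (clinear W (clinear X R^o)))) a b c q :
  `|(f a b c q : R)| <= `|f| * `|a| * `|b| * `|c| * `|q|.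
Proof. exact: (@clinear4_le R U V W X R^o f a b c q). Qed.

End FormBounds.

Lemma abs_sub_le3 {R : realType} (M q x y na nb nc : R) :
  q = x - y -> `|x| <= 1 * na * nb * nc ->
  `|y| <= (1 + M) * na * nb * nc -> `|q| <= (2 + M) * na * nb * nc.
Proof.
move=> ->; rewrite -!mulrA mul1r !mulrDl mul1r => hx hy.
apply: le_trans (ler_normB _ _) _; move: hx hy.
by set X := `|x|; set Y := `|y|; set m := na * _; move=> hx hy; lra.
Qed.

Section ProductNear.
Context {R : realType} {V : normedModType R}.

Lemma small_near_of_nbhs (x0 : V) (P : R * V -> Prop) :
  (\forall p \near ((0 : R), x0), P p) -> small_near x0 (fun e x => P (e, x)).
Proof.
move=> [[A B] /= [A0 Bx] AB]; apply/small_nearP.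
exists (A, B); last by move=> [e x] /= [Ae Bx']; exact: (AB (e, x)).
by split=> //=; apply: cvg_within A0.
Qed.

Lemma small_near_continuous (W : normedModType R) (f : R * V -> W) (x0 : V)
    (k : R) :
  continuous f -> 0 < k ->
  small_near x0 (fun e x => `|f (e, x) - f (0, x0)| <= k).
Proof.
move=> /(_ (0, x0)) /cvgrPdist_le /(_ k) fc k0.
apply: small_nearS (small_near_of_nbhs (fc k0)) => e x _.
by rewrite distrC.
Qed.

Lemma small_near_continuous_right (W : normedModType R) (f : V -> W) (x0 : V)
    (k : R) :
  {for x0, continuous f} -> 0 < k ->
  small_near x0 (fun _ x => `|f x - f x0| <= k).
Proof.
move=> /cvgrPdist_le /(_ k) fc k0.
by apply: small_nearS (small_near_right (fc k0)) => e x _; rewrite distrC.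
Qed.

(* Pulling a neighbourhood of [g y0] back along [(y, w) |-> g y + w]. *)
Lemma small_near_translate (W : normedModType R) (g : V -> W) (y0 : V)
    (P : R -> W -> Prop) :
  {for y0, continuous g} -> small_near (g y0) P ->
  exists2 r, 0 < r &
    small_near y0 (fun e y => forall w, `|w| <= r -> P e (g y + w)).
Proof.
move=> gc [r r0 rP]; have r20 : 0 < r / 4 by rewrite divr_gt0.
exists (r / 4) => //.
have [s s0 sP] := small_near_continuous_right gc r20.
exists (Num.min r s); first by rewrite lt_min r0.
move=> e y e0; rewrite !lt_min => /andP[er es] /andP[yr ys] w wr.
apply: rP => //; rewrite addrAC (le_lt_trans (ler_normD _ _))//.
have := sP e y e0 es ys; move: wr; set a := `|w|; set b := `|_|; lra.
Qed.

End ProductNear.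

(** * Local bounds for the second, third and fourth derivatives of [fpert F G e] *)

Section PointEstimates.
Context {R : realType} {E : completeNormedModType R}.
Variable ip : {dot E for (@idfun R)}.
Hypothesis ip_norm : forall u : E, ip u u = `|u| ^+ 2.
Variables (F : E -> R^o) (G : R -> E -> R^o) (p : E).
Hypotheses (HF4 : Ck 4 F) (HG4 : forall e, Ck 4 (G e)).
Hypothesis HG0_zero : forall u, G 0 u = 0.
Hypothesis HG2_hess : continuous (fun p : R * E => hess ip (G p.1) p.2).
Hypothesis HG4_third : continuous (fun p : R * E => third ip (G p.1) p.2).
Hypothesis HG4_fourth : fourth_bounded_near G p.

(** With continuity at [(0, p)], this makes the Hessian of [G e] small near [p]; [third_at0] does
    the same for the third derivative. *)
Lemma hess_at0 u : hess ip (G 0) u = 0.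
Proof.
apply: clinear_ext => v; apply: (ip_eq ip_norm) => y.
rewrite (hessP ip_norm) clinear0E ip0l.
have -> : G 0 = fun=> 0 by apply/funext.
have -> : Dop (fun _ : E => 0 : R^o) = fun=> 0.
  by apply/funext => x; rewrite Dop_cst.
by rewrite Dop_cst !clinear0E.
Qed.

Lemma third_at0 u : third ip (G 0) u = 0.
Proof.
apply: clinear_ext => v; apply: clinear_ext => v'.
apply: (ip_eq ip_norm) => y.
rewrite (thirdP ip_norm) !clinear0E ip0l.
have -> : G 0 = fun=> 0 by apply/funext.
have -> : Dop (fun _ : E => 0 : R^o) = fun=> 0.
  by apply/funext => x; rewrite Dop_cst.
have -> : Dop (fun _ : E => 0 : clinear E R^o) = fun=> 0.
  by apply/funext => x; rewrite Dop_cst.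
by rewrite Dop_cst !clinear0E.
Qed.

Lemma D2_hess_le e u v y :
  `|(Dop (Dop (G e)) u v y : R)| <= `|hess ip (G e) u| * `|v| * `|y|.
Proof.
rewrite -(hessP ip_norm) (le_trans (cauchy_schwarz ip_norm _ _))// ler_wpM2r//.
exact: clinear_le.
Qed.

Lemma D3_third_le e u a b c :
  `|(Dop (Dop (Dop (G e))) u a b c : R)| <= `|third ip (G e) u| * `|a| * `|b| * `|c|.
Proof.
rewrite -(thirdP ip_norm) (le_trans (cauchy_schwarz ip_norm _ _))// ler_wpM2r//.
exact: clinear2_le.
Qed.

Lemma D2_fpert_near (k : R) : 0 < k -> small_near p (fun e u => forall v y,
  `|(D2form (fpert F G e) u v y : R) - D2form (fpert F G 0) p v y|
    <= k * `|v| * `|y|).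
Proof.
move=> k0; have k20 : 0 < k / 2 by rewrite divr_gt0.
have [dF [ddF [dddF _]]] := HF4.
have h1 := small_near_continuous p HG2_hess k20.
have h2 := small_near_continuous_right (differentiable_continuous (dddF p)) k20.
apply: small_nearS (small_nearI h1 h2) => e u _ /= [].
rewrite hess_at0 subr0 => Ge Fe v y.
have G0 : (Dop (Dop (G 0)) p v y : R) = 0.
  by apply: etrans (esym (hessP ip_norm _ _ _ _)) _; rewrite hess_at0 clinear0E ip0l.
have h3 := le_trans (D2_hess_le e u v y)
  (ler_wpM2r (normr_ge0 y) (ler_wpM2r (normr_ge0 v) Ge)).
have h4 := le_trans (form2_sub_le (Dop (Dop F) u) (Dop (Dop F) p) v y)
  (ler_wpM2r (normr_ge0 y) (ler_wpM2r (normr_ge0 v) Fe)).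
(* A statement on variables of type [R], so that [lra] does not meet the values of the forms, which
   lie in [R^o]. The same device recurs below. *)
have aux (x x' a b c g g' nv ny : R) : x = a - b + g -> x' = a - c + g' -> g' = 0 ->
    `|b - c| <= k / 2 * nv * ny -> `|g| <= k / 2 * nv * ny ->
    `|x - x'| <= k * nv * ny.
  move=> -> -> ->.
  by rewrite !ler_norml => /andP[? ?] /andP[? ?]; apply/andP; split; lra.
exact: aux (D2_fpert ip_norm HF4 HG4 e u v y) (D2_fpert ip_norm HF4 HG4 0 p v y)
  G0 h4 h3.
Qed.

Lemma D3_fpert_near : exists2 C, 0 <= C & small_near p (fun e u => forall a b c,
  `|(Dop (Dop (Dop (fpert F G e))) u a b c : R)| <= C * `|a| * `|b| * `|c|).
Proof.
have [_ [_ [_ [d3F _]]]] := HF4.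
have h1 := small_near_continuous p HG4_third ltr01.
have h2 := small_near_continuous_right (differentiable_continuous (d3F p)) ltr01.
set M := `|Dop (Dop (Dop F)) p|.
exists (2 + M); first by rewrite /M addr_ge0.
apply: small_nearS (small_nearI h1 h2) => e u _ /= [].
rewrite third_at0 subr0 => Ge Fe a b c.
have Fe' : `|Dop (Dop (Dop F)) u| <= 1 + M.
  rewrite -[X in `|X|](subrK (Dop (Dop (Dop F)) p)).
  by rewrite (le_trans (ler_normD _ _))// lerD2r.
have h3 := le_trans (D3_third_le e u a b c) (ler_wpM2r (normr_ge0 c)
  (ler_wpM2r (normr_ge0 b) (ler_wpM2r (normr_ge0 a) Ge))).
have h4 := le_trans (form3_le (Dop (Dop (Dop F)) u) a b c)
  (ler_wpM2r (normr_ge0 c)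
  (ler_wpM2r (normr_ge0 b) (ler_wpM2r (normr_ge0 a) Fe'))).
exact: abs_sub_le3 (D3_fpert ip_norm HF4 HG4 e u a b c) h3 h4.
Qed.

Lemma D4_fpert_near : exists2 C, 0 <= C &
  small_near p (fun e u => forall a b c q,
  `|(Dop (Dop (Dop (Dop (fpert F G e)))) u a b c q : R)|
     <= C * `|a| * `|b| * `|c| * `|q|).
Proof.
have [_ [_ [_ [_ d4F]]]] := HF4.
have [M0 /small_nearP h1] := HG4_fourth.
have h2 := small_near_continuous_right (d4F p) ltr01.
set M := `|Dop (Dop (Dop (Dop F))) p| in h2.
pose N := `|M0|.
exists (N + (1 + M)); first by rewrite /N /M !addr_ge0.
apply: small_nearS (small_nearI h1 h2) => e u _ /= [Ge Fe] a b c q.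
have Fe' : `|Dop (Dop (Dop (Dop F))) u| <= 1 + M.
  rewrite -[X in `|X|](subrK (Dop (Dop (Dop (Dop F))) p)).
  by rewrite (le_trans (ler_normD _ _))// lerD2r.
have Ge' := le_trans Ge (ler_norm M0).
have E4 : Dop (Dop (Dop (Dop (fpert F G e)))) u =
    Dop (Dop (Dop (Dop (G e)))) u - Dop (Dop (Dop (Dop F))) u.
  exact: (congr1 (fun L : E -> clinear E (clinear E (clinear E (clinear E R^o)))
    => L u) (D4_fpert_fun ip_norm HF4 HG4 e)).
apply: le_trans (form4_le _ _ _ _ _) _.
do 4!apply: ler_wpM2r => //.
apply: le_trans (_ : `|Dop (Dop (Dop (Dop (G e)))) u| +
  `|Dop (Dop (Dop (Dop F))) u| <= _); last exact: lerD.
apply: le_trans (ler_normB _ _).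
by rewrite -E4.
Qed.

End PointEstimates.

(** * The scale [e ^ (alpha / 2)] *)

Section Scales.
Context {R : realType}.
Variable alpha : R.
Hypothesis alpha_gt0 : 0 < alpha.

Definition scale (e : R) : R := e `^ (alpha / 2).

Lemma scale_gt0 e : 0 < e -> 0 < scale e.
Proof. exact: powR_gt0. Qed.

Lemma scale_le1 e : 0 < e -> e <= 1 -> scale e <= 1.
Proof.
move=> e0 e1; apply: (@le_trans _ _ (1 `^ (alpha / 2))); last by rewrite powR1.
apply: ge0_ler_powR => //; rewrite ?nnegrE ?ler01 ?(ltW e0)//.
by rewrite divr_ge0// ltW.
Qed.

Lemma sqr_scale e : scale e ^+ 2 = e `^ alpha.
Proof.
rewrite /scale -powR_mulrn ?powR_ge0// -powRrM; congr (_ `^ _).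
by field.
Qed.

Lemma powRN_scale e : e `^ (- (alpha / 2)) = (scale e)^-1.
Proof. by rewrite powRN. Qed.

Context {V W : normedModType R}.

(** (G5) gives limits along families [th_] tending to [th]. Through [small_near_of_along] they
    become bounds uniform in [(e, eta)], a form that survives sums over indices and mean values
    along segments. *)
Lemma small_near_littleo (th : V) (X : R -> V -> W) :
  (forall th_ : R -> V, th_ e @[e --> 0^'+] --> th ->
     e `^ (- (alpha / 2)) *: X e (th_ e) @[e --> 0^'+] --> (0 : W)) ->
  forall k, 0 < k -> small_near th (fun e eta => `|X e eta| <= k * scale e).
Proof.
move=> X0 k k0; apply: small_near_of_along => th_ /X0 /cvgr0Pnorm_le /(_ k k0).
move=> Xk; near=> e.
have e0 : 0 < e by near: e; exact: nbhs_right_gt.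
have : `|e `^ (- (alpha / 2)) *: X e (th_ e)| <= k by near: e; exact: Xk.
rewrite normrZ powRN_scale normfV (gtr0_norm (scale_gt0 e0)) mulrC.
by rewrite ler_pdivrMr// scale_gt0.
Unshelve. all: by end_near. Qed.

Lemma small_near_littleo_sqr (th : V) (X Y : R -> V -> R) (l : R) :
  (forall th_ : R -> V, th_ e @[e --> 0^'+] --> th ->
     e `^ (- alpha) * X e (th_ e) + e `^ (- alpha) * Y e (th_ e)
       @[e --> 0^'+] --> (l : R^o)) ->
  forall k, 0 < k -> small_near th (fun e eta =>
    `|X e eta + Y e eta - scale e ^+ 2 * l| <= k * scale e ^+ 2).
Proof.
move=> X0 k k0; apply: small_near_of_along => th_ /X0 /cvgrPdist_le /(_ k k0).
move=> Xk; near=> e.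
have e0 : 0 < e by near: e; exact: nbhs_right_gt.
have : `|l - (e `^ (- alpha) * X e (th_ e) + e `^ (- alpha) * Y e (th_ e))| <= k.
  by near: e; exact: Xk.
have s0 : 0 < scale e ^+ 2 by rewrite exprn_gt0// scale_gt0.
rewrite powRN -sqr_scale -mulrDr -(ler_pM2r s0) => h.
have -> : X e (th_ e) + Y e (th_ e) - scale e ^+ 2 * l =
    - ((l - (scale e ^+ 2)^-1 * (X e (th_ e) + Y e (th_ e))) * scale e ^+ 2).
  by field; rewrite gt_eqF// scale_gt0.
by rewrite normrN normrM (gtr0_norm s0).
Unshelve. all: by end_near. Qed.

End Scales.

(** * Derivatives of [G e] in the directions tangent to the manifold *)

Section TangentEstimates.
Context {R : realType} {E : completeNormedModType R}.
Variable ip : {dot E for (@idfun R)}.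
Hypothesis ip_norm : forall u : E, ip u u = `|u| ^+ 2.
Variables (F : E -> R^o) (G : R -> E -> R^o) (d : nat) (z : 'rV[R]_d -> E).
Variables (alpha : R) (H : 'I_d -> 'I_d -> R) (th : 'rV[R]_d).
Hypothesis alpha_gt0 : 0 < alpha.
Hypothesis Cz : Ck 2 z.
Hypothesis HG3_grad :
  (fun e => grad ip (G e) (z th)) =o_ (0^'+) (fun e => e `^ (alpha / 2) : R^o).
Hypothesis HG4 : forall e, Ck 4 (G e).
Hypothesis HG5 : forall th_ : R -> 'rV[R]_d,
  th_ e @[e --> 0^'+] --> th ->
  forall i j,
  [/\ e `^ (- alpha) *
        ip (grad ip (G e) (z (th_ e))) (partial i (partial j z) (th_ e)) +
      e `^ (- alpha) *
        ip (hess ip (G e) (z (th_ e)) (partial i z (th_ e)))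
           (partial j z (th_ e))
        @[e --> 0^'+] --> (H i j : R^o),
      e `^ (- (alpha / 2)) *:
        hess ip (G e) (z (th_ e)) (partial i z (th_ e))
        @[e --> 0^'+] --> (0 : E),
      e `^ (- (alpha / 2)) *:
        hess ip (G e) (z (th_ e)) (partial i (partial j z) (th_ e))
        @[e --> 0^'+] --> (0 : E) &
      e `^ (- (alpha / 2)) *:
        third ip (G e) (z (th_ e)) (partial i z (th_ e))
          (partial j z (th_ e))
        @[e --> 0^'+] --> (0 : E)].

Local Notation s := (scale alpha).
Local Notation T := (Dop z).
Local Notation S eta h := (Dop (Dop z) eta h h).

Definition quad_form (h : 'rV[R]_d) : R :=
  \sum_i h 0 i * (\sum_j h 0 j * H i j).

(** A combination of [d] vectors, or of [d ^ 2] vectors in [norm_div_sqr], is bounded by [k] if each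
    of them is bounded by this share of [k]; [d.+1] keeps the share positive also for [d = 0]. *)
Lemma norm_div (k : R) : 0 < k -> d%:R * (k / d.+1%:R) <= k.
Proof.
by move=> k0; rewrite mulrCA ler_piMr ?(ltW k0)// ler_pdivrMr// mul1r ler_nat.
Qed.

Lemma norm_div_sqr (k : R) : 0 < k -> d%:R ^+ 2 * (k / d.+1%:R ^+ 2) <= k.
Proof.
move=> k0; rewrite mulrCA ler_piMr ?(ltW k0)// ler_pdivrMr ?exprn_gt0// mul1r.
by rewrite lerXn2r ?nnegrE ?ler_nat.
Qed.

Lemma hess_tangent_near k : 0 < k -> small_near th (fun e eta => forall h,
  `|hess ip (G e) (z eta) (T eta h)| <= k * s e * `|h|).
Proof.
move=> k0; have k10 : 0 < k / d.+1%:R by rewrite divr_gt0.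
have hi i : small_near th (fun e eta =>
    `|hess ip (G e) (z eta) (partial i z eta)| <= k / d.+1%:R * s e).
  by apply: small_near_littleo k10 => th_ /HG5/(_ i i)[].
apply: small_nearS (small_near_forall hi) => e eta e0 hk h.
rewrite (Dop_row Cz) linear_sum/=.
under eq_bigr do rewrite linearZ/=.
apply: le_trans (norm_row_comb_le _ hk) _.
rewrite ler_wpM2r// [d%:R * _]mulrA ler_wpM2r ?(ltW (scale_gt0 _ _))//.
exact: norm_div.
Qed.

Lemma hess_second_near k : 0 < k -> small_near th (fun e eta => forall h,
  `|hess ip (G e) (z eta) (S eta h)| <= k * s e * `|h| ^+ 2).
Proof.
move=> k0; have k10 : 0 < k / d.+1%:R ^+ 2 by rewrite divr_gt0// exprn_gt0.
have hi i j : small_near th (fun e eta =>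
    `|hess ip (G e) (z eta) (partial i (partial j z) eta)|
      <= k / d.+1%:R ^+ 2 * s e).
  by apply: small_near_littleo k10 => th_ /HG5/(_ i j)[].
have hi2 := small_near_forall (fun i => small_near_forall (hi i)).
apply: small_nearS hi2 => e eta e0 hk h.
rewrite (Dop2_row Cz) linear_sum/=.
have -> : \sum_i hess ip (G e) (z eta)
      (h 0 i *: (\sum_j h 0 j *: partial i (partial j z) eta)) =
    \sum_i h 0 i *: (\sum_j h 0 j *:
      hess ip (G e) (z eta) (partial i (partial j z) eta)).
  apply: eq_bigr => i _; rewrite linearZ/= linear_sum/=; congr (_ *: _).
  by apply: eq_bigr => j _; rewrite linearZ.
apply: le_trans (norm_row_comb2_le _ hk) _.
rewrite ler_wpM2r ?exprn_ge0// [d%:R ^+ 2 * _]mulrA ler_wpM2r ?(ltW (scale_gt0 _ _))//.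
exact: norm_div_sqr.
Qed.

Lemma third_tangent_near k : 0 < k -> small_near th (fun e eta => forall h,
  `|third ip (G e) (z eta) (T eta h) (T eta h)| <= k * s e * `|h| ^+ 2).
Proof.
move=> k0; have k10 : 0 < k / d.+1%:R ^+ 2 by rewrite divr_gt0// exprn_gt0.
have hi i j : small_near th (fun e eta =>
    `|third ip (G e) (z eta) (partial i z eta) (partial j z eta)|
      <= k / d.+1%:R ^+ 2 * s e).
  by apply: small_near_littleo k10 => th_ /HG5/(_ i j)[].
have hi2 := small_near_forall (fun i => small_near_forall (hi i)).
apply: small_nearS hi2 => e eta e0 hk h.
rewrite (Dop_row Cz).
set v := \sum_i _ *: _.
have -> : third ip (G e) (z eta) v v =
    \sum_i h 0 i *: (\sum_j h 0 j *:
      third ip (G e) (z eta) (partial i z eta) (partial j z eta)).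
  have E1 : third ip (G e) (z eta) v =
      \sum_i h 0 i *: third ip (G e) (z eta) (partial i z eta).
    by rewrite /v linear_sum/=; apply: eq_bigr => i _; exact: linearZ.
  apply: etrans (congr1 (fun L : clinear E E => L v) E1) _.
  rewrite clinear_sumE; apply: eq_bigr => i _.
  rewrite clinearZE; congr (_ *: _).
  rewrite /v linear_sum/=; apply: eq_bigr => j _; exact: linearZ.
apply: le_trans (norm_row_comb2_le _ hk) _.
rewrite ler_wpM2r ?exprn_ge0// [d%:R ^+ 2 * _]mulrA ler_wpM2r ?(ltW (scale_gt0 _ _))//.
exact: norm_div_sqr.
Qed.

(** The sum of the two scalar products is the second derivative at [0] of
    [t |-> G e (z (eta + t *: h))]; it is for this combination that (G5) provides a limit at the
    scale [s ^ 2]. *)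
Lemma hess_quad_form_near k : 0 < k -> small_near th (fun e eta => forall h,
  `|ip (grad ip (G e) (z eta)) (S eta h) +
    ip (hess ip (G e) (z eta) (T eta h)) (T eta h) - s e ^+ 2 * quad_form h|
   <= k * s e ^+ 2 * `|h| ^+ 2).
Proof.
move=> k0; have k10 : 0 < k / d.+1%:R ^+ 2 by rewrite divr_gt0// exprn_gt0.
have hi i j : small_near th (fun e eta =>
    `|ip (grad ip (G e) (z eta)) (partial i (partial j z) eta) +
      ip (hess ip (G e) (z eta) (partial i z eta)) (partial j z eta) -
      s e ^+ 2 * H i j| <= k / d.+1%:R ^+ 2 * s e ^+ 2).
  apply: (@small_near_littleo_sqr _ _ _ _
    (fun e eta => ip (grad ip (G e) (z eta)) (partial i (partial j z) eta))
    (fun e eta => ip (hess ip (G e) (z eta) (partial i z eta)) (partial j z eta))).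
  - by move=> th_ /HG5/(_ i j)[].
  - exact: k10.
have hi2 := small_near_forall (fun i => small_near_forall (hi i)).
apply: small_nearS hi2 => e eta e0 hk h.
rewrite (Dop_row Cz) (Dop2_row Cz).
set v := \sum_i _ *: partial i z eta.
have -> : ip (grad ip (G e) (z eta))
      (\sum_i h 0 i *: (\sum_j h 0 j *: partial i (partial j z) eta)) +
    ip (hess ip (G e) (z eta) v) v - s e ^+ 2 * quad_form h =
    \sum_i h 0 i *: (\sum_j h 0 j *:
      (ip (grad ip (G e) (z eta)) (partial i (partial j z) eta) +
       ip (hess ip (G e) (z eta) (partial i z eta)) (partial j z eta)
       - s e ^+ 2 * H i j : R^o)).
  have E1 : ip (grad ip (G e) (z eta))
        (\sum_i h 0 i *: (\sum_j h 0 j *: partial i (partial j z) eta)) =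
      \sum_i h 0 i * (\sum_j h 0 j *
        ip (grad ip (G e) (z eta)) (partial i (partial j z) eta)).
    rewrite ip_sumr; apply: eq_bigr => i _; rewrite ipZr ip_sumr; congr (_ * _).
    by apply: eq_bigr => j _; rewrite ipZr.
  have E2 : ip (hess ip (G e) (z eta) v) v =
      \sum_i h 0 i * (\sum_j h 0 j *
        ip (hess ip (G e) (z eta) (partial i z eta)) (partial j z eta)).
    have -> : hess ip (G e) (z eta) v =
        \sum_i h 0 i *: hess ip (G e) (z eta) (partial i z eta).
      by rewrite /v linear_sum/=; apply: eq_bigr => i _; exact: linearZ.
    rewrite ip_suml; apply: eq_bigr => i _; rewrite ipZl ip_sumr; congr (_ * _).
    by apply: eq_bigr => j _; rewrite ipZr.
  rewrite E1 E2 /quad_form mulr_sumr -big_split/= -sumrB.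
  apply: eq_bigr => i _; rewrite -mulrDr mulrCA -mulrBr; congr (_ * _).
  rewrite mulr_sumr -big_split/= -sumrB; apply: eq_bigr => j _.
  by rewrite mulrCA -mulrDr -mulrBr.
apply: le_trans (norm_row_comb2_le (W := R^o) _ hk) _.
rewrite ler_wpM2r ?exprn_ge0// [d%:R ^+ 2 * _]mulrA ler_wpM2r ?exprn_ge0 ?(ltW (scale_gt0 _ _))//.
exact: norm_div_sqr.
Qed.

(** (G3) is used at [th] itself. The bound is carried to [eta] along the segment from [th], on which
    the derivative of the gradient is [hess] applied to a tangent vector, hence o(s) uniformly; the
    radius at most [1] bounds [|eta - th|]. *)
Lemma grad_near k : 0 < k -> small_near th (fun e eta =>
  `|grad ip (G e) (z eta)| <= k * s e).
Proof.
move=> k0; have k20 : 0 < k / 2 by rewrite divr_gt0.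
have h1 : small_near th (fun e _ => `|grad ip (G e) (z th)| <= k / 2 * s e).
  apply: small_near_left.
  have /eqoP /(_ _ k20) := HG3_grad.
  move=> h; near=> e.
  have e0 : 0 < e by near: e; exact: nbhs_right_gt.
  rewrite -[X in _ * X]gtr0_norm ?scale_gt0//.
  by near: e; exact: h.
have [r r0 h2] := hess_tangent_near k20.
have [q q0 {}h1] := h1.
pose m := Num.min (Num.min r q) 1.
exists m; first by rewrite !lt_min r0 q0 ltr01.
move=> e eta e0; rewrite !lt_min => /andP[/andP[er eq] _] /andP[/andP[etar etaq] eta1].
have h1e := h1 e th e0 eq; rewrite subrr normr0 in h1e; have {}h1e := h1e q0.
have s0 := scale_gt0 alpha e0.
apply: (norm_le_ip ip_norm) => [|y]; first by rewrite mulr_ge0 ?ltW.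
pose h := eta - th.
pose g t : R := Dop (G e) (z (th + t *: h)) y.
have [dz _] := Cz; have [_ [ddG _]] := HG4 e.
have gd t : is_derive t (1 : R) g
    (Dop (Dop (G e)) (z (th + t *: h)) (T (th + t *: h) h) y).
  apply: is_derive_eq.
    apply: (curve_comp (f := fun u => Dop (G e) u y)).
      exact: eval_differentiable.
    exact: (curve_comp (dz _) (line_derive th h t)).
  exact: Dop_eval.
have [t /andP[t0 t1] Eg] := mvt01 gd.
have h2e := h2 e (th + t *: h) e0 er.
have ht : `|th + t *: h - th| < r.
  rewrite addrC addKr normrZ (ger0_norm t0).
  by apply: le_lt_trans etar; rewrite ler_piMl.
have {}h2e := h2e ht h.
have b1 : (g 1 : R) <= g 0 + k / 2 * s e * `|h| * `|y|.
  rewrite -lerBlDl Eg; apply: le_trans (ler_norm _) _.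
  rewrite -(hessP ip_norm); apply: le_trans (cauchy_schwarz ip_norm _ _) _.
  by rewrite ler_wpM2r.
have b0 : (g 0 : R) <= k / 2 * s e * `|y|.
  rewrite /g scale0r addr0 -(gradP ip_norm).
  by apply: le_trans (ip_le ip_norm _ _) _; rewrite ler_wpM2r.
have E1 : ip (grad ip (G e) (z eta)) y = g 1.
  by rewrite (gradP ip_norm) /g scale1r /h addrC subrK.
rewrite E1; apply: le_trans b1 _.
have hy : k / 2 * s e * `|h| * `|y| <= k / 2 * s e * `|y|.
  by rewrite ler_wpM2r// ler_piMr ?mulr_ge0// ltW.
have -> : k * s e * `|y| = k / 2 * s e * `|y| + k / 2 * s e * `|y| by field.
exact: lerD.
Unshelve. all: by end_near. Qed.

End TangentEstimates.

(** * Taylor estimates for the first and second derivatives *)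

Section TaylorForms.
Context {R : realType} {V : completeNormedModType R}.
Variables (f : V -> R^o).
Hypothesis cf : Ck 4 f.
Implicit Types u w a b : V.

Let df : forall x, differentiable f x. Proof. by have [] := cf. Qed.
Let ddf : forall x, differentiable (Dop f) x. Proof. by have [_ []] := cf. Qed.
Let d3f : forall x, differentiable (Dop (Dop f)) x.
Proof. by have [_ [_ []]] := cf. Qed.
Let d4f : forall x, differentiable (Dop (Dop (Dop f))) x.
Proof. by have [_ [_ [_ []]]] := cf. Qed.

(** The mean value theorem is scalar, so the derivatives are first evaluated at fixed vectors. *)
Let form1 a u : R^o := Dop f u a.
Let form2 a b u : R^o := D2form f u a b.

Let dform1 a u : differentiable (form1 a) u.
Proof. exact: eval_differentiable. Qed.
Let Dform1 a u w : Dop (form1 a) u w = Dop (Dop f) u w a.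
Proof. exact: Dop_eval. Qed.

Let dform2 a b u : differentiable (form2 a b) u.
Proof. by apply: eval_differentiable; exact: eval_differentiable. Qed.
Let Dform2 a b u w : Dop (form2 a b) u w = Dop (Dop (Dop f)) u w a b.
Proof.
apply: etrans (Dop_eval b w (eval_differentiable a (d3f u))) _.
exact: (congr1 (fun L : clinear V R^o => L b) (Dop_eval a w (d3f u))).
Qed.

Lemma Dop_mvt_form u w a : exists2 t : R, 0 <= t <= 1 &
  (Dop f (u + w) a : R) - (Dop f u a : R) = D2form f (u + t *: w) w a.
Proof.
have [t t01 E] := Dop_mvt u w (dform1 a).
by exists t => //; apply: etrans E _; exact: Dform1.
Qed.

Lemma D2form_mvt_bound u w a b (B : R) :
  (forall t : R, 0 <= t <= 1 ->
     `|(Dop (Dop (Dop f)) (u + t *: w) w a b : R)| <= B) ->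
  `|(D2form f (u + w) a b : R) - D2form f u a b| <= B.
Proof.
move=> fB; have [t t01 E] := Dop_mvt u w (dform2 a b).
have {}E := etrans E (Dform2 a b (u + t *: w) w).
apply: le_trans (fB t t01); rewrite le_eqVlt; apply/orP; left; apply/eqP.
exact: (congr1 (fun x : R => `|x|) E).
Qed.

(** Two nested mean values stand in for a Taylor formula with remainder: the second intermediate
    point is [u + (r * t) *: w], so a bound along the segment suffices. The factor [1/2] is given
    up. [D2form_taylor] is the same one order higher. *)
Lemma Dop_taylor_form u w a (B : R) :
  (forall t : R, 0 <= t <= 1 ->
     `|(Dop (Dop (Dop f)) (u + t *: w) w w a : R)| <= B) ->
  `|(Dop f (u + w) a : R) - (Dop f u a : R) - D2form f u w a| <= B.
Proof.
move=> fB; have [t /andP[t0 t1] E] := Dop_mvt_form u w a.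
have [r /andP[r0 r1] E2] := Dop_mvt u (t *: w) (dform2 w a).
have E3 := etrans E2 (Dform2 w a (u + r *: (t *: w)) (t *: w)).
have E4 : (Dop (Dop (Dop f)) (u + r *: (t *: w)) (t *: w) w a : R) =
    t * (Dop (Dop (Dop f)) (u + r *: (t *: w)) w w a : R).
  have e1 : Dop (Dop (Dop f)) (u + r *: (t *: w)) (t *: w) =
      t *: Dop (Dop (Dop f)) (u + r *: (t *: w)) w by exact: linearZ.
  have e2 := etrans (congr1 (fun L : clinear V (clinear V R^o) => L w) e1)
    (clinearZE _ _ w).
  exact: (etrans (congr1 (fun L : clinear V R^o => L a) e2) (clinearZE _ _ a)).
have rt : 0 <= r * t <= 1 by rewrite mulr_ge0//= mulr_ile1.
have := fB (r * t) rt; rewrite -scalerA => b1.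
have fin (x p q y y' : R) : x = p -> p - q = y -> y = t * y' -> `|y'| <= B ->
    `|x - q| <= B.
  move=> -> -> -> h; rewrite normrM (ger0_norm t0) (le_trans _ h)//.
  by rewrite ler_piMl.
exact: fin E E3 E4 b1.
Qed.

Lemma D2form_taylor u w a b (B : R) :
  (forall t : R, 0 <= t <= 1 ->
     `|(Dop (Dop (Dop (Dop f))) (u + t *: w) w w a b : R)| <= B) ->
  `|(D2form f (u + w) a b : R) - (D2form f u a b : R)
     - (Dop (Dop (Dop f)) u w a b : R)| <= B.
Proof.
move=> fB; have [t /andP[t0 t1] E] := Dop_mvt u w (dform2 a b).
have {}E := etrans E (Dform2 a b (u + t *: w) w).
pose g3 x : R^o := Dop (Dop (Dop f)) x w a b.
have dg3 x : differentiable g3 x.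
  by do 2!apply: eval_differentiable; exact: eval_differentiable.
have Dg3 x y : Dop g3 x y = Dop (Dop (Dop (Dop f))) x y w a b.
  have e1 := Dop_eval w y (d4f x).
  have d1 := eval_differentiable w (d4f x).
  have e2 := Dop_eval a y d1; have d2 := eval_differentiable a d1.
  have e3 := Dop_eval b y d2.
  apply: etrans e3 _; apply: etrans (congr1 (fun L : clinear V R^o => L b) e2) _.
  exact: (congr1 (fun L : clinear V (clinear V R^o) => L a b) e1).
have [r /andP[r0 r1] E2] := Dop_mvt u (t *: w) dg3.
have E3 := etrans E2 (Dg3 (u + r *: (t *: w)) (t *: w)).
have E4 : (Dop (Dop (Dop (Dop f))) (u + r *: (t *: w)) (t *: w) w a b : R) =
    t * (Dop (Dop (Dop (Dop f))) (u + r *: (t *: w)) w w a b : R).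
  have e1 : Dop (Dop (Dop (Dop f))) (u + r *: (t *: w)) (t *: w) =
      t *: Dop (Dop (Dop (Dop f))) (u + r *: (t *: w)) w by exact: linearZ.
  have e2 := etrans (congr1
    (fun L : clinear V (clinear V (clinear V R^o)) => L w) e1)
    (clinearZE _ _ w).
  have e3 := etrans (congr1 (fun L : clinear V (clinear V R^o) => L a) e2)
    (clinearZE _ _ a).
  exact: (etrans (congr1 (fun L : clinear V R^o => L b) e3) (clinearZE _ _ b)).
have rt : 0 <= r * t <= 1 by rewrite mulr_ge0//= mulr_ile1.
have := fB (r * t) rt; rewrite -scalerA => b1.
have fin (x p q y y' : R) : x = p -> p - q = y -> y = t * y' -> `|y'| <= B ->
    `|x - q| <= B.
  move=> -> -> -> h; rewrite normrM (ger0_norm t0) (le_trans _ h)//.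
  by rewrite ler_piMl.
exact: fin E E3 E4 b1.
Qed.

End TaylorForms.

Lemma norm_le_near {R : realType} {W : normedModType R} (x y : W) :
  `|x - y| <= 1 -> `|x| <= 1 + `|y|.
Proof.
by move=> h; rewrite -[in leLHS](subrK y x) (le_trans (ler_normD _ _))// lerD2r.
Qed.

(** * Real inequalities that combine the expansions in [w] *)

Section EstimateArithmetic.
Context {R : realType}.

Lemma norm_eq_le (x y B : R) : x = y -> `|y| <= B -> `|x| <= B.
Proof. by move=> ->. Qed.

Lemma sub_eq_add (a b c : R) : b = a -> a - b + c = c.
Proof. by move=> ->; rewrite subrr add0r. Qed.

(** Here [A] and [A0] are the Hessian at [z + w] and at [z] on a tangent vector and on [y]; [C]
    bounds the third derivative of [f_e], [Z] the first derivative of [z], and [N], [Y], [W] are the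
    norms of [h], [y], [w]. *)
Lemma tangent_arith (k s r C Z W N Y A A0 : R) :
  0 < s -> 0 <= C -> 0 <= Z -> 0 <= N -> 0 <= Y -> 0 <= W -> W <= r * s ->
  C * Z * r <= k / 2 ->
  `|A - A0| <= C * W * (Z * N) * Y -> `|A0| <= k / 2 * s * N * Y ->
  `|A| <= k * s * N * Y.
Proof.
move=> s0 C0 Z0 N0 Y0 W0 Wr Cr h1 h2.
have -> : A = (A - A0) + A0 by rewrite subrK.
apply: le_trans (ler_normD _ _) _; apply: le_trans (lerD h1 h2) _.
have NY : 0 <= N * Y by rewrite mulr_ge0.
have h3 : C * Z * W <= k / 2 * s.
  apply: (@le_trans _ _ (C * Z * (r * s))); first by rewrite ler_wpM2l// mulr_ge0.
  by rewrite mulrA ler_pM2r.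
have := ler_wpM2r NY h3.
have -> : C * W * (Z * N) * Y = C * Z * W * (N * Y) by ring.
have -> : k * s * N * Y = k / 2 * s * (N * Y) + k / 2 * s * N * Y by field.
by rewrite lerD2r.
Qed.

(** [A], [A0], [A1] are [D^2 f_e (T, T)] at [z + w], at [z], and its term linear in [w]; [B], [B0],
    [B1] are the same for [D f_e (S)]. Of the tolerance [k], the quadratic remainders take [k / 2],
    the limit form takes [k / 6], and the sum [A1 + B1], bounded as a whole, takes [k / 3]. *)
Lemma quadratic_arith (k s r C Z W N A A0 A1 B B0 B1 Q : R) :
  0 < k -> 0 < s -> 0 <= C -> 0 <= Z -> 0 <= N -> 0 <= W -> W <= r * s ->
  r <= 1 -> r * (C * (Z * Z + Z)) <= k / 2 ->
  `|A - A0 - A1| <= C * W * W * (Z * N) * (Z * N) ->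
  `|B - B0 - B1| <= C * W * W * (Z * N ^+ 2) ->
  `|B0 + A0 - s ^+ 2 * Q| <= k / 6 * s ^+ 2 * N ^+ 2 ->
  `|A1 + B1| <= k / 3 * s * N ^+ 2 * W ->
  `|A + B - s ^+ 2 * Q| <= k * s ^+ 2 * N ^+ 2.
Proof.
move=> k0 s0 C0 Z0 N0 W0 Wr r1 Cr h1 h2 h3 h4.
have -> : A + B - s ^+ 2 * Q = (A - A0 - A1) + (B - B0 - B1) +
  (B0 + A0 - s ^+ 2 * Q) + (A1 + B1) by ring.
have -> : k * s ^+ 2 * N ^+ 2 = k / 2 * s ^+ 2 * N ^+ 2 +
  k / 6 * s ^+ 2 * N ^+ 2 + k / 3 * s ^+ 2 * N ^+ 2 by field.
have NN : 0 <= N ^+ 2 by rewrite exprn_ge0.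
have rs : r * s <= s by rewrite ler_piMl// ltW.
have Ws : W <= s by apply: le_trans rs.
have b4 : k / 3 * s * N ^+ 2 * W <= k / 3 * s ^+ 2 * N ^+ 2.
  have -> : k / 3 * s ^+ 2 * N ^+ 2 = k / 3 * s * N ^+ 2 * s by ring.
  by rewrite ler_wpM2l// !mulr_ge0// ltW.
have b12 : C * W * W * (Z * N) * (Z * N) + C * W * W * (Z * N ^+ 2) <=
    k / 2 * s ^+ 2 * N ^+ 2.
  have -> : C * W * W * (Z * N) * (Z * N) + C * W * W * (Z * N ^+ 2) =
    (W * W * (C * (Z * Z + Z))) * N ^+ 2 by ring.
  rewrite ler_wpM2r//.
  have M0 : 0 <= C * (Z * Z + Z) by rewrite mulr_ge0// addr_ge0// mulr_ge0.
  apply: (@le_trans _ _ (r * s * s * (C * (Z * Z + Z)))).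
    by rewrite ler_wpM2r// ler_pM.
  have -> : r * s * s * (C * (Z * Z + Z)) = r * (C * (Z * Z + Z)) * s ^+ 2 by ring.
  by rewrite ler_wpM2r// exprn_ge0// ltW.
apply: le_trans (ler_normD _ _) _; apply: lerD; last exact: le_trans b4.
apply: le_trans (ler_normD _ _) _; apply: lerD => //.
apply: le_trans (ler_normD _ _) _; apply: le_trans b12; exact: lerD.
Qed.

End EstimateArithmetic.

(** * Expansion of the Hessian of [fpert F G e] at [z eta + w] *)

Section MainEstimates.
Context {R : realType} {E : completeNormedModType R}.
Variable ip : {dot E for (@idfun R)}.
Hypothesis ip_norm : forall u : E, ip u u = `|u| ^+ 2.
Variables (F : E -> R^o) (G : R -> E -> R^o) (d : nat) (z : 'rV[R]_d -> E).
Variables (alpha : R) (H : 'I_d -> 'I_d -> R) (th : 'rV[R]_d).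
Hypothesis alpha_gt0 : 0 < alpha.
Hypothesis Cz : Ck 2 z.
Hypothesis HF1_crit : forall eta, z eta = grad ip F (z eta).
Hypothesis HF3 : forall eta, tangent z eta =
  [set v | v - hess ip F (z eta) v = 0].
Hypothesis HF4 : Ck 4 F.
Hypothesis HG0_zero : forall u, G 0 u = 0.
Hypothesis HG2_hess : continuous (fun p : R * E => hess ip (G p.1) p.2).
Hypothesis HG3_grad :
  (fun e => grad ip (G e) (z th)) =o_ (0^'+) (fun e => e `^ (alpha / 2) : R^o).
Hypothesis HG4 : forall e, Ck 4 (G e).
Hypothesis HG4_third : continuous (fun p : R * E => third ip (G p.1) p.2).
Hypothesis HG4_fourth : fourth_bounded_near G (z th).
Hypothesis HG5 : forall th_ : R -> 'rV[R]_d,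
  th_ e @[e --> 0^'+] --> th ->
  forall i j,
  [/\ e `^ (- alpha) *
        ip (grad ip (G e) (z (th_ e))) (partial i (partial j z) (th_ e)) +
      e `^ (- alpha) *
        ip (hess ip (G e) (z (th_ e)) (partial i z (th_ e)))
           (partial j z (th_ e))
        @[e --> 0^'+] --> (H i j : R^o),
      e `^ (- (alpha / 2)) *:
        hess ip (G e) (z (th_ e)) (partial i z (th_ e))
        @[e --> 0^'+] --> (0 : E),
      e `^ (- (alpha / 2)) *:
        hess ip (G e) (z (th_ e)) (partial i (partial j z) (th_ e))
        @[e --> 0^'+] --> (0 : E) &
      e `^ (- (alpha / 2)) *:
        third ip (G e) (z (th_ e)) (partial i z (th_ e))
          (partial j z (th_ e))
        @[e --> 0^'+] --> (0 : E)].

Local Notation s := (scale alpha).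
Local Notation T := (Dop z).
Local Notation S eta h := (Dop (Dop z) eta h h).
Local Notation f := (fpert F G).

Let dz eta : differentiable z eta. Proof. by have [] := Cz. Qed.
Let ddz eta : differentiable (Dop z) eta. Proof. by have [_ []] := Cz. Qed.

Lemma tangent_fixed eta h : hess ip F (z eta) (T eta h) = T eta h.
Proof.
have : tangent z eta (T eta h) by exists h => //; rewrite DopE.
by rewrite HF3 /= => /subr0_eq.
Qed.

Lemma Dop_fpert_z e eta y :
  (Dop (f e) (z eta) y : R) = ip (grad ip (G e) (z eta)) y.
Proof.
apply: etrans (Dop_fpert ip_norm HF4 HG4 e (z eta) y) _.
have E1 : (Dop F (z eta) y : R) = ip (z eta) y.
  by apply: etrans (esym (gradP ip_norm _ _ _)) _; rewrite -HF1_crit.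
exact: etrans (sub_eq_add _ E1) (esym (gradP ip_norm _ _ _)).
Qed.

Lemma D2form_fpert_tangent e eta h y :
  (D2form (f e) (z eta) (T eta h) y : R) =
  ip (hess ip (G e) (z eta) (T eta h)) y.
Proof.
apply: etrans (D2_fpert ip_norm HF4 HG4 e (z eta) (T eta h) y) _.
have E1 : (Dop (Dop F) (z eta) (T eta h) y : R) = ip (T eta h) y.
  by apply: etrans (esym (hessP ip_norm _ _ _ _)) _; rewrite tangent_fixed.
exact: etrans (sub_eq_add _ E1) (esym (hessP ip_norm _ _ _ _)).
Qed.

(* Differentiate [(I - F''(z)) T = 0] along [h]. *)
Lemma tangent_derived eta h y : ip (S eta h) y =
  (Dop (Dop (Dop F)) (z eta) (T eta h) (T eta h) y : R) +
  (Dop (Dop F) (z eta) (S eta h) y : R).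
Proof.
have [dF [ddF [dddF _]]] := HF4.
have [I IE] := ip_clinear ip_norm.
pose c (t : R) := eta + t *: h.
have dc (t : R) : is_derive t 1 c h by exact: line_derive.
have dzc (t : R) : is_derive t 1 (fun q : R => z (c q)) (T (c t) h).
  exact: (curve_comp (dz _) (dc t)).
have dT (t : R) : is_derive t 1 (fun q : R => T (c q) h) (S (c t) h).
  apply: is_derive_eq; first exact: (curve_comp (eval_differentiable h (ddz _)) (dc t)).
  exact: Dop_eval.
have dF2 (t : R) : is_derive t 1 (fun q : R => Dop (Dop F) (z (c q)))
    (Dop (Dop (Dop F)) (z (c t)) (T (c t) h)).
  exact: (curve_comp (dddF _) (dzc t)).
have d1 := curve_apply (dF2 0) (dT 0).
have d2 : is_derive (0 : R) 1 (fun q : R => I (T (c q) h)) (I (S (c 0) h)).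
  apply: is_derive_eq; first exact: (curve_comp (clinear_differentiable I _) (dT 0)).
  by rewrite Dop_clinear.
have EE : (fun q : R => Dop (Dop F) (z (c q)) (T (c q) h)) = (fun q : R => I (T (c q) h)).
  apply/funext => t; apply: clinear_ext => v.
  rewrite IE; apply: etrans (esym (hessP ip_norm _ _ _ _)) _.
  by rewrite tangent_fixed.
rewrite EE in d1.
have [_ v1] := d1; have [_ v2] := d2.
have := etrans (esym v2) v1; rewrite /c scale0r addr0 => e1.
have e2 := etrans (congr1 (fun L : clinear E R^o => L y) e1) (clinearDE _ _ y).
by rewrite -IE; exact: e2.
Qed.

Lemma tangent_bound : exists2 Z : R, 0 <= Z & small_near th (fun _ eta =>
  forall h, `|T eta h| <= Z * `|h| /\ `|S eta h| <= Z * `|h| ^+ 2).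
Proof.
have h1 := small_near_continuous_right
  (differentiable_continuous (ddz th)) ltr01.
have [_ [_ c2]] := Cz.
have h2 := small_near_continuous_right (c2 th) ltr01.
exists (1 + `|Dop z th| + `|Dop (Dop z) th|).
  by rewrite !addr_ge0.
apply: small_nearS (small_nearI h1 h2) => e eta _ [b1 b2] h.
have t1 := norm_le_near b1; have t2 := norm_le_near b2.
split.
  apply: le_trans (clinear_le _ _) _; rewrite ler_wpM2r//.
  by apply: le_trans t1 _; rewrite lerDl.
apply: le_trans (clinear2_le _ _ _) _; rewrite expr2 -mulrA ler_wpM2r ?mulr_ge0//.
by apply: le_trans t2 _; rewrite addrAC lerDl.
Qed.

(** By [tangent_derived] the part that does not involve [G], namely
    [(w | S) - D^2 F (w, S) - D^3 F (w, T, T)], is zero. What remains is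
    [D^3 G (w, T, T) + D^2 G (w, S)], and (G5) makes both terms o(s) |w|. *)
Lemma first_order_cancel e eta h w k : 0 <= k ->
  `|hess ip (G e) (z eta) (S eta h)| <= k * s e * `|h| ^+ 2 ->
  `|third ip (G e) (z eta) (T eta h) (T eta h)| <= k * s e * `|h| ^+ 2 ->
  `|(Dop (Dop (Dop (f e))) (z eta) w (T eta h) (T eta h) : R) +
    (D2form (f e) (z eta) w (S eta h) : R)|
  <= 2 * k * s e * `|h| ^+ 2 * `|w|.
Proof.
move=> k0 b1 b2.
have [dF cF] := HF4; have [dG cG] := HG4 e.
have C3F : Ck 3 F.
  by split => //; case: cF => ? [? [? _]]; split=> //; split=> // x;
    exact: differentiable_continuous.
have C3G : Ck 3 (G e).
  by split => //; case: cG => ? [? [? _]]; split=> //; split=> // x;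
    exact: differentiable_continuous.
have C2F : Ck 2 F.
  by case: C3F => ? [? [? _]]; split=> //; split=> // x;
    exact: differentiable_continuous.
have C2G : Ck 2 (G e).
  by case: C3G => ? [? [? _]]; split=> //; split=> // x;
    exact: differentiable_continuous.
set t := T eta h; set a := S eta h; set p := z eta.
have e1 := D3_fpert ip_norm HF4 HG4 e p w t t.
have e2 := D2_fpert ip_norm HF4 HG4 e p w a.
(* The argument [w] is moved to the last place, to match [tangent_derived] and the representatives
   [third] and [hess] that (G5) controls. *)
have e3 : (Dop (Dop (Dop F)) p w t t : R) = Dop (Dop (Dop F)) p t t w.
  exact: etrans (D3_sym12 p w t t C3F) (D3_sym23 p t w t C3F).
have e4 : (Dop (Dop (Dop (G e))) p w t t : R) = ip (third ip (G e) p t t) w.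
  exact: (etrans (etrans (D3_sym12 p w t t C3G) (D3_sym23 p t w t C3G))
    (esym (thirdP ip_norm (G e) p t t w))).
have e5 := D2_sym p w a C2F.
have e6 : (Dop (Dop (G e)) p w a : R) = ip (hess ip (G e) p a) w.
  exact: (etrans (D2_sym p w a C2G) (esym (hessP ip_norm (G e) p a w))).
have e7 := tangent_derived eta h w.
have aux (x y g3 f3 f3' g2 f2 f2' i i' q3 q2 : R) :
    x = g3 - f3 -> y = i - f2 + g2 -> f3 = f3' -> g3 = q3 -> f2 = f2' ->
    g2 = q2 -> i' = f3' + f2' -> i = i' -> x + y = q3 + q2.
  by move=> -> -> -> -> -> -> + -> => ->; ring.
have Exy := aux _ _ _ _ _ _ _ _ _ _ _ _ e1 e2 e3 e4 e5 e6 e7 (ipC ip w a).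
have -> : 2 * k * s e * `|h| ^+ 2 * `|w| =
  k * s e * `|h| ^+ 2 * `|w| + k * s e * `|h| ^+ 2 * `|w| by ring.
apply: norm_eq_le Exy _.
apply: le_trans (ler_normD _ _) _; apply: lerD.
  by apply: le_trans (cauchy_schwarz ip_norm _ _) _; rewrite ler_wpM2r.
by apply: le_trans (cauchy_schwarz ip_norm _ _) _; rewrite ler_wpM2r.
Qed.

(** The clauses give the mixed block, the tangent block, the closeness to the unperturbed Hessian
    and the initial residual of the reduction. In the second clause [D f_e (S)] stays beside
    [D^2 f_e (T, T)], because each alone contains a term linear in [w] that is not o(s^2). *)
Lemma main_estimates (k : R) : 0 < k -> exists2 r : R, 0 < r &
  small_near th (fun e eta => forall w, `|w| <= r * s e ->
  [/\ forall h y, `|(D2form (f e) (z eta + w) (T eta h) y : R)|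
        <= k * s e * `|h| * `|y|,
      forall h, `|(D2form (f e) (z eta + w) (T eta h) (T eta h) : R) +
          (Dop (f e) (z eta + w) (S eta h) : R) - s e ^+ 2 * quad_form H h|
        <= k * s e ^+ 2 * `|h| ^+ 2,
      forall v y, `|(D2form (f e) (z eta + w) v y : R) -
          (D2form (f 0) (z th) v y : R)| <= k * `|v| * `|y| &
      forall y, `|(Dop (f e) (z eta) y : R)| <= k * s e * `|y|]).
Proof.
move=> k0.
have cz : {for th, continuous z} by exact: differentiable_continuous.
have k20 : 0 < k / 2 by rewrite divr_gt0.
have k60 : 0 < k / 6 by rewrite divr_gt0.
have [Z Z0 nZ] := tangent_bound.
have [C3 C30 nC3] := D3_fpert_near ip_norm (z th) HF4 HG4 HG0_zero HG4_third.
have [C4 C40 nC4] := D4_fpert_near ip_norm HF4 HG4 HG4_fourth.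
have n2 := D2_fpert_near ip_norm (z th) HF4 HG4 HG0_zero HG2_hess k0.
have [r0 r00 nu] := small_near_translate cz (small_nearI nC3 (small_nearI nC4 n2)).
have na := hess_tangent_near Cz HG5 k20.
have nb1 := hess_second_near Cz HG5 k60.
have nb2 := third_tangent_near Cz HG5 k60.
have nb3 := hess_quad_form_near Cz HG5 k60.
have nd := grad_near ip_norm Cz HG3_grad HG4 HG5 k0.
pose C := C3 + C4.
have C0 : 0 <= C by rewrite addr_ge0.
(* [D] dominates both [C * Z], for the mixed block, and [C * (Z * Z + Z)], for the tangent block;
   the summand [1] makes it positive. *)
pose D := C * (Z * Z + Z) + 1.
have D0 : 0 < D by rewrite ltr_pwDr// mulr_ge0// addr_ge0// mulr_ge0.
pose r := Num.min (Num.min r0 1) (k / 2 / D).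
have r_gt0 : 0 < r by rewrite !lt_min r00 ltr01 divr_gt0.
have rr0 : r <= r0 by rewrite /r !ge_min lexx.
have r1 : r <= 1 by rewrite /r !ge_min lexx orbT.
have rD : r * D <= k / 2.
  by rewrite -ler_pdivlMr// /r !ge_min lexx orbT.
exists r => //.
apply: small_nearS (small_nearI (small_nearI (small_near_exponent th) nZ)
  (small_nearI nu (small_nearI na (small_nearI nb1 (small_nearI nb2
  (small_nearI nb3 nd)))))).
move=> e eta e0 [[e1 hZ] [hu [ha [hb1 [hb2 [hb3 hd]]]]]] w ws.
have s0 := scale_gt0 alpha e0; have s1 := scale_le1 alpha_gt0 e0 e1.
have Ctf : Ck 4 (f e) := Ck_fpert ip_norm HF4 (HG4 e).
have wr : `|w| <= r0.
  by apply: le_trans ws _; apply: le_trans rr0; rewrite ler_piMr// ltW.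
have seg (t : R) : 0 <= t <= 1 -> `|t *: w| <= r0.
  move=> /andP[t0 t1]; rewrite normrZ (ger0_norm t0).
  by apply: le_trans wr; rewrite ler_piMl.
have b3 (t : R) a b c : 0 <= t <= 1 ->
    `|(Dop (Dop (Dop (f e))) (z eta + t *: w) a b c : R)| <= C * `|a| * `|b| * `|c|.
  move=> t01; have [+ _] := hu _ (seg t t01).
  move=> /(_ a b c) /le_trans; apply.
  by do 3!apply: ler_wpM2r => //; rewrite /C lerDl.
have b4 (t : R) a b c q : 0 <= t <= 1 ->
    `|(Dop (Dop (Dop (Dop (f e)))) (z eta + t *: w) a b c q : R)|
      <= C * `|a| * `|b| * `|c| * `|q|.
  move=> t01; have [_ [+ _]] := hu _ (seg t t01).
  move=> /(_ a b c q) /le_trans; apply.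
  by do 4!apply: ler_wpM2r => //; rewrite /C lerDr.
split.
- move=> h y.
  have A0 : `|(D2form (f e) (z eta) (T eta h) y : R)| <= k / 2 * s e * `|h| * `|y|.
    apply: norm_eq_le (D2form_fpert_tangent e eta h y) _.
    by apply: le_trans (cauchy_schwarz ip_norm _ _) _; rewrite ler_wpM2r.
  have A1 : `|(D2form (f e) (z eta + w) (T eta h) y : R) -
      (D2form (f e) (z eta) (T eta h) y : R)| <= C * `|w| * (Z * `|h|) * `|y|.
    apply: (D2form_mvt_bound Ctf) => t t01; apply: le_trans (b3 t _ _ _ t01) _.
    by rewrite ler_wpM2r// ler_wpM2l ?mulr_ge0//; case: (hZ h).
  apply: (tangent_arith s0 C0 Z0 _ _ _ ws _ A1 A0) => //.
  have : C * Z * r <= r * D.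
    have CZZ : 0 <= C * (Z * Z) by rewrite !mulr_ge0.
    rewrite mulrC ler_pM2l// /D mulrDr -addrA; apply: ler_wpDl => //.
    by rewrite lerDl.
  by move=> /le_trans; apply.
- move=> h.
  have [hT hS] := hZ h.
  have A1 : `|(D2form (f e) (z eta + w) (T eta h) (T eta h) : R) -
      (D2form (f e) (z eta) (T eta h) (T eta h) : R) -
      (Dop (Dop (Dop (f e))) (z eta) w (T eta h) (T eta h) : R)| <=
      C * `|w| * `|w| * (Z * `|h|) * (Z * `|h|).
    apply: (D2form_taylor Ctf) => t t01; apply: le_trans (b4 t _ _ _ _ t01) _.
    by rewrite ler_pM ?mulr_ge0// ler_wpM2l ?mulr_ge0.
  have B1 : `|(Dop (f e) (z eta + w) (S eta h) : R) -
      (Dop (f e) (z eta) (S eta h) : R) -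
      (D2form (f e) (z eta) w (S eta h) : R)| <=
      C * `|w| * `|w| * (Z * `|h| ^+ 2).
    apply: (Dop_taylor_form Ctf) => t t01; apply: le_trans (b3 t _ _ _ t01) _.
    by rewrite ler_wpM2l ?mulr_ge0.
  have aux0 (x y x' y' q B : R) : x = x' -> y = y' -> `|x' + y' - q| <= B ->
    `|x + y - q| <= B by move=> -> ->.
  have Q1 := aux0 _ _ _ _ _ _ (Dop_fpert_z e eta (S eta h))
    (D2form_fpert_tangent e eta h (T eta h)) (hb3 h).
  have L1 := first_order_cancel w (ltW k60) (hb1 h) (hb2 h).
  have k3 : 2 * (k / 6) = k / 3 by field.
  rewrite k3 in L1.
  apply: (quadratic_arith k0 s0 C0 Z0 _ _ ws r1 _ A1 B1 Q1 L1) => //.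
  by apply: le_trans rD; rewrite ler_pM2l// /D lerDl.
- move=> v y; have [_ [_ +]] := hu w wr; exact.
- move=> y; apply: norm_eq_le (Dop_fpert_z e eta y) _.
  by apply: le_trans (cauchy_schwarz ip_norm _ _) _; rewrite ler_wpM2r.
Qed.

End MainEstimates.

(** * Quadratic forms and linear conditions in finite dimension *)

Section FiniteDimensional.
Context {R : realType}.

Lemma quad_formZ d (H : 'I_d -> 'I_d -> R) (a : R) h :
  quad_form H (a *: h) = a ^+ 2 * quad_form H h.
Proof.
rewrite /quad_form mulr_sumr; apply: eq_bigr => i _; rewrite mxE.
have -> : \sum_j (a *: h) 0 j * H i j = a * \sum_j h 0 j * H i j.
  by rewrite mulr_sumr; apply: eq_bigr => j _; rewrite mxE mulrA.
ring.
Qed.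

Lemma quad_form_continuous d (H : 'I_d -> 'I_d -> R) : continuous (quad_form H).
Proof.
have cs n (g : 'I_n -> 'rV[R]_d -> R) : (forall i, continuous (g i)) ->
    continuous (fun x => \sum_i g i x).
  by move=> gc; apply: continuous_big => [|i _]; [exact: add_continuous|exact: gc].
have cc i : continuous (fun x : 'rV[R]_d => x 0 i : R).
  exact: coord_continuous.
have c2 i : continuous (fun x : 'rV[R]_d => \sum_j x 0 j * H i j : R).
  apply: (cs _ (fun j (x : 'rV[R]_d) => x 0 j * _)) => j t.
  exact: (cvgM (cc j t) (cvg_cst _)).
apply: (cs _ (fun i (x : 'rV[R]_d) => x 0 i * _)) => i y.
exact: (cvgM (cc i y) (c2 i y)).
Qed.

Lemma posdef_coercive d (H : 'I_d -> 'I_d -> R) :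
  (forall h, h != 0 -> 0 < quad_form H h) ->
  exists2 k, 0 < k & forall h, k * `|h| ^+ 2 <= quad_form H h.
Proof.
move=> Hpos; pose S := [set h : 'rV[R]_d | `|h| = 1].
(* The extreme value theorem needs a point of the unit sphere, which is empty when [d = 0]; that
   case occurs for negative subspaces of dimension zero. *)
have [[h0 Sh0]|/forallNP nS] := pselect (exists h, S h); last first.
  exists 1 => // h; have [->|hn] := eqVneq h 0.
    rewrite normr0 expr0n/= mulr0 /quad_form big1// => i _.
    by rewrite mxE mul0r.
  by case: (nS (`|h|^-1 *: h)); rewrite /S /= normfZV.
have cS : compact S.
  apply: bounded_closed_compact.
    by exists 1; split=> // M M1 x /= ->; exact: ltW.
  have -> : S = (fun x : 'rV[R]_d => `|x|) @^-1` [set 1] by [].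
  apply: closed_comp; last exact: closed_eq.
  by move=> x _; exact: norm_continuous.
have [|c cS' cmin] := @EVT_min_rV R d (quad_form H) S (ex_intro _ h0 Sh0) cS.
  exact/continuous_subspaceT/quad_form_continuous.
have c0 : c != 0.
  by rewrite -normr_eq0; move: cS'; rewrite inE /S /= => ->; exact: oner_neq0.
exists (quad_form H c); first exact: Hpos.
move=> h; have [->|hn] := eqVneq h 0.
  rewrite normr0 expr0n/= mulr0 /quad_form big1// => i _.
  by rewrite mxE mul0r.
have hgt0 : 0 < `|h| by rewrite normr_gt0.
have := cmin (`|h|^-1 *: h); rewrite inE /S /= => /(_ (normfZV hn)).
rewrite quad_formZ exprVn => h1.
by rewrite -ler_pdivlMr ?exprn_gt0// mulrC.
Qed.

Lemma quad_form_mx d (A : 'M[R]_d) (x : 'rV[R]_d) :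
  (x *m A *m x^T) 0 0 = quad_form (fun i j => A i j) x.
Proof.
rewrite mxE /quad_form.
under eq_bigr do rewrite !mxE mulr_suml.
rewrite exchange_big/=; apply: eq_bigr => i _; rewrite mulr_sumr.
by apply: eq_bigr => j _; ring.
Qed.

(** The coefficients form a row in the left kernel of the [n] by [m] matrix of values, which is
    nonzero because the rank is at most [m]. *)
Lemma functionals_common_kernel (E : lmodType R) n m (b : 'I_n -> E)
    (phi : 'I_m -> E -> R) : (m < n)%N ->
  (forall j (c : 'I_n -> R),
     phi j (\sum_i c i *: b i) = \sum_i c i * phi j (b i)) ->
  exists2 c : 'I_n -> R, exists i, c i != 0 &
    forall j, phi j (\sum_i c i *: b i) = 0.
Proof.
move=> mn phil; pose M := \matrix_(i < n, j < m) phi j (b i).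
have : kermx M != 0.
  by rewrite -mxrank_eq0 mxrank_ker subn_eq0 -ltnNge (leq_ltn_trans (rank_leq_col M)).
case/rowV0Pn => v /sub_kermxP vM v0.
exists (fun i => v 0 i).
  by have /rV0Pn := v0.
move=> j; rewrite phil; have := congr1 (fun N : 'rV_m => N 0 j) vM.
rewrite !mxE => E0; rewrite -[RHS]E0; apply: eq_bigr => i _.
by rewrite mxE.
Qed.

End FiniteDimensional.

(** * Symmetric forms: coercivity on the complement of a maximal negative subspace *)

Section ComplementArithmetic.
Context {R : realType}.

(** The inequality behind [complement_coercive], with [y = u - t A u]: [qv] and [qyy] are the values
    of the form at [u] and [y], [p = |A u|^2], [x] is the coefficient of [y] and [c] the norm of the
    coefficients of the [b i]. The gain [2 t p >= 2 t beta^2] is linear in [t], while the value at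
    [A u] and, after completing the square, the cross term cost multiples of [t^2]. [X] collects
    these costs and [t = beta^2 / X] balances them against the gain. *)
Lemma indefinite_arith (beta a M K k1 : R) :
  0 < beta -> 0 <= M -> 0 < k1 -> 0 <= a ->
  exists2 t, 0 < t & forall qv qyy x p c cross,
    qv < t * beta ^+ 2 / 2 -> beta ^+ 2 <= p ->
    qyy <= qv - 2 * t * p + t ^+ 2 * (M * a ^+ 2) ->
    `|cross| <= t * K * c -> (x != 0) || (c != 0) ->
    x ^+ 2 * qyy + 2 * x * cross - k1 * c ^+ 2 < 0.
Proof.
move=> b0 M0 k10 a0.
pose X := M * a ^+ 2 + 2 * K ^+ 2 / k1 + 1.
have X0 : 0 < X.
  have e1 : 0 <= M * a ^+ 2 by rewrite mulr_ge0// sqr_ge0.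
  have e2 : 0 <= 2 * K ^+ 2 / k1.
    by apply: divr_ge0; [apply: mulr_ge0 => //; exact: sqr_ge0|exact: ltW].
  by apply: ltr_wpDl => //; exact: addr_ge0.
pose t := beta ^+ 2 / X.
have t0 : 0 < t by rewrite divr_gt0// exprn_gt0.
exists t => // qv qyy x p c cross hqv hp hqyy hcross xc.
have tX : t * X = beta ^+ 2 by rewrite /t divfK// gt_eqF.
(* AM-GM on the cross term *)
have h1 : 2 * x * cross <= k1 / 2 * c ^+ 2 + 2 / k1 * (t * K) ^+ 2 * x ^+ 2.
  have h2 : 2 * x * cross <= 2 * `|x| * (t * K * c).
    apply: le_trans (ler_norm _) _; rewrite !normrM ger0_norm//.
    by rewrite ler_wpM2l// mulr_ge0.
  apply: le_trans h2 _.
  have : 0 <= k1 / 2 * (c - 2 / k1 * (t * K) * `|x|) ^+ 2.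
    by rewrite mulr_ge0 ?sqr_ge0// divr_ge0// ltW.
  move=> h; rewrite -subr_ge0.
  have -> // : k1 / 2 * c ^+ 2 + 2 / k1 * (t * K) ^+ 2 * x ^+ 2 -
     2 * `|x| * (t * K * c) = k1 / 2 * (c - 2 / k1 * (t * K) * `|x|) ^+ 2.
    by rewrite -(real_normK (num_real x)); field; rewrite gt_eqF.
pose D := t * beta ^+ 2 / 2.
have D0 : 0 < D by rewrite divr_gt0// mulr_gt0// exprn_gt0.
have h3 : qyy + 2 / k1 * (t * K) ^+ 2 <= - D.
  have e1 : t ^+ 2 * X = t * beta ^+ 2 by rewrite expr2 -mulrA tX.
  have e2 : t ^+ 2 * X = t ^+ 2 * (M * a ^+ 2) + 2 / k1 * (t * K) ^+ 2 + t ^+ 2.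
    by rewrite /X; field; rewrite gt_eqF.
  have t20 : 0 <= t ^+ 2 by rewrite exprn_ge0// ltW.
  have tp : t * beta ^+ 2 <= t * p by rewrite ler_pM2l.
  rewrite /D; move: hqv hqyy e1 e2 t20 tp.
  set u1 := t * beta ^+ 2; set u2 := t ^+ 2 * X; set u3 := t ^+ 2 * (M * _).
  set u4 := 2 / k1 * _; set u5 := t * p.
  have -> : 2 * t * p = 2 * u5 by rewrite /u5; ring.
  lra.
have x20 := sqr_ge0 x; have c20 := sqr_ge0 c.
have h4 : x ^+ 2 * (qyy + 2 / k1 * (t * K) ^+ 2) <= x ^+ 2 * (- D).
  by rewrite ler_wpM2l.
apply: (@le_lt_trans _ _ (- (D * x ^+ 2) - k1 / 2 * c ^+ 2)).
  move: h1 h4; rewrite !mulrDr; set u1 := 2 / k1 * _ * _; set u2 := x ^+ 2 * qyy.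
  have -> : x ^+ 2 * (2 / k1 * (t * K) ^+ 2) = u1 by rewrite mulrC.
  rewrite mulrN [x ^+ 2 * D]mulrC; set u3 := D * _.
  have -> : k1 * c ^+ 2 = k1 / 2 * c ^+ 2 + k1 / 2 * c ^+ 2 by field.
  set u4 := k1 / 2 * _; set u5 := 2 * x * _; lra.
have k120 : 0 < k1 / 2 by rewrite divr_gt0.
have g1 : 0 <= D * x ^+ 2 by rewrite mulr_ge0// ltW.
have g2 : 0 <= k1 / 2 * c ^+ 2 by rewrite mulr_ge0// ltW.
rewrite -opprD oppr_lt0; case/orP: xc => n0.
  by apply: ltr_pwDl => //; rewrite mulr_gt0// lt_def sqrf_eq0 n0 x20.
by apply: ltr_wpDl => //; rewrite mulr_gt0// lt_def sqrf_eq0 n0 c20.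
Qed.

End ComplementArithmetic.

Section SymmetricForms.
Context {R : realType} {E : completeNormedModType R}.
Variable ip : {dot E for (@idfun R)}.
Hypothesis ip_norm : forall u : E, ip u u = `|u| ^+ 2.
Variable L : clinear E (clinear E R^o).
Hypothesis Lsym : forall v w, L v w = L w v.

Definition form_of (v w : E) : R := L v w.
Local Notation q := form_of.

Lemma form_sym v w : q v w = q w v. Proof. exact: Lsym. Qed.
Lemma formDr v w w' : q v (w + w') = q v w + q v w'. Proof. exact: linearD. Qed.
Lemma formZr a v w : q v (a *: w) = a * q v w. Proof. exact: linearZ. Qed.
Lemma formDl v v' w : q (v + v') w = q v w + q v' w.
Proof. by rewrite form_sym formDr !(form_sym w). Qed.
Lemma formZl a v w : q (a *: v) w = a * q v w.
Proof. by rewrite form_sym formZr form_sym. Qed.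
Lemma formBr v w w' : q v (w - w') = q v w - q v w'.
Proof. by rewrite -scaleN1r formDr formZr mulN1r. Qed.
Lemma form0l w : q 0 w = 0.
Proof. by rewrite -(scale0r 0) formZl mul0r. Qed.
Lemma form0r w : q w 0 = 0.
Proof. by rewrite form_sym form0l. Qed.
Lemma form_sumr I (s : seq I) (P : pred I) (g : I -> E) v :
  q v (\sum_(i <- s | P i) g i) = \sum_(i <- s | P i) q v (g i).
Proof.
elim: s => [|i s IH]; rewrite ?big_nil ?form0r// !big_cons.
by case: ifP => _; rewrite ?formDr IH.
Qed.
Lemma form_suml I (s : seq I) (P : pred I) (g : I -> E) v :
  q (\sum_(i <- s | P i) g i) v = \sum_(i <- s | P i) q (g i) v.
Proof. by rewrite form_sym form_sumr; apply: eq_bigr => i _; rewrite form_sym. Qed.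
Lemma form_le v w : `|q v w| <= `|L| * `|v| * `|w|.
Proof. exact: form2_le. Qed.
Lemma form_sqrD v w : q (v + w) (v + w) = q v v + 2 * q v w + q w w.
Proof. by rewrite formDl !formDr (form_sym w v); ring. Qed.

Lemma form_comb n (b : 'I_n -> E) (c : 'rV[R]_n) :
  q (\sum_i c 0 i *: b i) (\sum_i c 0 i *: b i) =
  quad_form (fun i j => q (b i) (b j)) c.
Proof.
rewrite form_suml; apply: eq_bigr => i _; rewrite formZl form_sumr.
by congr (_ * _); apply: eq_bigr => j _; rewrite formZr.
Qed.

(** Negativity at every nonzero coefficient row contains linear independence, since the form is zero
    at a vanishing combination. *)
Lemma negdef_family (V : set E) n (b : 'I_n -> E) : (forall i, V (b i)) ->
  (forall c : 'rV[R]_n, c != 0 ->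
     q (\sum_i c 0 i *: b i) (\sum_i c 0 i *: b i) < 0) ->
  negdef_subspace_dim V q n.
Proof.
move=> Vb bneg; exists b.
have toRow (c : 'I_n -> R) :
    \sum_i c i *: b i = \sum_i (\row_i c i) 0 i *: b i.
  by apply: eq_bigr => i _; rewrite mxE.
split=> // c.
  rewrite toRow => c0 i; have [r0|rn] := eqVneq (\row_i c i) 0.
    by have := congr1 (fun x : 'rV_n => x 0 i) r0; rewrite !mxE.
  by have := bneg _ rn; rewrite c0 form0l ltxx.
move=> v vn; rewrite /v toRow; apply: bneg.
apply: contra_neq vn => r0; rewrite /v toRow r0.
by rewrite big1// => i _; rewrite mxE scale0r.
Qed.

(** Compactness in the space of coefficients makes negativity uniform, so that it survives small
    perturbations of the form. *)
Lemma negdef_span_coercive (V : set E) n : negdef_subspace_dim V q n ->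
  exists b : 'I_n -> E, exists2 k, 0 < k & (forall i, V (b i)) /\
    forall c : 'rV[R]_n, q (\sum_i c 0 i *: b i) (\sum_i c 0 i *: b i)
      <= - (k * `|c| ^+ 2).
Proof.
move=> [b [Vb bfree bneg]]; exists b.
have [h hn|k k0 kP] := @posdef_coercive R n (fun i j => - q (b i) (b j)).
  have -> : quad_form (fun i j => - q (b i) (b j)) h =
      - quad_form (fun i j => q (b i) (b j)) h.
    rewrite /quad_form -sumrN; apply: eq_bigr => i _; rewrite -mulrN -sumrN.
    by congr (_ * _); apply: eq_bigr => j _; rewrite mulrN.
  rewrite oppr_gt0 -form_comb; apply: (bneg (fun i => h 0 i)).
  apply: contra_neq hn => s0; apply/rowP => i; rewrite mxE.
  exact: (bfree (fun i => h 0 i)).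
exists k => //; split=> // c; rewrite form_comb lerNr.
apply: le_trans (kP c) _; rewrite /quad_form -sumrN le_eqVlt; apply/orP; left.
apply/eqP; apply: eq_bigr => i _; rewrite -mulrN -sumrN; congr (_ * _).
by apply: eq_bigr => j _; rewrite mulrN.
Qed.

Lemma row_comb_bound n (b : 'I_n -> E) : exists2 K : R, 0 <= K &
  forall c : 'rV[R]_n, `|\sum_i c 0 i *: b i| <= K * `|c|.
Proof.
exists (n%:R * \sum_i `|b i|); first by rewrite mulr_ge0// sumr_ge0.
move=> c; apply: norm_row_comb_le => i.
by rewrite (bigD1 i)//= lerDl sumr_ge0.
Qed.

(* A unit vector [v] of the complement on which the form is too small is turned
   into a negative direction [v - t A v], which together with the [b i] spans a
   negative definite subspace of too large a dimension. *)
Lemma complement_coercive (V : set E) (A B : clinear E E) m (b : 'I_m -> E)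
    (k1 : R) :
  (forall v w a, V v -> V w -> V (v + a *: w)) ->
  (forall v, V v -> V (A v)) ->
  (forall v w, V v -> V w -> ip (A v) w = q v w) ->
  (forall v, V v -> B (A v) = v) ->
  (forall i, V (b i)) -> 0 < k1 ->
  (forall c : 'rV[R]_m, q (\sum_i c 0 i *: b i) (\sum_i c 0 i *: b i)
     <= - (k1 * `|c| ^+ 2)) ->
  (forall n, negdef_subspace_dim V q n -> (n <= m)%N) ->
  exists2 k, 0 < k & forall v, V v -> (forall i, q (b i) v = 0) ->
    k * `|v| ^+ 2 <= q v v.
Proof.
move=> Vlin VA qA BA Vb k10 bneg mmax.
have [Kb Kb0 bK] := row_comb_bound b.
(* [B] inverts [A] on [V], which bounds [A] from below there; the [1 +] avoids a division by
   zero. *)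
pose beta := (1 + `|B|)^-1.
have B1 : 0 < 1 + `|B| by rewrite ltr_pwDl.
have b0 : 0 < beta by rewrite invr_gt0.
have Abelow v : V v -> beta * `|v| <= `|A v|.
  move=> Vv; rewrite ler_pdivrMl// -{1}(BA v Vv).
  by apply: le_trans (clinear_le _ _) _; rewrite ler_wpM2r// lerDr.
pose K := `|L| * `|A| * Kb.
have [t t0 tP] := @indefinite_arith R beta `|A| `|L| K k1 b0
  (normr_ge0 _) k10 (normr_ge0 _).
pose eps := t * beta ^+ 2 / 2.
have eps0 : 0 < eps by rewrite divr_gt0// mulr_gt0// exprn_gt0.
exists eps => // v Vv bv.
have [->|vn] := eqVneq v 0; first by rewrite normr0 expr0n/= mulr0 form0l.
have vgt0 : 0 < `|v| by rewrite normr_gt0.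
rewrite leNgt; apply/negP => small.
pose u := `|v|^-1 *: v.
have Vu : V u.
  have := Vlin v v (`|v|^-1 - 1) Vv Vv.
  by rewrite scalerBl scale1r addrCA subrr addr0.
have u1 : `|u| = 1 by exact: normfZV.
have bu i : q (b i) u = 0 by rewrite formZr bv mulr0.
have qu : q u u < eps.
  rewrite formZl formZr mulrA -expr2 exprVn mulrC ltr_pdivrMr ?exprn_gt0//.
clearbody u.
pose y := u + (- t) *: A u.
have Vy : V y by apply: Vlin => //; exact: VA.
have Au1 : beta <= `|A u| by rewrite -[beta]mulr1 -u1 Abelow.
have p1 : beta ^+ 2 <= ip (A u) (A u).
  by rewrite ip_norm ler_pXn2r ?nnegrE ?(ltW b0).
have AuA : `|A u| <= `|A| by rewrite -[leRHS]mulr1 -u1 clinear_le.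
have qy : q y y <= q u u - 2 * t * ip (A u) (A u) + t ^+ 2 * (`|L| * `|A| ^+ 2).
  rewrite /y form_sqrD !formZr !formZl -(qA u (A u))//; last exact: VA.
  have h1 : q (A u) (A u) <= `|L| * `|A| ^+ 2.
    apply: le_trans (ler_norm _) _; apply: le_trans (form_le _ _) _.
    by rewrite expr2 -mulrA ler_wpM2l// ler_pM.
  have h2 : t ^+ 2 * q (A u) (A u) <= t ^+ 2 * (`|L| * `|A| ^+ 2).
    by rewrite ler_wpM2l// exprn_ge0// ltW.
  have -> : - t * (- t * q (A u) (A u)) = t ^+ 2 * q (A u) (A u) by ring.
  have -> : 2 * (- t * ip (A u) (A u)) = - (2 * t * ip (A u) (A u)) by ring.
  by rewrite lerD2l.
suff /mmax : negdef_subspace_dim V q m.+1 by rewrite ltnn.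
pose b' i := if unlift ord0 i is Some j then b j else y.
apply: (@negdef_family _ m.+1 b') => [i|c cn].
  by rewrite /b'; case: unliftP => [j _|_].
pose c' : 'rV[R]_m := \row_j c 0 (lift ord0 j).
have -> : \sum_i c 0 i *: b' i = c 0 ord0 *: y + \sum_i c' 0 i *: b i.
  rewrite big_ord_recl /b' unlift_none; congr (_ + _); apply: eq_bigr => i _.
  by rewrite liftK mxE.
set w := \sum_i _ *: b i.
(* [u] is orthogonal to the [b i] for the form, so only [- t A u] contributes: the cross term
   carries a factor [t]. *)
have cross : `|q y w| <= t * K * `|c'|.
  have -> : q y w = - t * q (A u) w.
    rewrite /y formDl formZl /w form_sumr big1 ?add0r// => i _.
    by rewrite formZr form_sym bu mulr0.
  rewrite normrM normrN (gtr0_norm t0) -mulrA ler_pM2l//.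
  apply: le_trans (form_le _ _) _.
  apply: (@le_trans _ _ (`|L| * `|A| * (Kb * `|c'|))).
    by rewrite ler_pM ?mulr_ge0// ?ler_wpM2l//; exact: bK.
  by rewrite /K !mulrA.
have xc : (c 0 ord0 != 0) || (`|c'| != 0).
  rewrite -negb_and; apply: contra cn => /andP[/eqP c00 /eqP/normr0_eq0 c0'].
  apply/eqP/rowP => i; rewrite [RHS]mxE.
  have [j ->|->//] := unliftP ord0 i.
  by have := congr1 (fun x : 'rV_m => x 0 j) c0'; rewrite !mxE.
have := tP _ _ (c 0 ord0) _ _ _ qu p1 qy cross xc.
have := bneg c'; rewrite -/w => hw.
have -> : q (c 0 ord0 *: y + w) (c 0 ord0 *: y + w) =
    c 0 ord0 ^+ 2 * q y y + 2 * c 0 ord0 * q y w + q w w.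
  by rewrite form_sqrD !formZl formZr; ring.
by apply: le_lt_trans; rewrite lerD2l.
Qed.

End SymmetricForms.

(** * Orthogonal frames of equal norm, their projections and their complements *)

Section Frames.
Context {R : realType} {E : completeNormedModType R}.
Variable ip : {dot E for (@idfun R)}.
Hypothesis ip_norm : forall u : E, ip u u = `|u| ^+ 2.
Context {d : nat}.

(* Coordinates in the frame [tau], when it is orthogonal with common norm [c]. *)
Definition frame_coord (c : R) (tau : 'I_d -> E) (y : E) : 'rV[R]_d :=
  \row_i (c ^- 2 * ip y (tau i)).

Definition frame_comb (tau : 'I_d -> E) (h : 'rV[R]_d) : E :=
  \sum_i h 0 i *: tau i.

Definition frame_proj c tau y := frame_comb tau (frame_coord c tau y).

Definition orthoframe (c : R) (tau : 'I_d -> E) :=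
  forall i j, ip (tau i) (tau j) = c ^+ 2 *+ (i == j).

Lemma row_norm_le (h : 'rV[R]_d) (B : R) :
  0 <= B -> (forall i, `|h 0 i| <= B) -> `|h| <= B.
Proof.
move=> B0 hB; rewrite [leLHS]/Num.norm/= mx_normrE.
by apply: bigmax_le => // -[i j] _; rewrite (ord1 i).
Qed.

Lemma frame_combP (tau : 'I_d -> E) a h h' :
  frame_comb tau (a *: h + h') = a *: frame_comb tau h + frame_comb tau h'.
Proof.
rewrite /frame_comb scaler_sumr -big_split/=; apply: eq_bigr => i _.
by rewrite !mxE scalerDl scalerA.
Qed.

Lemma frame_coordP c tau a y y' : frame_coord c tau (a *: y + y') =
  a *: frame_coord c tau y + frame_coord c tau y'.
Proof. by apply/rowP => i; rewrite !mxE ipDl ipZl; ring. Qed.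

Variables (c : R) (tau : 'I_d -> E).
Hypothesis c0 : 0 < c.

Lemma frame_proj_linear : linear (frame_proj c tau).
Proof. by move=> a y y'; rewrite /frame_proj frame_coordP frame_combP. Qed.

Lemma frame_coord_le (t : 'I_d -> E) (y : E) : (forall i, `|t i| <= c) ->
  `|frame_coord c t y| <= c^-1 * `|y|.
Proof.
move=> tc; apply: row_norm_le => [|i]; first by rewrite mulr_ge0// invr_ge0 ltW.
rewrite mxE normrM ger0_norm ?invr_ge0 ?exprn_ge0 ?(ltW c0)//.
apply: (@le_trans _ _ (c ^- 2 * (`|y| * c))).
  rewrite ler_wpM2l ?invr_ge0 ?exprn_ge0 ?(ltW c0)//.
  by apply: le_trans (cauchy_schwarz ip_norm _ _) _; rewrite ler_wpM2l.
by rewrite le_eqVlt; apply/orP; left; apply/eqP; field; rewrite gt_eqF.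
Qed.

Hypothesis oframe : orthoframe c tau.

Lemma frame_norm i : `|tau i| = c.
Proof.
apply/eqP; rewrite -(eqrXn2 (_ : 0 < 2)%N) ?(ltW c0)//.
by rewrite -ip_norm oframe eqxx mulr1n.
Qed.

Lemma ip_frame_comb h j : ip (frame_comb tau h) (tau j) = c ^+ 2 * h 0 j.
Proof.
rewrite ip_suml (bigD1 j)//= big1 => [|i ij].
  by rewrite ipZl oframe eqxx addr0 mulr1n mulrC.
by rewrite ipZl oframe (negPf ij) mulr0n mulr0.
Qed.

Lemma frame_combK h : frame_coord c tau (frame_comb tau h) = h.
Proof.
apply/rowP => i; rewrite mxE ip_frame_comb mulrA mulVf ?mul1r//.
by rewrite expf_neq0// gt_eqF.
Qed.

Lemma frame_proj_ortho y i : ip (y - frame_proj c tau y) (tau i) = 0.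
Proof.
rewrite ipBl ip_frame_comb mxE mulrA mulfV ?mul1r ?subrr//.
by rewrite expf_neq0// gt_eqF.
Qed.

Lemma frame_proj_eq0 y : (forall i, ip y (tau i) = 0) -> frame_proj c tau y = 0.
Proof.
move=> y0; rewrite /frame_proj /frame_comb big1// => i _.
by rewrite mxE y0 mulr0 scale0r.
Qed.

Lemma frame_proj_comb h : frame_proj c tau (frame_comb tau h) = frame_comb tau h.
Proof. by rewrite /frame_proj frame_combK. Qed.

Lemma frame_comb_le h : `|frame_comb tau h| <= d%:R * c * `|h|.
Proof. by apply: norm_row_comb_le => i; rewrite frame_norm. Qed.

Lemma frame_proj_le y : `|frame_proj c tau y| <= d%:R * `|y|.
Proof.
apply: le_trans (frame_comb_le _) _.
have tc i : `|tau i| <= c by rewrite frame_norm.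
apply: (@le_trans _ _ (d%:R * c * (c^-1 * `|y|))).
  by rewrite ler_wpM2l ?frame_coord_le// mulr_ge0// ltW.
by rewrite le_eqVlt; apply/orP; left; apply/eqP; field; rewrite gt_eqF.
Qed.

Lemma frame_proj_clinear : {P : clinear E E | forall y, P y = frame_proj c tau y}.
Proof. exact: clinear_of frame_proj_linear frame_proj_le. Qed.

Lemma frame_comb_ortho h y :
  (forall i, ip y (tau i) = 0) -> ip (frame_comb tau h) y = 0.
Proof.
by move=> y0; rewrite ip_suml big1// => i _; rewrite ipZl ipC y0 mulr0.
Qed.

Lemma frame_proj_near (tau' : 'I_d -> E) (k : R) y : 0 <= k ->
  (forall i, `|tau' i - tau i| <= k) -> (forall i, `|tau' i| = c) ->
  `|frame_proj c tau' y - frame_proj c tau y| <= 2 * d%:R / c * k * `|y|.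
Proof.
move=> k0 tk tc'.
have -> : frame_proj c tau' y - frame_proj c tau y =
    \sum_i (frame_coord c tau' y 0 i *: (tau' i - tau i) +
            (frame_coord c tau' y 0 i - frame_coord c tau y 0 i) *: tau i).
  rewrite -sumrB; apply: eq_bigr => i _.
  by rewrite scalerBr scalerBl addrA subrK.
apply: le_trans (ler_norm_sum _ _ _) _.
apply: (@le_trans _ _ (\sum_(i < d) (2 / c * k * `|y|))); last first.
  by rewrite sumr_const card_ord -[leLHS]mulr_natl le_eqVlt; apply/orP; left;
    apply/eqP; field; rewrite gt_eqF.
apply: ler_sum => i _; apply: le_trans (ler_normD _ _) _.
have tc'' j : `|tau' j| <= c by rewrite tc'.
have h1 : `|frame_coord c tau' y 0 i| <= c^-1 * `|y|.
  by apply: le_trans (norm_entry_le _ _) _; exact: frame_coord_le.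
have h2 : `|frame_coord c tau' y 0 i - frame_coord c tau y 0 i| <=
    c ^- 2 * (`|y| * k).
  rewrite !mxE -mulrBr -ipBr normrM ger0_norm ?invr_ge0 ?exprn_ge0 ?(ltW c0)//.
  rewrite ler_wpM2l ?invr_ge0 ?exprn_ge0 ?(ltW c0)//.
  by apply: le_trans (cauchy_schwarz ip_norm _ _) _; rewrite ler_wpM2l.
have -> : 2 / c * k * `|y| = c^-1 * `|y| * k + c ^- 2 * (`|y| * k) * c.
  by field; rewrite gt_eqF.
rewrite !normrZ frame_norm; apply: lerD; first by rewrite ler_pM.
by rewrite ler_wpM2r// ltW.
Qed.

End Frames.

Section FrameComplement.
Context {R : realType} {E : completeNormedModType R}.
Variable ip : {dot E for (@idfun R)}.
Hypothesis ip_norm : forall u : E, ip u u = `|u| ^+ 2.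
Context {d : nat}.
Variables (c : R) (tau : 'I_d -> E).
Hypotheses (c0 : 0 < c) (oframe : orthoframe ip c tau).
Variables (L : clinear E (clinear E R^o)) (A0 : clinear E E).
Hypothesis Lsym : forall v w, L v w = L w v.
Hypothesis A0L : forall v w, ip (A0 v) w = L v w.
Hypothesis A0tau : forall i, A0 (tau i) = 0.
Let V : set E := [set v | forall i, ip v (tau i) = 0].
Local Notation P := (frame_proj ip c tau).
Hypothesis nondeg : nondegenerate_on ip V (form_of L).

Lemma A0_proj y : A0 (P y) = 0.
Proof.
rewrite /frame_proj /frame_comb linear_sum big1// => i _.
by rewrite linearZ/= A0tau scaler0.
Qed.

Lemma A0_range y : V (A0 y).
Proof. by move=> i; rewrite A0L Lsym -A0L A0tau ip0l. Qed.

Lemma A0_subproj y : A0 (y - P y) = A0 y.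
Proof. by rewrite linearB/= A0_proj subr0. Qed.

Lemma frame_subproj_mem y : V (y - P y).
Proof. by move=> i; exact: frame_proj_ortho. Qed.

Lemma eq_on_frame_complement x y : V x -> V y ->
  (forall w, V w -> ip x w = ip y w) -> x = y.
Proof.
move=> Vx Vy xy; have Vxy : V (x - y).
  by move=> i; rewrite ipBl Vx Vy subrr.
apply/eqP; rewrite -subr_eq0 -normr_eq0 -sqrf_eq0 -ip_norm ipBl xy//.
by rewrite subrr.
Qed.

(** [A0] vanishes on the frame and has its range in the complement, where nondegeneracy inverts it.
    Adding the projection [P] fills the kernel; the inverse is [B] on the complement and the
    identity on the span of the frame. *)
Lemma frame_complement_inverse : exists K L' : clinear E E,
  [/\ forall v, K v = A0 v + P v, forall v, L' (K v) = v & forall v, K (L' v) = v].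
Proof.
have [A [B [ABV AL ABK]]] := nondeg.
have [Pc PcE] := frame_proj_clinear ip_norm c0 oframe.
have [BQ BQE] := clinear_comp B (projT1 (clinear_id E) - Pc).
have idE x : projT1 (clinear_id E) x = x by case: clinear_id.
have BQE' x : BQ x = B (x - P x) by rewrite BQE clinearBE idE PcE.
have AA0 v : V v -> A v = A0 v.
  move=> Vv; apply: eq_on_frame_complement.
  - by have [] := ABV _ Vv.
  - exact: A0_range.
  - by move=> w Vw; rewrite AL// A0L.
exists (A0 + Pc), (BQ + Pc); split=> v.
- by rewrite clinearDE PcE.
- rewrite !clinearDE !PcE BQE'.
  have P0 : P (A0 v) = 0 by apply: frame_proj_eq0; exact: A0_range.
  have PP : P (P v) = P v by exact: frame_proj_comb.
  have PD : P (A0 v + P v) = P v.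
    by have := @frame_proj_linear _ _ ip _ c tau 1 (A0 v) (P v); rewrite !scale1r P0 PP add0r.
  rewrite PD addrK -A0_subproj -AA0; last exact: frame_subproj_mem.
  have [_ ->] := ABK _ (frame_subproj_mem v).
  by rewrite subrK.
- rewrite !clinearDE !PcE BQE'.
  have VB : V (B (v - P v)) by have [] := ABV _ (frame_subproj_mem v).
  have P0 : P (B (v - P v)) = 0 by apply: frame_proj_eq0; exact: VB.
  have PP : P (P v) = P v by exact: frame_proj_comb.
  have PD : P (B (v - P v) + P v) = P v.
    have := @frame_proj_linear _ _ ip _ c tau 1 (B (v - P v)) (P v).
    by rewrite !scale1r P0 PP add0r.
  rewrite PD linearD/= A0_proj addr0 -AA0//.
  have [-> _] := ABK _ (frame_subproj_mem v).
  by rewrite subrK.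
Qed.

(** The form does not see the component along the frame, so the bound of [complement_coercive]
    extends to every vector of [E]. It is applied to vectors normal to the frame at a nearby point,
    which are not in the complement of this one. *)
Lemma frame_complement_coercive (m : nat) (b : 'I_m -> E) (k1 : R) :
  (forall i, V (b i)) -> 0 < k1 ->
  (forall h : 'rV[R]_m, form_of L (\sum_i h 0 i *: b i) (\sum_i h 0 i *: b i)
     <= - (k1 * `|h| ^+ 2)) ->
  (forall n, negdef_subspace_dim V (form_of L) n -> (n <= m)%N) ->
  exists2 k, 0 < k & forall v, (forall i, form_of L (b i) v = 0) ->
    k * `|v - P v| ^+ 2 <= form_of L v v.
Proof.
move=> Vb k10 bneg mmax.
have [A [B [ABV AL ABK]]] := nondeg.
have [||||k k0 kP] := complement_coercive ip_norm Lsym (A := A) (B := B)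
  _ _ _ _ Vb k10 bneg mmax.
- by move=> v w a Vv Vw i; rewrite ipDl ipZl Vv Vw mulr0 addr0.
- by move=> v /ABV[].
- by move=> v w Vv Vw; exact: AL.
- by move=> v /ABK[].
exists k => // v bv.
have L0 w : form_of L (P v) w = 0 by rewrite /form_of -A0L A0_proj ip0l.
have E1 w : form_of L w (v - P v) = form_of L w v.
  by rewrite formBr// (form_sym Lsym w (P v)) L0 subr0.
have -> : form_of L v v = form_of L (v - P v) (v - P v).
  by rewrite E1 (form_sym Lsym _ v) E1.
by apply: kP => [|i]; [exact: frame_subproj_mem|rewrite E1].
Qed.

End FrameComplement.

(** * From the block estimates to bounds on the two components of a vector *)

Section SplittingArithmetic.
Context {R : realType}.

(** [N] and [V] are the norms of the tangential coordinates and of the normal component, [D] is the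
    size of the residual. The bound on [V] is inserted into the mixed term [k s N V], and the
    outcome is absorbed by [k0 N^2], as [k] is small against [kappa] and [k0]. It serves both
    nondegeneracy, with [D] the norm of the Hessian applied to a vector, and continuity, with [D]
    the norm of a gradient. *)
Lemma splitting_arith (kappa k0 k s N V D Z : R) :
  0 < kappa -> 0 < k0 -> 0 <= k -> 4 * k <= kappa -> 4 * k <= k0 ->
  0 < s -> s <= 1 -> 0 <= N -> 0 <= V -> 0 <= D -> 1 <= Z ->
  kappa * V <= 2 * k * V + D + k * s * N ->
  s ^+ 2 * (k0 * N ^+ 2) <= D * Z * N + k * s ^+ 2 * N ^+ 2 + k * s * N * V ->
  s ^+ 2 * (N + V) <= (3 / k0 + 4 / kappa) * Z * D.
Proof.
move=> ka0 k00 kge0 kka kk0 s0 s1 N0 V0 D0 Z1 hV hN.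
have s20 : 0 <= s ^+ 2 by rewrite exprn_ge0// ltW.
have DZ : D <= D * Z by rewrite ler_peMr.
have ksN : 0 <= k * s * N by rewrite !mulr_ge0// ltW.
have kV : 4 * k * V <= kappa * V by rewrite ler_wpM2r.
have V1 : kappa * V <= 2 * (D + k * s * N) by lra.
(* [V1] multiplied by [k * s * N], with [4 * k <= kappa]: the mixed term turns into a residual term
   and a fraction of the tangent term. *)
have V2 : kappa * (k * s * N * V) <= kappa * (s * N * D / 2 + k * s ^+ 2 * N ^+ 2 / 2).
  have -> : kappa * (k * s * N * V) = k * s * N * (kappa * V) by ring.
  apply: (@le_trans _ _ (k * s * N * (2 * (D + k * s * N)))); first by rewrite ler_wpM2l.
  have -> : k * s * N * (2 * (D + k * s * N)) =
    4 * k * (s * N * D / 2 + k * s ^+ 2 * N ^+ 2 / 2) by field.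
  have t1 : 0 <= s * N * D := mulr_ge0 (mulr_ge0 (ltW s0) N0) D0.
  have t2 : 0 <= k * s ^+ 2 * N ^+ 2.
    by apply: mulr_ge0; [exact: mulr_ge0|exact: sqr_ge0].
  by apply: ler_wpM2r => //; apply: addr_ge0; exact: divr_ge0.
rewrite ler_pM2l// in V2.
have sND : s * N * D <= D * Z * N.
  have -> : s * N * D = s * D * N by ring.
  by rewrite ler_wpM2r//; apply: le_trans DZ; rewrite ler_piMl.
have h1 : s ^+ 2 * (k0 * N ^+ 2) <= 3 / 2 * (D * Z * N) + 3 / 2 * (k * s ^+ 2 * N ^+ 2).
  move: hN V2 sND; set a1 := _ * (k0 * _); set a2 := D * Z * N.
  set a3 := k * s ^+ 2 * _; set a4 := k * s * N * V; set a5 := s * N * D; lra.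
have p0 : 0 <= D * Z by rewrite mulr_ge0// (le_trans ler01 Z1).
have sN : s ^+ 2 * N <= 3 / k0 * (D * Z).
  have [->|Nn] := eqVneq N 0; first by rewrite mulr0 mulr_ge0// divr_ge0// ltW.
  have Ngt : 0 < N by rewrite lt_def Nn.
  have h2 : 4 * k * (s ^+ 2 * N ^+ 2) <= k0 * (s ^+ 2 * N ^+ 2).
    by rewrite ler_wpM2r// mulr_ge0// exprn_ge0.
  rewrite -(ler_pM2r Ngt) -(ler_pM2l k00).
  have -> : k0 * (3 / k0 * (D * Z) * N) = 3 * (D * Z * N) by field; rewrite gt_eqF.
  have p1 : 0 <= D * Z * N by rewrite mulr_ge0.
  move: h1 h2.
  have -> : s ^+ 2 * (k0 * N ^+ 2) = k0 * (s ^+ 2 * N * N) by ring.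
  have -> : k0 * (s ^+ 2 * N ^+ 2) = k0 * (s ^+ 2 * N * N) by ring.
  have -> : 4 * k * (s ^+ 2 * N ^+ 2) = 4 * (k * s ^+ 2 * N ^+ 2) by ring.
  set a1 := k0 * _; set a2 := k * _ * _; lra.
have sV : s ^+ 2 * V <= 4 / kappa * (D * Z).
  rewrite -(ler_pM2l ka0).
  have -> : kappa * (s ^+ 2 * V) = s ^+ 2 * (kappa * V) by ring.
  have -> : kappa * (4 / kappa * (D * Z)) = 4 * (D * Z) by field; rewrite gt_eqF.
  apply: (@le_trans _ _ (s ^+ 2 * (2 * (D + k * s * N)))); first by rewrite ler_wpM2l.
  have -> : s ^+ 2 * (2 * (D + k * s * N)) =
    2 * (s ^+ 2 * D) + 2 * (s * (k * (s ^+ 2 * N))) by ring.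
  have e1 : s ^+ 2 * D <= D by rewrite ler_piMl// exprn_ile1// ltW.
  have kk : k * (3 / k0 * (D * Z)) <= 3 / 4 * (D * Z).
    rewrite -(ler_pM2l k00).
    have -> : k0 * (k * (3 / k0 * (D * Z))) = 3 / 4 * (4 * k * (D * Z)) by field; rewrite gt_eqF.
    have -> : k0 * (3 / 4 * (D * Z)) = 3 / 4 * (k0 * (D * Z)) by ring.
    by rewrite ler_wpM2l// ler_wpM2r.
  have e2 : s * (k * (s ^+ 2 * N)) <= 3 / 4 * (D * Z).
    apply: (@le_trans _ _ (k * (s ^+ 2 * N))).
      by apply: ler_piMl => //; apply: mulr_ge0 => //; exact: mulr_ge0.
    by apply: le_trans kk; rewrite ler_wpM2l.
  move: e1 e2 DZ p0; set a1 := s ^+ 2 * D; set a2 := s * _; set a3 := D * Z; lra.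
rewrite mulrDr -mulrA [Z * D]mulrC mulrDl; exact: lerD.
Qed.

Lemma cross_term_bound (k s N C X : R) : 0 <= k -> 0 <= N -> 0 <= C -> 0 <= s ->
  `|X| <= k * s * N * C -> `|2 * X| <= k * (s ^+ 2 * N ^+ 2) + k * C ^+ 2.
Proof.
move=> k0 N0 C0 s0 hX; rewrite normrM ger0_norm//.
have : 0 <= k * (s * N - C) ^+ 2 by rewrite mulr_ge0// sqr_ge0.
have -> : k * (s * N - C) ^+ 2 =
  k * (s ^+ 2 * N ^+ 2) + k * C ^+ 2 - 2 * (k * s * N * C) by ring.
by move: hX; set a := `|X|; set b := k * s * N * C; set p := k * _ + k * C ^+ 2; lra.
Qed.

End SplittingArithmetic.

(** * The Hessian at one critical point as a perturbation of a block form *)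

Section PointAnalysis.
Context {R : realType} {E : completeNormedModType R}.
Variable ip : {dot E for (@idfun R)}.
Hypothesis ip_norm : forall u : E, ip u u = `|u| ^+ 2.
Context {d : nat}.
Variables (c : R) (tau tau0 : 'I_d -> E) (Hq : 'rV[R]_d -> R).
Variables (L M : clinear E (clinear E R^o)) (A0 : clinear E E) (k s : R).
Hypotheses (c0 : 0 < c) (oframe : orthoframe ip c tau).
Hypothesis A0L : forall v w, ip (A0 v) w = L v w.
Hypothesis Msym : forall v w, M v w = M w v.
Hypotheses (k_ge0 : 0 <= k) (s_gt0 : 0 < s) (s_le1 : s <= 1).
Local Notation q := (form_of L).
Local Notation qM := (form_of M).
Local Notation T := (frame_comb tau).
Local Notation P := (frame_proj ip c tau).
Local Notation P0 := (frame_proj ip c tau0).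
Hypothesis Ha : forall h y, `|qM (T h) y| <= k * s * `|h| * `|y|.
Hypothesis Hb : forall h,
  `|qM (T h) (T h) - s ^+ 2 * Hq h| <= k * s ^+ 2 * `|h| ^+ 2.
Hypothesis Hc : forall v y, `|qM v y - q v y| <= k * `|v| * `|y|.
Hypothesis HP : forall v, `|P v - P0 v| <= k * `|v|.

Let mul_s2N h : 0 <= s ^+ 2 * `|h : 'rV[R]_d| ^+ 2.
Proof. by rewrite mulr_ge0// exprn_ge0// ltW. Qed.

(** The vector [T h + v] is tested against [T h], where [s ^+ 2 * Hq h] controls [h], and against
    arbitrary vectors, where [A0 + P0] controls [v]. As [v] is orthogonal to [tau], the term [P0 v]
    is a difference of two nearby projections. *)
Lemma splitting_bound (kappa k0 D : R) h v :
  0 < kappa -> 0 < k0 -> 4 * k <= kappa -> 4 * k <= k0 -> 0 <= D ->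
  (forall x, kappa * `|x| <= `|A0 x + P0 x|) ->
  (forall x, k0 * `|x| ^+ 2 <= `|Hq x|) ->
  (forall x, `|qM (T h + v) x| <= D * `|x|) ->
  (forall i, ip v (tau i) = 0) ->
  s ^+ 2 * (`|h| + `|v|) <= (3 / k0 + 4 / kappa) * (1 + d%:R * c) * D.
Proof.
move=> ka0 k00 kka kk0 D0 hA hH hD vo.
have Z1 : 1 <= 1 + d%:R * c by rewrite lerDl mulr_ge0// ltW.
apply: (splitting_arith (k := k)) => //.
- apply: le_trans (hA v) _; apply: le_trans (ler_normD _ _) _.
  have hP0 : `|P0 v| <= k * `|v|.
    have := HP v; rewrite (frame_proj_eq0 c vo) sub0r normrN //.
  have hA0 : `|A0 v| <= D + k * s * `|h| + k * `|v|.
    apply: (norm_le_ip ip_norm) => [|y].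
      by rewrite !addr_ge0// !mulr_ge0// ltW.
    rewrite A0L -[X in X <= _]/(q v y).
    have h1 := hD y; rewrite (formDl Msym) in h1.
    have h2 := Ha h y; have h3 := Hc v y.
    rewrite !mulrDl; move: h1 h2 h3; rewrite !ler_norml.
    by move=> /andP[? ?] /andP[? ?] /andP[? ?]; lra.
  move: hP0 hA0; set a := `|A0 v|; set b := `|P0 v|; set kv := k * `|v|.
  have -> : 2 * k * `|v| = 2 * kv by rewrite /kv; ring.
  by lra.
- have hTn : `|T h| <= (1 + d%:R * c) * `|h|.
    apply: le_trans (frame_comb_le ip_norm c0 oframe h) _.
    by rewrite ler_wpM2r// lerDr.
  have h1 : `|qM (T h + v) (T h)| <= D * (1 + d%:R * c) * `|h|.
    by apply: le_trans (hD _) _; rewrite -mulrA ler_wpM2l.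
  have h2 : `|qM v (T h)| <= k * s * `|h| * `|v| by rewrite (form_sym Msym).
  rewrite (formDl Msym) in h1.
  apply: (@le_trans _ _ (s ^+ 2 * `|Hq h|)).
    by rewrite ler_wpM2l// exprn_ge0// ltW.
  have -> : s ^+ 2 * `|Hq h| = `|s ^+ 2 * Hq h|.
    by rewrite normrM (ger0_norm (sqr_ge0 s)).
  have h3 := Hb h; move: h1 h2 h3; rewrite !ler_norml.
  by move=> /andP[? ?] /andP[? ?] /andP[? ?]; apply/andP; split; lra.
Qed.

(** The alternative [h = 0] serves a negative definite limit form, where the tangential directions
    have been removed. Since [|P0 v| <= |v| / 2], replacing [v - P0 v] by [v] costs a factor [4],
    whence [8 * k < k2]. *)
Lemma positive_on_complement (k0 k2 : R) h v :
  2 * k < k0 -> 8 * k < k2 -> k <= 2^-1 ->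
  (h = 0 \/ k0 * `|h| ^+ 2 <= Hq h) ->
  (forall i, ip v (tau i) = 0) ->
  k2 * `|v - P0 v| ^+ 2 <= q v v -> (h != 0) || (v != 0) ->
  0 < qM (T h + v) (T h + v).
Proof.
move=> kk0 kk2 k12 hH vo hq hv.
have hP0 : `|P0 v| <= 2^-1 * `|v|.
  have := HP v; rewrite (frame_proj_eq0 c vo) sub0r normrN => /le_trans; apply.
  by rewrite ler_wpM2r.
have k20 : 0 < k2 by apply: le_lt_trans kk2; rewrite mulr_ge0.
have q1 : k2 / 4 * `|v| ^+ 2 <= q v v.
  apply: le_trans hq.
  have -> : k2 / 4 * `|v| ^+ 2 = k2 * (2^-1 * `|v|) ^+ 2 by field.
  rewrite ler_pM2l// ler_pXn2r ?nnegrE ?mulr_ge0//.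
  have := ler_distD 0 v (P0 v); rewrite subr0 sub0r normrN => _.
  have := lerB_dist v (P0 v); move: hP0; set a := `|v|; set b := `|P0 v|.
  set x := `|_ - _|; lra.
have q2 : `|qM v v - q v v| <= k * `|v| ^+ 2.
  by apply: le_trans (Hc v v) _; rewrite expr2 mulrA.
have q3 := cross_term_bound k_ge0 (normr_ge0 h) (normr_ge0 v) (ltW s_gt0) (Ha h v).
have q4 := Hb h.
rewrite (form_sqrD Msym).
have N0 := mul_s2N h; have V0 : 0 <= `|v| ^+ 2 by rewrite exprn_ge0.
have hH' : s ^+ 2 * (k0 * `|h| ^+ 2) <= s ^+ 2 * Hq h \/ h = 0.
  case: hH => [->|hH]; first by right.
  by left; rewrite ler_wpM2l// exprn_ge0// ltW.
have q5 : (k0 - k) * (s ^+ 2 * `|h| ^+ 2) <= qM (T h) (T h).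
  case: hH' => [hh|->]; last first.
    have -> : T 0 = 0 by rewrite /frame_comb big1// => i _; rewrite mxE scale0r.
    by rewrite (form0l Msym) normr0 expr0n/= !mulr0.
  move: q4 hh; rewrite ler_norml => /andP[q4 _].
  move: q4; set a := qM _ _; set x := s ^+ 2 * Hq h.
  have -> : (k0 - k) * (s ^+ 2 * `|h| ^+ 2) =
    s ^+ 2 * (k0 * `|h| ^+ 2) - k * s ^+ 2 * `|h| ^+ 2 by ring.
  by set b := s ^+ 2 * _; lra.
have q6 : (k2 / 4 - k) * `|v| ^+ 2 <= qM v v.
  move: q1 q2; rewrite ler_norml => q1 /andP[q2 _].
  by move: q1 q2; rewrite mulrBl; set a := k * _; set b := k2 / 4 * _; lra.
have q7 : - (k * (s ^+ 2 * `|h| ^+ 2) + k * `|v| ^+ 2) <= 2 * qM (T h) v.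
  by move: q3; rewrite ler_norml => /andP[].
apply: (@lt_le_trans _ _ ((k0 - 2 * k) * (s ^+ 2 * `|h| ^+ 2) +
   (k2 / 4 - 2 * k) * `|v| ^+ 2)).
  have x1 : 0 < k0 - 2 * k by rewrite subr_gt0.
  have x2 : 0 < k2 / 4 - 2 * k.
    rewrite subr_gt0 ltr_pdivlMr//.
    by have -> : 2 * k * 4 = 8 * k by ring.
  have y1 : 0 <= (k0 - 2 * k) * (s ^+ 2 * `|h| ^+ 2) by rewrite mulr_ge0// ltW.
  have y2 : 0 <= (k2 / 4 - 2 * k) * `|v| ^+ 2 by rewrite mulr_ge0// ltW.
  case/orP: hv => n0.
    by apply: ltr_pwDl => //; apply: mulr_gt0 => //; apply: mulr_gt0; rewrite exprn_gt0 ?normr_gt0.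
  by apply: ltr_wpDl => //; apply: mulr_gt0 => //; rewrite exprn_gt0 ?normr_gt0.
move: q5 q6 q7; set a1 := qM _ _; set a2 := qM _ _; set a3 := 2 * qM _ _.
set u := s ^+ 2 * _; set w := `|v| ^+ 2.
have -> : (k0 - 2 * k) * u + (k2 / 4 - 2 * k) * w =
  (k0 - k) * u + (k2 / 4 - k) * w - (k * u + k * w) by ring.
set y1 := (k0 - k) * u; set y2 := (k2 / 4 - k) * w; set y3 := k * u + _; lra.
Qed.

(** The [b i] come from the unperturbed form and stay fixed while the frame moves; [Ha] makes the
    mixed term small whatever their position relative to the frame. The alternative [h = 0] serves a
    positive definite limit form. *)
Lemma negative_on_span (n : nat) (b : 'I_n -> E) (k0 k1 Kb : R) h (g : 'rV[R]_n) :
  2 * k < k0 -> 2 * k * Kb ^+ 2 < k1 -> 0 <= Kb ->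
  (h = 0 \/ Hq h <= - (k0 * `|h| ^+ 2)) ->
  (q (\sum_i g 0 i *: b i) (\sum_i g 0 i *: b i) <= - (k1 * `|g| ^+ 2)) ->
  `|\sum_i g 0 i *: b i| <= Kb * `|g| ->
  (h != 0) || (g != 0) ->
  qM (T h + \sum_i g 0 i *: b i) (T h + \sum_i g 0 i *: b i) < 0.
Proof.
move=> kk0 kk1 Kb0 hH; set x := \sum_i _ => hq xK hg.
have q2 : `|qM x x - q x x| <= k * Kb ^+ 2 * `|g| ^+ 2.
  apply: le_trans (Hc x x) _.
  have -> : k * Kb ^+ 2 * `|g| ^+ 2 = k * ((Kb * `|g|) * (Kb * `|g|)) by ring.
  by rewrite -mulrA ler_wpM2l// ler_pM.
have hx : `|qM (T h) x| <= k * s * `|h| * (Kb * `|g|).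
  by apply: le_trans (Ha h x) _; rewrite ler_wpM2l// !mulr_ge0// ltW.
have Kg0 : 0 <= Kb * `|g| by rewrite mulr_ge0.
have q3 := cross_term_bound k_ge0 (normr_ge0 h) Kg0 (ltW s_gt0) hx.
have q4 := Hb h.
rewrite (form_sqrD Msym).
have N0 := mul_s2N h; have G0 : 0 <= `|g| ^+ 2 by rewrite exprn_ge0.
have q5 : qM (T h) (T h) <= - ((k0 - k) * (s ^+ 2 * `|h| ^+ 2)).
  case: hH => [->|hH].
    have -> : T 0 = 0 by rewrite /frame_comb big1// => i _; rewrite mxE scale0r.
    by rewrite (form0l Msym) normr0 expr0n/= !mulr0 oppr0.
  have hh : s ^+ 2 * Hq h <= s ^+ 2 * (- (k0 * `|h| ^+ 2)).
    by rewrite ler_wpM2l// exprn_ge0// ltW.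
  move: q4; rewrite ler_norml => /andP[_ q4].
  move: q4 hh; set a := qM _ _; set y := s ^+ 2 * Hq h.
  have -> : - ((k0 - k) * (s ^+ 2 * `|h| ^+ 2)) =
    s ^+ 2 * (- (k0 * `|h| ^+ 2)) + k * s ^+ 2 * `|h| ^+ 2 by ring.
  by set b' := s ^+ 2 * - _; lra.
have q6 : qM x x <= - ((k1 - k * Kb ^+ 2) * `|g| ^+ 2).
  move: hq q2; rewrite ler_norml => hq /andP[_ q2].
  by move: hq q2; rewrite mulrBl; set a := k * _ * _; set y := k1 * _; lra.
have q7 : 2 * qM (T h) x <= k * (s ^+ 2 * `|h| ^+ 2) + k * Kb ^+ 2 * `|g| ^+ 2.
  apply: le_trans (ler_norm _) _; apply: le_trans q3 _.
  by rewrite [X in _ + X](_ : _ = k * Kb ^+ 2 * `|g| ^+ 2)//; ring.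
apply: (@le_lt_trans _ _ (- ((k0 - 2 * k) * (s ^+ 2 * `|h| ^+ 2) +
   (k1 - 2 * k * Kb ^+ 2) * `|g| ^+ 2))).
  move: q5 q6 q7; set a1 := qM _ _; set a2 := qM _ _; set a3 := 2 * qM _ _.
  set u := s ^+ 2 * _; set w := `|g| ^+ 2.
  have -> : - ((k0 - 2 * k) * u + (k1 - 2 * k * Kb ^+ 2) * w) =
    - ((k0 - k) * u) - (k1 - k * Kb ^+ 2) * w + (k * u + k * Kb ^+ 2 * w) by ring.
  set y1 := (k0 - k) * u; set y2 := _ * w; set y3 := _ + _; lra.
rewrite oppr_lt0.
have x1 : 0 < k0 - 2 * k by rewrite subr_gt0.
have x2 : 0 < k1 - 2 * k * Kb ^+ 2 by rewrite subr_gt0.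
have y1 : 0 <= (k0 - 2 * k) * (s ^+ 2 * `|h| ^+ 2) by rewrite mulr_ge0// ltW.
have y2 : 0 <= (k1 - 2 * k * Kb ^+ 2) * `|g| ^+ 2 by rewrite mulr_ge0// ltW.
case/orP: hg => n0.
  by apply: ltr_pwDl => //; apply: mulr_gt0 => //; apply: mulr_gt0; rewrite exprn_gt0 ?normr_gt0.
by apply: ltr_wpDl => //; rewrite mulr_gt0// exprn_gt0// normr_gt0.
Qed.

End PointAnalysis.

Lemma zmod_regroup (U : zmodType) (D A PD PA Pv Pt : U) :
  D + A - (PD + PA) + Pv - (A + Pt) = D - PD - PA + (Pv - Pt).
Proof.
rewrite !opprD !addrA; congr (_ - Pt).
by rewrite (addrAC D A) (addrAC _ A (- PA)) (addrAC _ A Pv) addrK.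
Qed.

Section CurveTestArithmetic.
Context {R : realType}.

(** [g0] and [g1] are the gradients at the ends of a curve tested with the tangent field, and
    [m + b] is the derivative at an intermediate time: [m = D^2 f (T + v, T)] splits into
    [a = D^2 f (T, T)] and [b1 = D^2 f (T, v)], while [b = D f (S)] comes from the motion of the
    field. *)
Lemma tangent_test_arith (g1 g0 a b m b1 Qs C k2 k1 : R) :
  g1 - g0 = m + b -> m = a + b1 -> g0 = 0 -> `|g1| <= C -> `|b1| <= k1 ->
  `|a + b - Qs| <= k2 -> `|Qs| <= C + 2 * k2 + 2 * k1.
Proof.
move=> e1 e2 e3; rewrite e2 e3 subr0 in e1; rewrite e1.
have b10 := normr_ge0 b1; have q0 := normr_ge0 (a + b - Qs).
move=> h1 h2 h3; have k10 := le_trans b10 h2; have k20 := le_trans q0 h3.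
move: h1 h2 h3; rewrite !ler_norml.
by move=> /andP[? ?] /andP[? ?] /andP[? ?]; apply/andP; split; lra.
Qed.

Lemma constant_test_arith (g1 g0 m a b q D k1 k2 ny nh nv : R) :
  g1 - g0 = m -> m = a + b -> g0 = 0 -> `|g1| <= D * ny ->
  `|a| <= k1 * nh * ny -> `|b - q| <= k2 * nv * ny ->
  q <= (D + k1 * nh + k2 * nv) * ny.
Proof.
move=> e1 e2 e3; rewrite e2 e3 subr0 in e1; rewrite e1 !mulrDl !ler_norml.
by move=> /andP[? ?] /andP[? ?] /andP[? ?]; lra.
Qed.

End CurveTestArithmetic.

(** * The reduced setting: consequences of the expansion near [th] *)

Section ReducedSetting.
Context {R : realType} {E : completeNormedModType R}.
Variable ip : {dot E for (@idfun R)}.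
Hypothesis ip_norm : forall u : E, ip u u = `|u| ^+ 2.
Context {d : nat}.
Variables (f : R -> E -> R^o) (z : 'rV[R]_d -> E) (s : R -> R).
Variables (Q : 'rV[R]_d -> R) (th : 'rV[R]_d) (c : R).
Variables (L : clinear E (clinear E R^o)) (A0 : clinear E E).

(** The conclusion of [main_estimates] with the scale and the limit form abstracted; in this section
    the structure of [f] as a perturbation enters through it. *)
Definition expansion_near (k : R) := exists2 r : R, 0 < r &
  small_near th (fun e eta => forall w, `|w| <= r * s e ->
  [/\ forall h y, `|(D2form (f e) (z eta + w) (Dop z eta h) y : R)|
        <= k * s e * `|h| * `|y|,
      forall h, `|(D2form (f e) (z eta + w) (Dop z eta h) (Dop z eta h) : R) +
          (Dop (f e) (z eta + w) (Dop (Dop z) eta h h) : R) - s e ^+ 2 * Q h|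
        <= k * s e ^+ 2 * `|h| ^+ 2,
      forall v y, `|(D2form (f e) (z eta + w) v y : R) - form_of L v y|
        <= k * `|v| * `|y| &
      forall y, `|(Dop (f e) (z eta) y : R)| <= k * s e * `|y|]).

Hypothesis cf : forall e, Ck 4 (f e).
Hypothesis s_gt0 : forall e, 0 < e -> 0 < s e.
Hypothesis s_le1 : forall e, 0 < e -> e <= 1 -> s e <= 1.
Hypothesis est : forall k, 0 < k -> expansion_near k.
Hypothesis Cz : Ck 2 z.
Hypothesis c0 : 0 < c.
Hypothesis oframe : forall eta, orthoframe ip c (fun i => partial i z eta).
Hypothesis Lsym : forall v w, L v w = L w v.
Hypothesis A0L : forall v w, ip (A0 v) w = L v w.
Hypothesis A0tau : forall i, A0 (partial i z th) = 0.
Hypothesis nondeg : nondegenerate_on ip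
  [set v | forall i, ip v (partial i z th) = 0] (form_of L).

Local Notation tau eta := (fun i => partial i z eta).
Local Notation P eta := (frame_proj ip c (tau eta)).

Lemma Dop_frame eta h : Dop z eta h = frame_comb (tau eta) h.
Proof. by rewrite (Dop_row Cz). Qed.

Lemma tangent_frame eta v : tangent z eta v <-> exists h, v = frame_comb (tau eta) h.
Proof.
have [dz _] := Cz.
split=> [[h _ <-]|[h ->]].
  by exists h; rewrite -Dop_frame DopE.
by exists h => //; rewrite -Dop_frame DopE.
Qed.

Lemma orthocomp_frame eta v : orthocomp ip (tangent z eta) v <->
  forall i, ip v (partial i z eta) = 0.
Proof.
split=> [vo i|vo t /tangent_frame[h ->]]; last by rewrite ipC; exact: frame_comb_ortho.
apply: vo; apply/tangent_frame; exists (delta_mx 0 i).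
by rewrite -Dop_frame (partialE Cz).
Qed.

Lemma frame_proj_continuous (k : R) : 0 < k -> small_near th (fun _ eta =>
  forall v, `|P eta v - P th v| <= k * `|v|).
Proof.
move=> k0.
pose k1 := k * c / (2 * d%:R + 1).
have D0 : 0 < 2 * d%:R + 1 :> R by rewrite ltr_wpDl// mulr_ge0.
have k10 : 0 < k1 by rewrite divr_gt0// mulr_gt0.
have hi i : small_near th (fun _ eta => `|partial i z eta - partial i z th| <= k1).
  apply: (small_near_continuous_right (f := partial i z)) => //.
  have -> : partial i z = (fun eta => Dop z eta (delta_mx 0 i)).
    by apply/funext => eta; rewrite (partialE Cz).
  have [_ [ddz _]] := Cz.
  by apply: differentiable_continuous; exact: eval_differentiable.
apply: small_nearS (small_near_forall hi) => e eta _ hk v.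
apply: le_trans (frame_proj_near ip_norm c0 (oframe th) v (ltW k10) hk _) _.
  by move=> i; exact: (frame_norm ip_norm c0 (oframe eta)).
rewrite ler_wpM2r// /k1.
have -> : 2 * d%:R / c * (k * c / (2 * d%:R + 1)) =
    k * (2 * d%:R / (2 * d%:R + 1)) by field; rewrite !gt_eqF.
by rewrite ler_piMr ?(ltW k0)// ler_pdivrMr// mul1r lerDl.
Qed.

(** * The Lyapunov-Schmidt equation and the size of its solution *)

Section LyapunovSchmidt.
Variables (e k m : R) (eta : 'rV[R]_d).
Hypotheses (k_ge0 : 0 <= k) (m_ge0 : 0 <= m).
Hypothesis Hc : forall w, `|w| <= m -> forall v y,
  `|(D2form (f e) (z eta + w) v y : R) - form_of L v y| <= k * `|v| * `|y|.
Hypothesis HP : forall v, `|P eta v - P th v| <= k * `|v|.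

Let g x := grad ip (f e) (z eta + x).
(** Normal part of the gradient plus tangential part of [x]: the two lie in complementary spaces, so
    a zero solves both equations of the reduction, and the linearization is the invertible
    [A0 + P th]. *)
Definition schmidt_map x := g x - P eta (g x) + P eta x.

Lemma grad_increment x y : `|x| <= m -> `|y| <= m ->
  `|g x - g y - A0 (x - y)| <= k * `|x - y|.
Proof.
move=> xm ym; apply: (norm_le_ip ip_norm) => [|v]; first by rewrite mulr_ge0.
have [t /andP[t0 t1] Et] := Dop_mvt_form (cf e) (z eta + y) (x - y) v.
have yt : `|y + t *: (x - y)| <= m.
  have -> : y + t *: (x - y) = (1 - t) *: y + t *: x.
    by rewrite scalerBr scalerBl scale1r addrA addrAC.
  apply: le_trans (ler_normD _ _) _; rewrite !normrZ !ger0_norm ?subr_ge0//.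
  have -> : m = (1 - t) * m + t * m by ring.
  by rewrite lerD// ler_wpM2l// subr_ge0.
have := Hc yt (x - y) v; rewrite addrA => /(le_trans (ler_norm _)).
have exy : z eta + y + (x - y) = z eta + x by rewrite -addrA [y + _]addrC subrK.
rewrite exy in Et.
apply: le_trans.
have e1 : ip (g x) v = Dop (f e) (z eta + x) v := gradP ip_norm _ _ _.
have e2 : ip (g y) v = Dop (f e) (z eta + y) v := gradP ip_norm _ _ _.
have aux (a b p q u w i : R) : a = p -> b = q -> p - q = u -> i = w ->
  a - b - i <= u - w by move=> -> -> -> ->.
rewrite !ipBl.
exact: aux e1 e2 Et (A0L (x - y) v).
Qed.

Lemma frame_projB x y : P eta (x - y) = P eta x - P eta y.
Proof.
have := @frame_proj_linear _ _ ip _ c (tau eta) (-1) y x.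
by rewrite !scaleN1r => h; rewrite addrC h addrC.
Qed.

(** [P th] vanishes on the range of [A0], so [P eta] acts on [A0 v] only through [P eta - P th]. The
    four summands of the constant belong to the error [D] of the gradient increment, to [P eta D],
    and to the difference of projections at [A0 v] and at [v]. *)
Lemma schmidt_increment K x y : (forall v, K v = A0 v + P th v) ->
  `|x| <= m -> `|y| <= m ->
  `|schmidt_map x - schmidt_map y - K (x - y)| <=
    (1 + d%:R + `|A0| + 1) * k * `|x - y|.
Proof.
move=> KE xm ym; pose v := x - y; pose D := g x - g y - A0 v.
have P0 : P th (A0 v) = 0.
  by apply: frame_proj_eq0 => i; exact: (A0_range Lsym A0L A0tau).
have E1 : g x - g y = D + A0 v by rewrite /D subrK.
have -> : schmidt_map x - schmidt_map y - K v =
    D - P eta D - (P eta (A0 v) - P th (A0 v)) + (P eta v - P th v).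
  have -> : schmidt_map x - schmidt_map y =
      (g x - g y) - P eta (g x - g y) + P eta v.
    rewrite /schmidt_map opprD addrACA /v [P eta (x - y)]frame_projB.
    congr (_ + _); rewrite frame_projB opprD addrACA opprK; congr (_ + _).
    by rewrite [RHS]opprB addrC.
  have PD : P eta (D + A0 v) = P eta D + P eta (A0 v).
    have := @frame_proj_linear _ _ ip _ c (tau eta) 1 D (A0 v).
    by rewrite !scale1r.
  rewrite E1 PD KE P0 subr0.
  exact: zmod_regroup.
have bD : `|D| <= k * `|v| by exact: grad_increment.
have h1 : `|P eta D| <= d%:R * (k * `|v|).
  apply: le_trans (frame_proj_le ip_norm c0 (oframe eta) _) _.
  by rewrite ler_wpM2l.
have h2 : `|P eta (A0 v) - P th (A0 v)| <= k * (`|A0| * `|v|).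
  by apply: le_trans (HP _) _; rewrite ler_wpM2l// clinear_le.
have h3 := HP v.
have -> : (1 + d%:R + `|A0| + 1) * k * `|x - y| =
  k * `|v| + d%:R * (k * `|v|) + k * (`|A0| * `|v|) + k * `|v|.
  by rewrite /v; ring.
apply: le_trans (ler_normD _ _) _; apply: lerD => //.
apply: le_trans (ler_normB _ _) _; apply: lerD => //.
by apply: le_trans (ler_normB _ _) _; apply: lerD.
Qed.

Lemma schmidt_zero x : schmidt_map x = 0 -> reduction_solution ip f z e eta x.
Proof.
move=> x0.
have PP v : P eta (P eta v) = P eta v by exact: frame_proj_comb.
have Px : P eta x = 0.
  have : P eta (schmidt_map x) = P eta 0 by rewrite x0.
  rewrite /schmidt_map.
  have -> : P eta (g x - P eta (g x) + P eta x) = P eta x.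
    have := @frame_proj_linear _ _ ip _ c (tau eta) 1 (g x - P eta (g x)) (P eta x).
    by rewrite !scale1r frame_projB !PP subrr add0r.
  by move=> ->; apply: frame_proj_eq0 => i; rewrite ip0l.
split.
  apply/orthocomp_frame => i.
  have := frame_proj_ortho c0 (oframe eta) x i.
  by rewrite Px subr0.
apply/tangent_frame; exists (frame_coord ip c (tau eta) (g x)).
by move: x0; rewrite /schmidt_map Px addr0 => /subr0_eq.
Qed.

End LyapunovSchmidt.

Variable w : R -> 'rV[R]_d -> E.
Hypothesis Hw : is_reduction ip f z w.

(** [is_reduction] gives a fixed radius of uniqueness. Newton's iteration started at [0], where the
    residual is o(s), finds a solution in the ball of radius [m * s e], which uniqueness identifies
    with [w e eta]. *)
Lemma reduction_small (k : R) : 0 < k ->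
  small_near th (fun e eta => `|w e eta| <= k * s e).
Proof.
move=> k0.
have [rho rho0 /small_nearP nw] := Hw th.
have [K [L' [KE LK KL]]] :=
  frame_complement_inverse ip_norm c0 (oframe th) Lsym A0L A0tau nondeg.
pose M := (`|L'| + 1) * (1 + d%:R + `|A0| + 1).
have L1 : 0 < `|L'| + 1 by rewrite ltr_wpDl.
have d1 : 0 < 1 + d%:R + `|A0| + 1 by rewrite ltr_wpDl// !addr_ge0.
have M0 : 0 < M by rewrite mulr_gt0.
pose k1 := 2^-1 / M; have k10 : 0 < k1 by rewrite divr_gt0// invr_gt0.
have [r r0 n1] := est k10.
(* [m <= k] is the bound sought, [m <= r] keeps the contraction estimate available, and [m < rho]
   makes uniqueness applicable as [s e <= 1]. The constant [k2] below fits the initial residual to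
   this radius. *)
pose m := Num.min (Num.min k r) (rho / 2).
have m0 : 0 < m by rewrite !lt_min k0 r0 divr_gt0.
have mk : m <= k by rewrite !ge_min lexx.
have mr : m <= r by rewrite !ge_min lexx orbT.
have mrho : m < rho.
  apply: (@le_lt_trans _ _ (rho / 2)); first by rewrite !ge_min lexx !orbT.
  by rewrite ltr_pdivrMr// ltr_pMr// ltr1n.
pose k2 := m / 2 / M; have k20 : 0 < k2 by rewrite !divr_gt0.
have [r2 r20 n2] := est k20.
apply: small_nearS (small_nearI (small_nearI (small_near_exponent th) nw)
  (small_nearI n1 (small_nearI n2 (frame_proj_continuous k10)))).
move=> e eta e0 [[e1 [_ _ wuniq]] [h1 [h2 hP]]].
have s0 := s_gt0 e0; have s1 := s_le1 e0 e1.
have ms : 0 <= m * s e by rewrite mulr_ge0 ?ltW.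
have Hc x : `|x| <= m * s e -> forall v y,
    `|(D2form (f e) (z eta + x) v y : R) - form_of L v y| <= k1 * `|v| * `|y|.
  move=> xm; have [|_ _ + _] := h1 x; last exact.
  by apply: le_trans xm _; rewrite ler_pM2r.
have Mk : `|L'| * ((1 + d%:R + `|A0| + 1) * k1) <= 2^-1.
  have -> : 2^-1 = M * k1 by rewrite /k1 mulrC divfK// gt_eqF.
  rewrite /M -mulrA; apply: ler_wpM2r; last by rewrite lerDl.
  by rewrite mulr_ge0 ?(ltW d1) ?(ltW k10).
have P00 : P eta 0 = 0 by apply: frame_proj_eq0 => i; rewrite ip0l.
have g0 : `|grad ip (f e) (z eta + 0)| <= k2 * s e.
  apply: (norm_le_ip ip_norm) => [|y]; first by rewrite mulr_ge0 ?ltW.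
  have [|_ _ _ hd] := h2 0; first by rewrite normr0 mulr_ge0 ?ltW.
  have := le_trans (ler_norm _) (hd y); apply: le_trans.
  by rewrite le_eqVlt; apply/orP; left; apply/eqP; rewrite addr0; exact: (gradP ip_norm).
have Phi0 : `|L'| * `|schmidt_map e eta 0| <= m * s e / 2.
  rewrite /schmidt_map P00 addr0.
  set g := grad _ _ _ in g0 *.
  have hg : `|g - P eta g| <= (1 + d%:R + `|A0| + 1) * (k2 * s e).
    apply: le_trans (ler_normB _ _) _.
    have := frame_proj_le ip_norm c0 (oframe eta) g => hPg.
    apply: (@le_trans _ _ ((1 + d%:R) * `|g|)).
      by rewrite mulrDl mul1r lerD2l.
    rewrite ler_pM ?addr_ge0// -addrA lerDl addr_ge0//.
  apply: le_trans (ler_wpM2l (normr_ge0 _) hg) _.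
  have -> : m * s e / 2 = M * (k2 * s e).
    by rewrite /k2; field; rewrite gt_eqF.
  rewrite /M -mulrA; apply: ler_wpM2r; last by rewrite lerDl.
  by rewrite mulr_ge0 ?(ltW d1)// mulr_ge0 ?(ltW k20) ?(ltW s0).
have [x xm x0] := zero_near_linear LK KL ms
  (fun x y hx hy => schmidt_increment (ltW k10) Hc hP KE hx hy) Mk Phi0.
have -> : w e eta = x.
  apply/esym/wuniq; last exact: schmidt_zero.
  apply: le_lt_trans xm _; apply: le_lt_trans mrho.
  by rewrite ler_piMr// ltW.
by apply: le_trans xm _; rewrite ler_pM2r.
Qed.

Lemma inverse_lower_bound : exists2 kappa, 0 < kappa &
  forall x, kappa * `|x| <= `|A0 x + P th x|.
Proof.
have [K [L' [KE LK _]]] :=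
  frame_complement_inverse ip_norm c0 (oframe th) Lsym A0L A0tau nondeg.
have L1 : 0 < 1 + `|L'| by rewrite ltr_pwDl.
exists (1 + `|L'|)^-1; first by rewrite invr_gt0.
move=> x; rewrite ler_pdivrMl// -KE -{1}(LK x).
by apply: le_trans (clinear_le _ _) _; rewrite ler_wpM2r// lerDr.
Qed.

Definition point_estimates (k : R) (e : R) (eta : 'rV[R]_d)
    (M : clinear E (clinear E R^o)) :=
  [/\ forall h y, `|form_of M (frame_comb (tau eta) h) y| <= k * s e * `|h| * `|y|,
      forall h, `|form_of M (frame_comb (tau eta) h) (frame_comb (tau eta) h)
         - s e ^+ 2 * Q h| <= k * s e ^+ 2 * `|h| ^+ 2,
      forall v y, `|form_of M v y - form_of L v y| <= k * `|v| * `|y| &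
      forall v, `|P eta v - P th v| <= k * `|v|].

(** At a critical point the term [Dop (f e) _ (S h)] vanishes, which leaves the tangent block by
    itself. *)
Lemma critical_point_estimates (k : R) : 0 < k -> exists2 r : R, 0 < r &
  small_near th (fun e eta => s e <= 1 /\ forall w', `|w'| <= r * s e ->
    (forall y, (Dop (f e) (z eta + w') y : R) = 0) ->
    point_estimates k e eta (Dop (Dop (f e)) (z eta + w'))).
Proof.
move=> k0; have [r r0 n1] := est k0; exists r => //.
apply: small_nearS (small_nearI (small_near_exponent th)
  (small_nearI n1 (frame_proj_continuous k0))).
move=> e eta e0 [e1 [h1 hP]]; split; first exact: s_le1.
move=> w' w'r crit; have [ha hb hc _] := h1 w' w'r; split => //.
- by move=> h y; rewrite -Dop_frame; exact: ha.
- move=> h; have := hb h; rewrite -Dop_frame => /(le_trans _); apply.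
  have aux (a b q : R) : b = 0 -> `|a - q| <= `|a + b - q|.
    by move=> ->; rewrite addr0.
  exact: aux (crit _).
Qed.

Lemma frame_split eta y :
  y = frame_comb (tau eta) (frame_coord ip c (tau eta) y) + (y - P eta y).
Proof. by rewrite addrC subrK. Qed.

(** [splitting_bound] bounds the Hessian operator from below by a multiple of [s e ^+ 2]; for each
    [e] this constant is positive and symmetry gives the inverse. *)
Lemma reduced_nondegenerate (k0 : R) : 0 < k0 ->
  (forall h, k0 * `|h| ^+ 2 <= `|Q h|) ->
  exists2 r : R, 0 < r & small_near th (fun e eta => forall w', `|w'| <= r * s e ->
    (forall y, (Dop (f e) (z eta + w') y : R) = 0) ->
    nondegenerate_on ip setT (D2form (f e) (z eta + w'))).
Proof.
move=> k00 hQ; have [kappa ka0 hK] := inverse_lower_bound.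
pose k := Num.min kappa k0 / 4.
have kgt0 : 0 < k by rewrite divr_gt0// lt_min ka0.
have kka : 4 * k <= kappa by rewrite mulrC divfK// ge_min lexx.
have kk0 : 4 * k <= k0 by rewrite mulrC divfK// ge_min lexx orbT.
have [r r0 n1] := critical_point_estimates kgt0; exists r => //.
apply: small_nearS n1 => e eta e0 [s1 h1] w' w'r crit.
have [ha hb hc hP] := h1 w' w'r crit.
set u := z eta + w'; set M := Dop (Dop (f e)) u in ha hb hc.
have s0 := s_gt0 e0.
have C2 : Ck 2 (f e).
  have [? [? [? _]]] := cf e; split=> //; split=> // x.
  exact: differentiable_continuous.
have Msym v y : M v y = M y v by exact: (D2_sym u v y C2).
pose A := hess ip (f e) u.
have AM v y : ip (A v) y = form_of M v y by exact: (hessP ip_norm (f e) u v y).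
pose C := (3 / k0 + 4 / kappa) * (1 + d%:R * c).
have Z1 : 0 < 1 + d%:R * c by rewrite ltr_pwDl// mulr_ge0// ltW.
have Cgt0 : 0 < C by rewrite mulr_gt0// addr_gt0// divr_gt0.
have below y : s e ^+ 2 / (C * (1 + d%:R * c)) * `|y| <= `|A y|.
  pose h := frame_coord ip c (tau eta) y; pose v := y - P eta y.
  have yE : y = frame_comb (tau eta) h + v by exact: frame_split.
  have hD x : `|form_of M (frame_comb (tau eta) h + v) x| <= `|A y| * `|x|.
    by rewrite -yE -AM (cauchy_schwarz ip_norm).
  have := splitting_bound ip_norm c0 (oframe eta) A0L Msym (ltW kgt0) s0 s1
    ha hb hc hP ka0 k00 kka kk0 (normr_ge0 (A y)) hK hQ hD
    (frame_proj_ortho c0 (oframe eta) y).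
  rewrite -/C => sb.
  have yn : `|y| <= (1 + d%:R * c) * (`|h| + `|v|).
    rewrite {1}yE; apply: le_trans (ler_normD _ _) _; rewrite mulrDr.
    apply: lerD.
      apply: le_trans (frame_comb_le ip_norm c0 (oframe eta) h) _.
      by rewrite ler_wpM2r// lerDr.
    by rewrite ler_peMl// lerDl mulr_ge0// ltW.
  rewrite mulrAC ler_pdivrMr; last by rewrite mulr_gt0.
  have s20 : 0 <= s e ^+ 2 by rewrite exprn_ge0// ltW.
  apply: le_trans (ler_wpM2l s20 yn) _.
  have -> : `|A y| * (C * (1 + d%:R * c)) = (1 + d%:R * c) * (C * `|A y|) by ring.
  by rewrite mulrCA ler_pM2l.
have [||B AB] := symmetric_bounded_below_inverse ip_norm _ _ below.
- by rewrite divr_gt0 ?exprn_gt0// mulr_gt0.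
- by move=> x y; rewrite AM (form_sym Msym) -AM ipC.
by exists A, B; split=> // v y _ _; exact: AM.
Qed.

(** A subspace of dimension above [m] meets the common kernel of [m] functionals in a nonzero
    vector, where the form would be both positive and negative. *)
Lemma negdef_dim_le (M : clinear E (clinear E R^o)) m n
    (phi : 'I_m -> E -> R) :
  (forall j n (g : 'I_n -> R) (b : 'I_n -> E),
     phi j (\sum_i g i *: b i) = \sum_i g i * phi j (b i)) ->
  (forall y, (forall j, phi j y = 0) -> y != 0 -> 0 < form_of M y y) ->
  negdef_subspace_dim setT (form_of M) n -> (n <= m)%N.
Proof.
move=> phil phipos [b [_ bfree bneg]]; rewrite leqNgt; apply/negP => mn.
have [g [i gi] g0] := functionals_common_kernel mn (fun j g => phil j n g b).
set y := \sum_i _ in g0.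
have yn : y != 0 by apply: contra_neq gi => /bfree; exact.
by have := lt_trans (phipos y g0 yn) (bneg g yn); rewrite ltxx.
Qed.

Lemma proj_functional_sum eta v n (g : 'I_n -> R) (b : 'I_n -> E) :
  form_of L v (\sum_i g i *: b i - P eta (\sum_i g i *: b i)) =
  \sum_i g i * form_of L v (b i - P eta (b i)).
Proof.
have PS : P eta (\sum_i g i *: b i) = \sum_i g i *: P eta (b i).
  have [Pc PcE] := frame_proj_clinear ip_norm c0 (oframe eta).
  rewrite -PcE linear_sum/=; apply: eq_bigr => i _.
  by rewrite linearZ/= PcE.
rewrite PS -sumrB (form_sumr Lsym); apply: eq_bigr => i _.
by rewrite -scalerBr formZr.
Qed.

(** * The Morse index for positive and for negative definite limit forms *)

Section MorseIndex.
Variables (m0 : nat) (k0 : R).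
Hypothesis k00 : 0 < k0.
Hypothesis morse0 :
  morse_index [set v | forall i, ip v (partial i z th) = 0] (form_of L) m0.

(** One tolerance for both [positive_on_complement] and [negative_on_span]. *)
Lemma morse_constant (k1 k2 Kb : R) : 0 < k1 -> 0 < k2 -> exists2 k, 0 < k &
  [/\ 2 * k < k0, 8 * k < k2, k <= 2^-1 & 2 * k * Kb ^+ 2 < k1].
Proof.
move=> k10 k20; pose D := 2 * Kb ^+ 2 + 1.
have D0 : 0 < D by rewrite ltr_wpDl// mulr_ge0// sqr_ge0.
pose k := Num.min (Num.min (k0 / 4) (k2 / 16)) (Num.min 2^-1 (k1 / 2 / D)).
have kgt0 : 0 < k.
  rewrite !lt_min -!andbA; apply/and4P; split; rewrite ?invr_gt0//.
  - exact: divr_gt0.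
  - exact: divr_gt0.
  - by rewrite !divr_gt0.
exists k => //; split.
- have : k <= k0 / 4 by rewrite !ge_min lexx.
  by have := k00; lra.
- have : k <= k2 / 16 by rewrite !ge_min lexx orbT.
  by have := k20; lra.
- by rewrite !ge_min lexx !orbT.
- have kD : k * D <= k1 / 2 by rewrite -ler_pdivlMr// !ge_min lexx !orbT.
  have : k * D = 2 * k * Kb ^+ 2 + k by rewrite /D; ring.
  by move: kD k10 kgt0; set a := 2 * k * _; lra.
Qed.

(** The span of the [b i] remains negative, so the index is at least [m0]. Conversely, the [m0]
    conditions that the normal part of a vector be orthogonal to the [b j] for [L] leave a space
    where the perturbed form is positive, tangential directions included. *)
Lemma reduced_morse_pos : (forall h, k0 * `|h| ^+ 2 <= Q h) ->
  exists2 r : R, 0 < r & small_near th (fun e eta => forall w', `|w'| <= r * s e ->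
    (forall y, (Dop (f e) (z eta + w') y : R) = 0) ->
    morse_index setT (D2form (f e) (z eta + w')) m0).
Proof.
move=> hQ; have [neg0 max0] := morse0.
have [b [k1 k10 [Vb bneg]]] := negdef_span_coercive Lsym neg0.
have [Kb Kb0 bK] := row_comb_bound b.
have [k2 k20 hk2] := frame_complement_coercive ip_norm c0 (oframe th) Lsym A0L
  A0tau nondeg Vb k10 bneg max0.
have [k kgt0 [kk0 kk2 k12 kk1]] := morse_constant Kb k10 k20.
have [r r0 n1] := critical_point_estimates kgt0; exists r => //.
apply: small_nearS n1 => e eta e0 [s1 h1] w' w'r crit.
have [ha hb hc hP] := h1 w' w'r crit.
set u := z eta + w'; set M := Dop (Dop (f e)) u in ha hb hc.
have s0 := s_gt0 e0.
have C2 : Ck 2 (f e).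
  have [? [? [? _]]] := cf e; split=> //; split=> // x.
  exact: differentiable_continuous.
have Msym v y : M v y = M y v by exact: (D2_sym u v y C2).
rewrite -[D2form (f e) u]/(form_of M); split=> [|n].
  apply: (negdef_family Msym (b := b)) => // g gn.
  have := negative_on_span (h := 0) Msym (ltW kgt0) s0 ha hb hc kk0 kk1 Kb0
    (or_introl (erefl _)) (bneg g) (bK g).
  rewrite gn orbT => /(_ isT).
  have -> : frame_comb (tau eta) 0 = 0.
    by rewrite /frame_comb big1// => i _; rewrite mxE scale0r.
  by rewrite add0r.
apply: (@negdef_dim_le M m0 n (fun j y => form_of L (b j) (y - P eta y))).
  by move=> j n' g b'; exact: proj_functional_sum.
move=> y y0 yn; rewrite (frame_split eta y).
apply: (positive_on_complement Msym (ltW kgt0) s0 ha hb hc hP kk0 kk2 k12).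
- by right; exact: hQ.
- exact: (frame_proj_ortho c0 (oframe eta)).
- by apply: hk2 => i; exact: y0.
- apply: contraR yn; rewrite negb_or !negbK => /andP[/eqP h0 /eqP v0].
  by rewrite (frame_split eta y) h0 v0 addr0 /frame_comb big1// => i _; rewrite mxE scale0r.
Qed.

(** The frame at [eta] joins the [b i] as negative directions. For the upper bound [d] further
    functionals read off the tangential coordinates, so that [h = 0] on their common kernel. *)
Lemma reduced_morse_neg : (forall h, Q h <= - (k0 * `|h| ^+ 2)) ->
  exists2 r : R, 0 < r & small_near th (fun e eta => forall w', `|w'| <= r * s e ->
    (forall y, (Dop (f e) (z eta + w') y : R) = 0) ->
    morse_index setT (D2form (f e) (z eta + w')) (m0 + d)%N).
Proof.
move=> hQ; have [neg0 max0] := morse0.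
have [b [k1 k10 [Vb bneg]]] := negdef_span_coercive Lsym neg0.
have [Kb Kb0 bK] := row_comb_bound b.
have [k2 k20 hk2] := frame_complement_coercive ip_norm c0 (oframe th) Lsym A0L
  A0tau nondeg Vb k10 bneg max0.
have [k kgt0 [kk0 kk2 k12 kk1]] := morse_constant Kb k10 k20.
have [r r0 n1] := critical_point_estimates kgt0; exists r => //.
apply: small_nearS n1 => e eta e0 [s1 h1] w' w'r crit.
have [ha hb hc hP] := h1 w' w'r crit.
set u := z eta + w'; set M := Dop (Dop (f e)) u in ha hb hc.
have s0 := s_gt0 e0.
have C2 : Ck 2 (f e).
  have [? [? [? _]]] := cf e; split=> //; split=> // x.
  exact: differentiable_continuous.
have Msym v y : M v y = M y v by exact: (D2_sym u v y C2).
have er (i : 'I_d) : fintype.split (rshift m0 i) = inr i := unsplitK (inr i).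
have el (i : 'I_m0) : fintype.split (lshift d i) = inl i := unsplitK (inl i).
rewrite -[D2form (f e) u]/(form_of M); split=> [|n].
  pose b' (i : 'I_(m0 + d)%N) := match fintype.split i with
    | inl j => b j | inr j => partial j z eta end.
  apply: (negdef_family Msym (b := b')) => // g gn.
  have -> : \sum_i g 0 i *: b' i = frame_comb (tau eta) (rsubmx g) +
      \sum_i (lsubmx g) 0 i *: b i.
    rewrite big_split_ord addrC; congr (_ + _); apply: eq_bigr => i _.
      by rewrite /b' ?er ?el mxE.
    by rewrite /b' ?er ?el mxE.
  apply: (negative_on_span Msym (ltW kgt0) s0 ha hb hc kk0 kk1 Kb0).
  - by right; exact: hQ.
  - exact: bneg.
  - exact: bK.
  - apply: contraR gn; rewrite negb_or !negbK => /andP[/eqP g0 /eqP g1].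
    by rewrite -[g]hsubmxK g0 g1 row_mx0.
pose phi (i : 'I_(m0 + d)%N) y := match fintype.split i with
  | inl j => form_of L (b j) (y - P eta y)
  | inr j => ip y (partial j z eta) end.
apply: (@negdef_dim_le M (m0 + d)%N n phi).
  move=> j n' g b'; rewrite /phi; case: (fintype.split j) => j'.
    exact: proj_functional_sum.
  by rewrite ip_suml; apply: eq_bigr => i _; rewrite ipZl.
move=> y y0 yn; rewrite (frame_split eta y).
have h0 : frame_coord ip c (tau eta) y = 0.
  apply/rowP => j; rewrite !mxE.
  by have := y0 (rshift m0 j); rewrite /phi er => ->; rewrite mulr0.
apply: (positive_on_complement Msym (ltW kgt0) s0 ha hb hc hP kk0 kk2 k12).
- by left.
- exact: (frame_proj_ortho c0 (oframe eta)).
- apply: hk2 => i; have := y0 (lshift d i).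
  by rewrite /phi el.
- apply: contraR yn; rewrite negb_or !negbK => /andP[_ /eqP v0].
  by rewrite (frame_split eta y) h0 v0 addr0 /frame_comb big1// => i _; rewrite mxE scale0r.
Qed.

End MorseIndex.

(** * Comparison of two points and continuity of the critical curve *)

Lemma second_derivative_bound : exists2 Z : R, 0 <= Z &
  small_near th (fun _ eta => `|Dop (Dop z) eta| <= Z).
Proof.
have [_ [_ c2]] := Cz.
exists (1 + `|Dop (Dop z) th|); first by rewrite addr_ge0.
apply: small_nearS (small_near_continuous_right (c2 th) ltr01).
by move=> e eta _; exact: norm_le_near.
Qed.

Lemma segmentE (V : lmodType R) (x0 x1 : V) (t : R) :
  x0 + t *: (x1 - x0) = (1 - t) *: x0 + t *: x1.
Proof. by rewrite scalerBr scalerBl scale1r addrA addrAC. Qed.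

Lemma segment_ball (V : normedModType R) (x0 x1 p : V) (t r : R) :
  0 <= t <= 1 -> `|x0 - p| < r -> `|x1 - p| < r ->
  `|x0 + t *: (x1 - x0) - p| < r.
Proof.
move=> /andP[t0 t1] h0 h1.
have -> : x0 + t *: (x1 - x0) - p = (1 - t) *: (x0 - p) + t *: (x1 - p).
  by rewrite -segmentE opprB addrA subrK addrAC.
apply: le_lt_trans (ler_normD _ _) _; rewrite !normrZ !ger0_norm ?subr_ge0//.
have -> : r = (1 - t) * r + t * r by ring.
have [->|tn] := eqVneq t 0; first by rewrite subr0 !mul1r !mul0r !addr0.
apply: ler_ltD; first by rewrite ler_wpM2l ?subr_ge0// ltW.
by rewrite ltr_pM2l// lt_def tn.
Qed.

Lemma segment_norm_le (V : normedModType R) (x0 x1 : V) (t r : R) :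
  0 <= t <= 1 -> `|x0| <= r -> `|x1| <= r -> `|x0 + t *: (x1 - x0)| <= r.
Proof.
move=> /andP[t0 t1] h0 h1; rewrite segmentE.
apply: le_trans (ler_normD _ _) _; rewrite !normrZ !ger0_norm ?subr_ge0//.
have -> : r = (1 - t) * r + t * r by ring.
by rewrite lerD// ler_wpM2l// subr_ge0.
Qed.

Lemma delta_mx_norm_le (i : 'I_d) : `|delta_mx 0 i : 'rV[R]_d| <= 1.
Proof.
apply: row_norm_le => // j; rewrite mxE /=; case: eqP => _.
  by rewrite normr1.
by rewrite normr0.
Qed.

(* A vector orthogonal to the frame at [eta1] is almost orthogonal to the frame
   at [eta0]. *)
Lemma frame_proj_variation (Z : R) eta0 eta1 w1 : 0 <= Z ->
  (forall t : R, 0 <= t <= 1 ->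
     `|Dop (Dop z) (eta0 + t *: (eta1 - eta0))| <= Z) ->
  (forall i, ip w1 (partial i z eta1) = 0) ->
  `|P eta0 w1| <= d%:R / c * Z * `|w1| * `|eta1 - eta0|.
Proof.
move=> Z0 hZ w1o; set h := eta1 - eta0.
have [dz [ddz _]] := Cz; have [I IE] := ip_clinear ip_norm.
have hi i : `|ip w1 (partial i z eta0)| <= Z * `|w1| * `|h|.
  pose g (t : R) : R := I w1 (Dop z (eta0 + t *: h) (delta_mx 0 i)).
  have gd t : is_derive t (1 : R) g
      (I w1 (Dop (Dop z) (eta0 + t *: h) h (delta_mx 0 i))).
    have d1 : is_derive t 1 (fun q : R => Dop z (eta0 + q *: h) (delta_mx 0 i))
        (Dop (Dop z) (eta0 + t *: h) h (delta_mx 0 i)).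
      apply: is_derive_eq.
        apply: (curve_comp (f := fun x => Dop z x (delta_mx 0 i))).
          exact: eval_differentiable.
        exact: line_derive.
      exact: Dop_eval.
    apply: is_derive_eq; first exact: (curve_comp (clinear_differentiable (I w1) _) d1).
    by rewrite Dop_clinear.
  have [t t01 Eg] := mvt01 gd.
  have g1 : g 1 = 0.
    by rewrite /g scale1r /h addrC subrK IE -(partialE Cz) w1o.
  have g0 : g 0 = ip w1 (partial i z eta0).
    by rewrite /g scale0r addr0 IE (partialE Cz).
  rewrite -g0 (_ : g 0 = - (g 1 - g 0)); last by rewrite g1 sub0r opprK.
  rewrite normrN Eg IE; apply: le_trans (cauchy_schwarz ip_norm _ _) _.
  have -> : Z * `|w1| * `|h| = `|w1| * (Z * `|h| * 1) by ring.
  rewrite ler_wpM2l//; apply: le_trans (clinear2_le _ _ _) _.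
  apply: ler_pM => //; first by rewrite ler_wpM2r// hZ.
  exact: delta_mx_norm_le.
apply: le_trans (frame_comb_le ip_norm c0 (oframe eta0) _) _.
have -> : d%:R / c * Z * `|w1| * `|h| = d%:R * c * (c ^- 2 * (Z * `|w1| * `|h|)).
  by field; rewrite gt_eqF.
rewrite ler_wpM2l ?mulr_ge0 ?(ltW c0)//.
apply: row_norm_le => [|i]; first by rewrite !mulr_ge0// invr_ge0 exprn_ge0// ltW.
rewrite mxE normrM ger0_norm ?invr_ge0 ?exprn_ge0 ?(ltW c0)//.
by rewrite ler_wpM2l// invr_ge0 exprn_ge0// ltW.
Qed.

(** The points are joined by the curve that is affine in [eta] and in [w]. Testing the gradient with
    the tangent field along this curve, rather than with a fixed vector, makes its derivative
    contain exactly the sum [D^2 f (T, T) + D f (S)] that [est] controls at points that need not be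
    critical. *)
Lemma critical_lipschitz (k0 : R) : 0 < k0 ->
  (forall h, k0 * `|h| ^+ 2 <= `|Q h|) ->
  exists2 rho : R, 0 < rho & exists C : R,
  forall e eta0 eta1 w0 w1 (D : R), 0 < e -> e < rho ->
    `|eta0 - th| < rho -> `|eta1 - th| < rho ->
    `|w0| <= rho * s e -> `|w1| <= rho * s e ->
    (forall i, ip w0 (partial i z eta0) = 0) ->
    (forall i, ip w1 (partial i z eta1) = 0) ->
    (forall y, (Dop (f e) (z eta0 + w0) y : R) = 0) ->
    0 <= D -> (forall y, `|(Dop (f e) (z eta1 + w1) y : R)| <= D * `|y|) ->
    s e ^+ 2 * (`|eta1 - eta0| + `|w1 - w0|) <= C * D.
Proof.
move=> k00 hQ; have [kappa ka0 hK] := inverse_lower_bound.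
(* The mixed error occurs twice, in the gradient increment and in the projection of [v], so
   [splitting_arith] is applied with [2 * k]. *)
pose k := Num.min kappa k0 / 8.
have kgt0 : 0 < k by rewrite divr_gt0// lt_min ka0.
have kka : 4 * (2 * k) <= kappa.
  by rewrite mulrA mulrC -natrM divfK// ge_min lexx.
have kk0 : 4 * (2 * k) <= k0.
  by rewrite mulrA mulrC -natrM divfK// ge_min lexx orbT.
have [r r0 [r1 r10 n1]] := est kgt0.
have [r2 r20 n2] := frame_proj_continuous kgt0.
have [Z Z0 [r3 r30 n3]] := second_derivative_bound.
pose B := d%:R / c * Z + 1.
have B0 : 0 < B by rewrite ltr_pwDr// !mulr_ge0// invr_ge0 ltW.
pose rho := Num.min (Num.min (Num.min r r1) (Num.min r2 r3)) (Num.min 1 (k / B)).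
have rho0 : 0 < rho by rewrite !lt_min r0 r10 r20 r30 ltr01 divr_gt0.
have rhor : rho <= r by rewrite !ge_min lexx.
have rhor1 : rho <= r1 by rewrite !ge_min lexx !orbT.
have rhor2 : rho <= r2 by rewrite !ge_min lexx !orbT.
have rhor3 : rho <= r3 by rewrite !ge_min lexx !orbT.
have rho1 : rho <= 1 by rewrite !ge_min lexx !orbT.
have rhoB : rho * B <= k by rewrite -ler_pdivlMr// !ge_min lexx !orbT.
exists rho => //; exists ((3 / k0 + 4 / kappa) * (1 + d%:R * c)).
move=> e eta0 eta1 w0 w1 D e0 er he0 he1 hw0 hw1 wo0 wo1 crit D0 hD.
have s0 := s_gt0 e0.
have s1 : s e <= 1 by apply: s_le1 => //; exact: ltW (lt_le_trans er rho1).
set h := eta1 - eta0; set v := w1 - w0.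
pose cc (t : R) := eta0 + t *: h; pose wt (t : R) := w0 + t *: v.
pose gam (t : R) := z (cc t) + wt t.
have [dz [ddz _]] := Cz; have [df [ddf _]] := cf e.
have C2 : Ck 2 (f e).
  have [? [? [? _]]] := cf e; split=> //; split=> // x.
  exact: differentiable_continuous.
have Et t : 0 <= t <= 1 ->
  [/\ forall h y, `|(D2form (f e) (gam t) (Dop z (cc t) h) y : R)|
        <= k * s e * `|h| * `|y|,
      forall h, `|(D2form (f e) (gam t) (Dop z (cc t) h) (Dop z (cc t) h) : R) +
          (Dop (f e) (gam t) (Dop (Dop z) (cc t) h h) : R) - s e ^+ 2 * Q h|
        <= k * s e ^+ 2 * `|h| ^+ 2,
      forall v y, `|(D2form (f e) (gam t) v y : R) - form_of L v y|
        <= k * `|v| * `|y| &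
      forall y, `|(Dop (f e) (z (cc t)) y : R)| <= k * s e * `|y|].
  move=> t01; apply: (n1 e (cc t) e0 (lt_le_trans er rhor1)).
    by apply: lt_le_trans rhor1; exact: segment_ball.
  apply: segment_norm_le => //.
    by apply: le_trans hw0 _; rewrite ler_pM2r.
  by apply: le_trans hw1 _; rewrite ler_pM2r.
have dcc t : is_derive t (1 : R) cc h by exact: line_derive.
have dgam t : is_derive t (1 : R) gam (Dop z (cc t) h + v).
  have d1 : is_derive t 1 (fun q : R => z (cc q)) (Dop z (cc t) h).
    exact: (curve_comp (dz _) (dcc t)).
  have d2 : is_derive t (1 : R) wt v by exact: line_derive.
  exact: (is_deriveD (f := fun q : R => z (cc q)) (g := wt)).
have dDf t : is_derive t (1 : R) (fun q : R => Dop (f e) (gam q))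
    (Dop (Dop (f e)) (gam t) (Dop z (cc t) h + v)).
  exact: (curve_comp (ddf _) (dgam t)).
have dT t : is_derive t (1 : R) (fun q : R => Dop z (cc q) h)
    (Dop (Dop z) (cc t) h h).
  apply: is_derive_eq.
    exact: (curve_comp (eval_differentiable h (ddz _)) (dcc t)).
  exact: Dop_eval.
have gam0 : gam 0 = z eta0 + w0 by rewrite /gam /cc /wt !scale0r !addr0.
have gam1 : gam 1 = z eta1 + w1.
  by rewrite /gam /cc /wt !scale1r /h /v ![_ + (_ - _)]addrC !subrK.
have cc1 : cc 1 = eta1 by rewrite /cc scale1r /h addrC subrK.
have Msym t x y : D2form (f e) (gam t) x y = D2form (f e) (gam t) y x.
  exact: (D2_sym (gam t) x y C2).
(* testing the gradient increment with the tangent field along the curve *)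
have hN : s e ^+ 2 * (k0 * `|h| ^+ 2) <= D * (1 + d%:R * c) * `|h| +
    2 * k * s e ^+ 2 * `|h| ^+ 2 + 2 * k * s e * `|h| * `|v|.
  have gd t := curve_apply (dDf t) (dT t).
  have [t t01 Eg] := mvt01 gd.
  have [ha hb _ _] := Et t t01.
  have E1 : form_of (Dop (Dop (f e)) (gam t)) (Dop z (cc t) h + v) (Dop z (cc t) h) =
      D2form (f e) (gam t) (Dop z (cc t) h) (Dop z (cc t) h) +
      D2form (f e) (gam t) (Dop z (cc t) h) v.
    rewrite (formDl (Msym t)); congr (_ + _); exact: Msym.
  have G0 : (Dop (f e) (gam 0) (Dop z (cc 0) h) : R) = 0 by rewrite gam0; exact: crit.
  have G1 : `|(Dop (f e) (gam 1) (Dop z (cc 1) h) : R)| <= D * (1 + d%:R * c) * `|h|.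
    rewrite gam1; apply: le_trans (hD _) _; rewrite -mulrA ler_wpM2l//.
    rewrite Dop_frame; apply: le_trans (frame_comb_le ip_norm c0 (oframe _) h) _.
    by rewrite ler_wpM2r// lerDr.
  apply: (@le_trans _ _ (s e ^+ 2 * `|Q h|)).
    by rewrite ler_wpM2l// exprn_ge0// ltW.
  have -> : s e ^+ 2 * `|Q h| = `|s e ^+ 2 * Q h|.
    by rewrite normrM (ger0_norm (sqr_ge0 (s e))).
  apply: le_trans (tangent_test_arith Eg E1 G0 G1 (ha h v) (hb h)) _.
  by rewrite !mulrA.
(* testing it with constant vectors *)
have hV : kappa * `|v| <= 2 * (2 * k) * `|v| + D + 2 * k * s e * `|h|.
  have hA0 : `|A0 v| <= D + k * s e * `|h| + k * `|v|.
    apply: (norm_le_ip ip_norm) => [|y].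
      have ks0 : 0 <= k * s e := mulr_ge0 (ltW kgt0) (ltW s0).
      by apply: addr_ge0; [apply: addr_ge0 => //|]; apply: mulr_ge0 => //; exact: ltW.
    have gd t : is_derive t (1 : R) (fun q : R => Dop (f e) (gam q) y)
        (Dop (Dop (f e)) (gam t) (Dop z (cc t) h + v) y).
      apply: is_derive_eq.
        exact: (curve_comp (eval_differentiable y (ddf _)) (dgam t)).
      exact: Dop_eval.
    have [t t01 Eg] := mvt01 gd.
    have [ha _ hc _] := Et t t01.
    have E1 : form_of (Dop (Dop (f e)) (gam t)) (Dop z (cc t) h + v) y =
      D2form (f e) (gam t) (Dop z (cc t) h) y + D2form (f e) (gam t) v y.
      exact: (formDl (Msym t)).
    have G0 : (Dop (f e) (gam 0) y : R) = 0 by rewrite gam0; exact: crit.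
    have G1 : `|(Dop (f e) (gam 1) y : R)| <= D * `|y| by rewrite gam1; exact: hD.
    rewrite A0L -[X in X <= _]/(form_of L v y).
    exact: constant_test_arith Eg E1 G0 G1 (ha h y) (hc v y).
  (* [v] is not normal at [eta0]: [w0] is, but [w1] is normal at [eta1]. The projection of [w1] is
     of order [|w1| |h|], thus at most [k * s e * |h|] by the choice of [B] and [rho]. *)
  have hP : `|P th v| <= k * `|v| + k * s e * `|h|.
    have hPv : `|P eta0 v - P th v| <= k * `|v|.
      apply: (n2 e eta0 e0 (lt_le_trans er rhor2)).
      exact: lt_le_trans he0 rhor2.
    have Pv : P eta0 v = P eta0 w1.
      by rewrite /v frame_projB (frame_proj_eq0 c wo0) subr0.
    have hPw : `|P eta0 w1| <= k * s e * `|h|.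
      apply: le_trans (frame_proj_variation Z0 _ wo1) _.
        move=> t t01; apply: (n3 e _ e0 (lt_le_trans er rhor3)).
        by apply: lt_le_trans rhor3; exact: segment_ball.
      rewrite ler_wpM2r//.
      apply: (@le_trans _ _ (d%:R / c * Z * (rho * s e))).
        by rewrite ler_wpM2l// !mulr_ge0// invr_ge0 ltW.
      rewrite mulrA ler_pM2r//; apply: le_trans rhoB.
      by rewrite mulrC ler_pM2l// lerDl.
    have -> : P th v = P eta0 v - (P eta0 v - P th v) by rewrite opprB addrC subrK.
    apply: le_trans (ler_normB _ _) _; rewrite addrC; apply: lerD => //.
    by rewrite Pv.
  apply: le_trans (hK v) _; apply: le_trans (ler_normD _ _) _.
  apply: le_trans (lerD hA0 hP) _.
  set a := k * `|v|; have -> : 2 * (2 * k) * `|v| = 4 * a by rewrite /a; ring.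
  set b := k * s e * `|h|.
  have -> : 2 * k * s e * `|h| = 2 * b by rewrite /b; ring.
  have : 0 <= a by rewrite mulr_ge0// ltW.
  lra.
by apply: (splitting_arith (k := 2 * k)) => //; [rewrite mulr_ge0// ltW|rewrite lerDl mulr_ge0// ltW].
Qed.

(** [critical_lipschitz] is applied at the parameter [e] to the critical point [u_ e] and to
    [u_ e1], whose gradient for [f e] tends to zero as [e] tends to [e1]. The factor [s e ^+ 2] does
    no harm, since it stays away from zero near a fixed [e1 > 0]. *)
Lemma critical_curve_continuous (k0 : R) (th_ : R -> 'rV[R]_d) (u_ : R -> E) :
  0 < k0 -> (forall h, k0 * `|h| ^+ 2 <= `|Q h|) ->
  (forall e, 0 < e -> {for e, continuous s}) ->
  (forall u e, 0 < e -> {for e, continuous (fun e => grad ip (f e) u)}) ->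
  th_ e @[e --> 0^'+] --> th ->
  (\forall e \near 0^'+, u_ e = z (th_ e) + w e (th_ e) /\
     forall y, (Dop (f e) (u_ e) y : R) = 0) ->
  exists2 e0 : R, 0 < e0 & {in `]0, e0[, continuous u_}.
Proof.
move=> k00 hQ sc gc thc hu.
have [rho rho0 [C hC]] := critical_lipschitz k00 hQ.
(* Half of [rho], because [w e1 (th_ e1)] must be admissible at the parameter [e] as well, where
   [s e1 / 2 <= s e]. *)
have rho20 : 0 < rho / 2 by rewrite divr_gt0.
have [rho' rho'0 /small_nearP nw] := Hw th.
have n1 := small_near_along (small_nearI (reduction_small rho20) nw) thc.
have n2 : \forall e \near 0^'+, `|th_ e - th| < rho.
  by move/cvgrPdist_lt: thc => /(_ _ rho0); apply: filterS => e; rewrite distrC.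
have n3 : \forall e \near 0^'+, (`|w e (th_ e)| <= rho / 2 * s e /\
    [/\ `|w e (th_ e)| < rho', reduction_solution ip f z e (th_ e) (w e (th_ e)) &
      forall x, `|x| < rho' -> reduction_solution ip f z e (th_ e) x ->
        x = w e (th_ e)]) /\ `|th_ e - th| < rho /\
    u_ e = z (th_ e) + w e (th_ e) /\ forall y, (Dop (f e) (u_ e) y : R) = 0.
  exact: filterI n1 (filterI n2 hu).
move: n3 => /nbhs_normP[e0' /= e0'0 he0].
pose e0 := Num.min e0' rho.
have e00 : 0 < e0 by rewrite lt_min e0'0.
have fact e : 0 < e -> e < e0 ->
    [/\ `|w e (th_ e)| <= rho / 2 * s e,
        forall i, ip (w e (th_ e)) (partial i z (th_ e)) = 0,
        `|th_ e - th| < rho, u_ e = z (th_ e) + w e (th_ e) &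
        forall y, (Dop (f e) (u_ e) y : R) = 0].
  move=> e_gt0; rewrite lt_min => /andP[ee0 _].
  have [|//|[h1 [_ [h2 _] _]] [h3 [h4 h5]]] := he0 e.
    by rewrite /= sub0r normrN gtr0_norm.
  by split=> //; apply/orthocomp_frame.
exists e0 => // e1; rewrite in_itv /= => /andP[e1_gt0 e1e0].
have [w1s w1o th1 u1E crit1] := fact e1 e1_gt0 e1e0.
have s1 := s_gt0 e1_gt0.
have s21 : 0 < s e1 ^+ 2 by rewrite exprn_gt0.
have K0 : 0 < 4 * (`|C| + 1) / s e1 ^+ 2.
  by rewrite divr_gt0// mulr_gt0// ltr_wpDl.
have g1 : grad ip (f e1) (u_ e1) = 0.
  apply: (ip_eq ip_norm) => y; rewrite ip0l.
  exact: etrans (gradP ip_norm (f e1) (u_ e1) y) (crit1 y).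
have near_e1 : \forall e \near e1, 0 < e /\ e < e0.
  near=> e; split.
    by near: e; exact: lt_nbhsr.
  by near: e; exact: lt_nbhsl.
have close (eps : R) : 0 < eps -> \forall e \near e1,
    `|th_ e1 - th_ e| + `|w e1 (th_ e1) - w e (th_ e)| <= eps.
  move=> eps0.
  have sn : \forall e \near e1, s e1 / 2 <= s e.
    have /cvgrPdist_le /(_ (s e1 / 2)) := sc e1 e1_gt0.
    have s12 : 0 < s e1 / 2 by rewrite divr_gt0.
    move=> /(_ s12); apply: filterS => e; rewrite ler_norml => /andP[_].
    by set a := s e1; set b := s e; lra.
  have Dn : \forall e \near e1,
      `|grad ip (f e) (u_ e1)| <= eps / (4 * (`|C| + 1) / s e1 ^+ 2).
    have /cvgrPdist_le := gc (u_ e1) e1 e1_gt0.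
    have e'0 : 0 < eps / (4 * (`|C| + 1) / s e1 ^+ 2) by rewrite divr_gt0.
    move=> /(_ _ e'0); apply: filterS => e.
    by rewrite g1 sub0r normrN.
  apply: filterS3 near_e1 sn Dn => e [e_gt0 ee0] se De.
  have [ws wo the uE crit] := fact e e_gt0 ee0.
  have se0 := s_gt0 e_gt0.
  have erho : e < rho by apply: lt_le_trans ee0 _; rewrite ge_min lexx orbT.
  have w0s : `|w e (th_ e)| <= rho * s e.
    by apply: le_trans ws _; rewrite ler_pM2r//; move: rho0; lra.
  have w1s' : `|w e1 (th_ e1)| <= rho * s e.
    apply: le_trans w1s _; rewrite -mulrA ler_pM2l// mulrC.
    exact: se.
  have hD y : `|(Dop (f e) (z (th_ e1) + w e1 (th_ e1)) y : R)| <=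
      `|grad ip (f e) (u_ e1)| * `|y|.
    rewrite -u1E.
    apply: norm_eq_le (esym (gradP ip_norm (f e) (u_ e1) y)) _.
    exact: (cauchy_schwarz ip_norm).
  have crit' y : (Dop (f e) (z (th_ e) + w e (th_ e)) y : R) = 0.
    by rewrite -uE; exact: crit.
  have := hC e _ _ _ _ _ e_gt0 erho the th1 w0s w1s' wo w1o crit' (normr_ge0 _) hD.
  set X := `|_| + `|_| => hX.
  have X0 : 0 <= X by rewrite addr_ge0.
  have h1 : s e1 ^+ 2 / 4 * X <= s e ^+ 2 * X.
    rewrite ler_wpM2r//.
    have -> : s e1 ^+ 2 / 4 = (s e1 / 2) ^+ 2 by field.
    have s20 : 0 <= s e1 / 2 by rewrite divr_ge0// ltW.
    by rewrite ler_pXn2r// nnegrE ltW.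
  have h2 : C * `|grad ip (f e) (u_ e1)| <=
      (`|C| + 1) * (eps / (4 * (`|C| + 1) / s e1 ^+ 2)).
    apply: (@le_trans _ _ ((`|C| + 1) * `|grad ip (f e) (u_ e1)|)).
      by rewrite ler_wpM2r//; apply: le_trans (ler_norm C) _; rewrite lerDl.
    by rewrite ler_wpM2l// addr_ge0.
  have h3 := le_trans h1 (le_trans hX h2).
  have s4 : 0 < s e1 ^+ 2 / 4 by rewrite divr_gt0.
  rewrite -(ler_pM2l s4); apply: le_trans h3 _.
  have C1 : `|C| + 1 != 0 by rewrite gt_eqF// ltr_wpDl.
  rewrite le_eqVlt; apply/orP; left; apply/eqP.
  by field; rewrite C1 gt_eqF.
have thc1 : th_ e @[e --> e1] --> th_ e1.
  apply/cvgrPdist_le => eps /close; apply: filterS => e; apply: le_trans.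
  by rewrite lerDl.
have wc1 : w e (th_ e) @[e --> e1] --> w e1 (th_ e1).
  apply/cvgrPdist_le => eps /close; apply: filterS => e; apply: le_trans.
  by rewrite lerDr.
have zc : {for th_ e1, continuous z}.
  by apply: differentiable_continuous; have [] := Cz.
have uc : z (th_ e) + w e (th_ e) @[e --> e1] --> u_ e1.
  by rewrite u1E; apply: cvgD wc1; exact: (cvg_comp th_ z thc1 zc).
apply: cvg_trans uc; apply: near_eq_cvg.
by apply: filterS near_e1 => e [e_gt0 ee0]; have [_ _ _ ->] := fact e e_gt0 ee0.
Unshelve. all: by end_near. Qed.

End ReducedSetting.

(** * Passage from the hypotheses on [F], [G] and [z] to the reduced setting *)

Theorem theorem5p1 (R : realType) (E : completeNormedModType R)
  (ip : {dot E for (@idfun R)}) (ip_norm : forall u : E, ip u u = `|u| ^+ 2)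
  (F : E -> R^o) (G : R -> E -> R^o)
  (d : nat) (z : 'rV[R]_d -> E) (alpha : R) (Gam : E -> R^o)
  (HF0 : Ck 2 F)
  (HF1_dim : (1 <= d)%N)
  (HF1_manifold : C2_parametrization z)
  (HF1_crit : forall th, z th = grad ip F (z th))
  (HF2 : forall th, compact_operator (hess ip F (z th)))
  (HF3 : forall th, tangent z th = [set v | v - hess ip F (z th) v = 0])
  (HF4 : Ck 4 F)
  (H_orth : forall th i j, i != j ->
     ip (partial i z th) (partial j z th) = 0)
  (H_norm : exists c : R, forall i th, `|partial i z th| = c)
  (H_second : forall th i j l,
     ip (partial i (partial j z) th) (partial l z th) = 0)
  (HG0_cont : continuous (fun p : R * E => G p.1 p.2))
  (HG0_zero : forall u, G 0 u = 0)
  (HG1 : forall e, Ck 2 (G e))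
  (HG2_grad : continuous (fun p : R * E => grad ip (G p.1) p.2))
  (HG2_hess : continuous (fun p : R * E => hess ip (G p.1) p.2))
  (HG3_alpha : 0 < alpha)
  (HG3_cont : {within range z, continuous Gam})
  (HG3_lim : forall th,
     e `^ (- alpha) * G e (z th) @[e --> 0^'+] --> Gam (z th))
  (HG3_grad : forall th,
     (fun e => grad ip (G e) (z th)) =o_ (0^'+)
     (fun e => e `^ (alpha / 2) : R^o))
  (HG4 : forall e, Ck 4 (G e))
  (HG4_third : continuous (fun p : R * E => third ip (G p.1) p.2))
  (HG4_fourth : forall th, fourth_bounded_near G (z th))
  (HG5_C2 : Ck 2 (Gam \o z))
  (HG5 : forall (th_ : R -> 'rV[R]_d) (th : 'rV[R]_d),
     th_ e @[e --> 0^'+] --> th ->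
     forall i j,
     [/\ e `^ (- alpha) *
           ip (grad ip (G e) (z (th_ e))) (partial i (partial j z) (th_ e)) +
         e `^ (- alpha) *
           ip (hess ip (G e) (z (th_ e)) (partial i z (th_ e)))
              (partial j z (th_ e))
           @[e --> 0^'+] --> (partial i (partial j (Gam \o z)) th : R^o),
         e `^ (- (alpha / 2)) *:
           hess ip (G e) (z (th_ e)) (partial i z (th_ e))
           @[e --> 0^'+] --> (0 : E),
         e `^ (- (alpha / 2)) *:
           hess ip (G e) (z (th_ e)) (partial i (partial j z) (th_ e))
           @[e --> 0^'+] --> (0 : E) &
         e `^ (- (alpha / 2)) *:
           third ip (G e) (z (th_ e)) (partial i z (th_ e))
             (partial j z (th_ e))
           @[e --> 0^'+] --> (0 : E)])
  (w : R -> 'rV[R]_d -> E) (Hw : is_reduction ip (fpert F G) z w)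
  (th : 'rV[R]_d) (th_ : R -> 'rV[R]_d) (u_ : R -> E)
  (Hu : \forall e \near 0^'+,
     [/\ Zpert z w e (u_ e), critical ip (fpert F G e) (u_ e) &
         u_ e = z (th_ e) + w e (th_ e)])
  (Hth : th_ e @[e --> 0^'+] --> th)
  (m0 : nat)
  (Hnondeg : nondegenerate_on ip (orthocomp ip (tangent z th))
               (D2form (fpert F G 0) (z th)))
  (Hmorse : morse_index (orthocomp ip (tangent z th))
              (D2form (fpert F G 0) (z th)) m0)
  (Hdef : posdef_mx (hessian_mx (Gam \o z) th) \/
          negdef_mx (hessian_mx (Gam \o z) th)) :
  (\forall e \near 0^'+,
     [/\ critical ip (fpert F G e) (u_ e),
         nondegenerate_on ip setT (D2form (fpert F G e) (u_ e)),
         posdef_mx (hessian_mx (Gam \o z) th) ->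
           morse_index setT (D2form (fpert F G e) (u_ e)) m0 &
         negdef_mx (hessian_mx (Gam \o z) th) ->
           morse_index setT (D2form (fpert F G e) (u_ e)) (m0 + d)%N]) /\
  (exists2 e0 : R, 0 < e0 & {in `]0, e0[, continuous u_}).
Proof.
have [Cz zinj _] := HF1_manifold.
have [c cE] := H_norm.
have [dz _] := Cz.
pose i0 : 'I_d := Ordinal HF1_dim.
(* If [c] were zero, the immersion [z] would have a vanishing partial derivative; [1 <= d] provides
   an index. *)
have c0 : 0 < c.
  rewrite -(cE i0 th) normr_gt0 (partialE Cz) DopE//; apply/eqP => d0.
  have /(_ (delta_mx 0 i0) 0) := zinj th; rewrite linear0 => /(_ d0).
  move=> /(congr1 (fun x : 'rV[R]_d => x 0 i0)); rewrite !mxE !eqxx/= => /eqP.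
  by rewrite oner_eq0.
have oframe eta : orthoframe ip c (fun i => partial i z eta).
  move=> i j; have [->|ij] := eqVneq i j; last by rewrite H_orth.
  by rewrite ip_norm cE.
pose f := fpert F G.
have cf e : Ck 4 (f e) := Ck_fpert ip_norm HF4 (HG4 e).
pose L := Dop (Dop (f 0)) (z th).
have cf2 e : Ck 2 (f e).
  have [? [? [? _]]] := cf e; split=> //; split=> // x.
  exact: differentiable_continuous.
have Lsym v y : L v y = L y v by exact: (D2_sym (z th) v y (cf2 0)).
pose A0 := hess ip (f 0) (z th).
have A0L v y : ip (A0 v) y = L v y by exact: (hessP ip_norm (f 0) (z th) v y).
(* At [e = 0] the part of [G] is zero, and (F3) puts the tangent vectors into the kernel of the
   rest. *)
have A0tau i : A0 (partial i z th) = 0.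
  apply: (ip_eq ip_norm) => y; rewrite A0L ip0l (partialE Cz).
  apply: etrans (D2form_fpert_tangent ip_norm Cz HF3 HF4 HG4 0 th _ y) _.
  by rewrite (hess_at0 ip_norm HG0_zero) clinear0E ip0l.
have VE : [set v | forall i, ip v (partial i z th) = 0] =
    orthocomp ip (tangent z th).
  by apply/seteqP; split=> v /= hv; apply/(orthocomp_frame _ Cz).
have nondeg : nondegenerate_on ip [set v | forall i, ip v (partial i z th) = 0]
    (form_of L).
  by rewrite VE; exact: Hnondeg.
have morse0 : morse_index [set v | forall i, ip v (partial i z th) = 0]
    (form_of L) m0.
  by rewrite VE; exact: Hmorse.
pose H i j : R := partial i (partial j (Gam \o z)) th.
have HG5' := fun th_ c => HG5 th_ th c.
pose Q := quad_form H; pose s := scale alpha.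
have est k : 0 < k -> expansion_near f z s Q th L k.
  move=> k0; exact: (main_estimates ip_norm HG3_alpha Cz HF1_crit HF3 HF4
    HG0_zero HG2_hess (HG3_grad th) HG4 HG4_third (HG4_fourth th) HG5' k0).
have sgt0 e : 0 < e -> 0 < s e by exact: scale_gt0.
have sle1 e : 0 < e -> e <= 1 -> s e <= 1 by exact: (scale_le1 HG3_alpha).
have sc e : 0 < e -> {for e, continuous s}.
  move=> e0; apply: differentiable_continuous; apply/derivable1_diffP.
  by apply: derivable_powR; rewrite in_itv/= e0.
(* Only [G] depends on [e], and (G2) makes its gradient jointly continuous. *)
have gc u e : 0 < e -> {for e, continuous (fun e => grad ip (f e) u)}.
  move=> _.
  have -> : (fun e => grad ip (f e) u) =
      (fun e => (u - grad ip F u) + grad ip (G e) u).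
    apply/funext => e'; apply: (ip_eq ip_norm) => y.
    apply: etrans (gradP ip_norm (f e') u y) _.
    apply: etrans (Dop_fpert ip_norm HF4 HG4 e' u y) _.
    have E2 : ip (u - grad ip F u + grad ip (G e') u) y =
        ip u y - ip (grad ip F u) y + ip (grad ip (G e') u) y.
      by rewrite ipDl ipBl.
    have aux (a b g x x' : R) : x = b -> x' = g -> a - b + g = a - x + x'.
      by move=> -> ->.
    apply: etrans _ (esym E2).
    exact: aux (gradP ip_norm F u y) (gradP ip_norm (G e') u y).
  apply: cvgD; first exact: cvg_cst.
  have pc : (e', u) @[e' --> e] --> (e, u).
    exact: (@cvg_pair _ _ _ (nbhs e) (nbhs e) (nbhs u) _ _ _ id (fun=> u) cvg_id (cvg_cst u)).
  exact: (cvg_comp (fun e' => (e', u)) (fun p : R * E => grad ip (G p.1) p.2)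
    pc (HG2_grad (e, u))).
have quadE x : (x *m hessian_mx (Gam \o z) th *m x^T) 0 0 = Q x.
  rewrite quad_form_mx /Q; apply: eq_bigr => i _; congr (_ * _).
  by apply: eq_bigr => j _; rewrite mxE.
have crit : \forall e \near 0^'+, u_ e = z (th_ e) + w e (th_ e) /\
    forall y, (Dop (f e) (u_ e) y : R) = 0.
  apply: filterS Hu => e [_ [_ g0] uE]; split=> // y.
  apply: etrans (esym (gradP ip_norm (f e) (u_ e) y)) _.
  by rewrite g0 ip0l.
have wsmall (r : R) : 0 < r ->
    small_near th (fun e eta => `|w e eta| <= r * s e).
  exact: (reduction_small ip_norm cf sgt0 sle1 est Cz c0 oframe Lsym A0L A0tau
    nondeg Hw).
(* Transfers a statement uniform in [eta] and in small [w'] to the family [u_], where [w] is o(s)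
   and [f e] is critical. *)
have along (r : R) (Prop_ : R -> E -> Prop) : 0 < r ->
    small_near th (fun e eta => forall w', `|w'| <= r * s e ->
      (forall y, (Dop (f e) (z eta + w') y : R) = 0) -> Prop_ e (z eta + w')) ->
    \forall e \near 0^'+, Prop_ e (u_ e).
  move=> r0 nP.
  have := small_near_along (small_nearI (wsmall r r0) nP) Hth.
  move=> n1; apply: filterS2 n1 crit => e [we Pe] [uE Dfe].
  by have := Pe _ we; rewrite -uE; exact.
(* The conclusion contains both implications on the index; the one whose premise fails is discharged
   by this contradiction, for which [1 <= d] provides a nonzero vector. *)
have contra_def : posdef_mx (hessian_mx (Gam \o z) th) ->
    negdef_mx (hessian_mx (Gam \o z) th) -> False.
  move=> hp hn; pose x : 'rV[R]_d := delta_mx 0 i0.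
  have xn : x != 0.
    apply/eqP => /(congr1 (fun x : 'rV[R]_d => x 0 i0)).
    by rewrite !mxE !eqxx/= => /eqP; rewrite oner_eq0.
  by have := lt_trans (hp x xn) (hn x xn); rewrite ltxx.
have [k0 k00 hQ] : exists2 k0, 0 < k0 &
    (posdef_mx (hessian_mx (Gam \o z) th) /\ forall h, k0 * `|h| ^+ 2 <= Q h) \/
    (negdef_mx (hessian_mx (Gam \o z) th) /\
      forall h, Q h <= - (k0 * `|h| ^+ 2)).
  have [hp|hn] := Hdef.
    have [h hn|k0 k00 hQ] := @posdef_coercive R d H.
      by have := hp h hn; rewrite quadE.
    by exists k0 => //; left.
  have QN h : quad_form (fun i j => - H i j) h = - Q h.
    rewrite /Q /quad_form -sumrN; apply: eq_bigr => i _; rewrite -mulrN -sumrN.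
    by congr (_ * _); apply: eq_bigr => j _; rewrite mulrN.
  have [h hn'|k0 k00 hQ] := @posdef_coercive R d (fun i j => - H i j).
    by rewrite QN oppr_gt0 -quadE; exact: hn.
  by exists k0 => //; right; split=> // h; rewrite lerNr -QN.
have absQ h : k0 * `|h| ^+ 2 <= `|Q h|.
  case: hQ => [[_ hQ]|[_ hQ]]; first exact: le_trans (hQ h) (ler_norm _).
  rewrite -[`|Q h|]normrN; apply: (@le_trans _ _ (- Q h)); last exact: ler_norm.
  by rewrite lerNr; exact: hQ.
split; last first.
  exact: (critical_curve_continuous ip_norm cf sgt0 sle1 est Cz c0 oframe Lsym
    A0L A0tau nondeg Hw k00 absQ sc gc Hth crit).
have [r1 r10 n1] := reduced_nondegenerate ip_norm cf sgt0 sle1 est Cz c0 oframe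
  Lsym A0L A0tau nondeg k00 absQ.
have nd := along r1 (fun e u => nondegenerate_on ip setT (D2form (f e) u)) r10 n1.
case: hQ => [[hp hQ]|[hn hQ]].
  have [r2 r20 n2] := reduced_morse_pos ip_norm cf sgt0 sle1 est Cz c0 oframe
    Lsym A0L A0tau nondeg k00 morse0 hQ.
  have mo := along r2 (fun e u => morse_index setT (D2form (f e) u) m0) r20 n2.
  apply: filterS3 Hu nd mo => e [_ cr _] nde moe.
  exact: (And4 cr nde (fun _ => moe)
    (fun hn => False_ind _ (contra_def hp hn))).
have [r2 r20 n2] := reduced_morse_neg ip_norm cf sgt0 sle1 est Cz c0 oframe
  Lsym A0L A0tau nondeg k00 morse0 hQ.
have mo := along r2 (fun e u => morse_index setT (D2form (f e) u) (m0 + d)%N) r20 n2.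
apply: filterS3 Hu nd mo => e [_ cr _] nde moe.
exact: (And4 cr nde (fun hp => False_ind _ (contra_def hp hn)) (fun _ => moe)).
Qed.
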